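(* The sharp $\mathcal{S}^*_{\mathfrak{B}}$-radii for the classes $\mathcal{S}^*(e^z)$, $\mathcal{S}^*(2/(1+e^{-z}))$, $\mathcal{S}^*(z+\sqrt{1+z^2})$ and $\mathcal{S}^*(1+ze^z)$ are given by: (i) $R_{\mathcal{S}^*_{\mathfrak{B}}}(\mathcal{S}^*(e^z))=1+\log\left(\sqrt{2/(1+e^2)}\right)\simeq0.28311$. (ii) $R_{\mathcal{S}^*_{\mathfrak{B}}}(\mathcal{S}^*(2/(1+e^{-z})))=-\log\left(e^{-1}\sqrt{2(1+e^2)}-1\right)\simeq0.679492$. (iii) $R_{\mathcal{S}^*_{\mathfrak{B}}}(\mathcal{S}^*(z+\sqrt{1+z^2}))=(e^2-1)/\left(2e\sqrt{2(e^2+1)}\right)\simeq0.2869$. (iv) $R_{\mathcal{S}^*_{\mathfrak{B}}}(\mathcal{S}^*(1+ze^z))=r_{\varrho}\simeq0.253877$, where $r_{\varrho}$ is the smallest positive root of the equation $\sqrt{1+e^2}\,(1+re^r)=\sqrt{2}\,e$.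
   Context: $\mathbb{D}$ is the open unit disk. $\mathcal{A}$ is the class of analytic functions $f$ in $\mathbb{D}$ with $f(z)=z+\sum_{n\ge2}a_nz^n$, and $\mathcal{S}\subset\mathcal{A}$ is the subclass of univalent functions. $f\prec g$ (subordination) means $f=g\circ w$ for some analytic $w:\mathbb{D}\to\mathbb{D}$ with $w(0)=0$. For $\psi$ analytic in $\mathbb{D}$ with $\psi(0)=1$, $\mathcal{S}^*(\psi)=\{f\in\mathcal{S}: zf'(z)/f(z)\prec\psi(z)\}$. $\mathfrak{B}(z)=\sqrt{1+\tanh z}$, and $\mathcal{S}^*_{\mathfrak{B}}=\mathcal{S}^*(\mathfrak{B})$. Square roots are principal branches. For a class $\mathcal{G}\subset\mathcal{A}$, the (sharp) $\mathcal{S}^*_{\mathfrak{B}}$-radius $R_{\mathcal{S}^*_{\mathfrak{B}}}(\mathcal{G})$ is the largest $R\in(0,1]$ such that for every $f\in\mathcal{G}$ and every $0<r\le R$ the function $z\mapsto f(rz)/r$ belongs to $\mathcal{S}^*_{\mathfrak{B}}$. *)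

(* Defs.v *)
From Stdlib Require Import Reals.
From Coquelicot Require Import Coquelicot.

Open Scope R_scope.

Definition in_disk (z : C) : Prop := Cmod z < 1.

(** Analytic in the unit disk means complex differentiable at each of its
    points.  Functions are total on [C]; their values off the disk play no
    role anywhere below. *)
Definition analytic_in_disk (f : C -> C) : Prop :=
  forall z, in_disk z -> @ex_derive C_AbsRing C_NormedModule f z.

Definition univalent_in_disk (f : C -> C) : Prop :=
  forall z1 z2, in_disk z1 -> in_disk z2 -> f z1 = f z2 -> z1 = z2.

(** [f z = z + sum_(n >= 2) a_n z^n] on the disk, the sum running over
    [n = k + 2]. *)
Definition class_A (f : C -> C) : Prop :=
  analytic_in_disk f /\
  exists a : nat -> C, forall z, in_disk z ->
    @is_series C_AbsRing C_NormedModule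
      (fun k => a (k + 2)%nat * z ^ (k + 2))%C (f z - z)%C.

Definition class_S (f : C -> C) : Prop := class_A f /\ univalent_in_disk f.

Definition subordinate (f g : C -> C) : Prop :=
  exists w : C -> C,
    analytic_in_disk w /\
    (forall z, in_disk z -> in_disk (w z)) /\
    w (RtoC 0) = RtoC 0 /\
    (forall z, in_disk z -> f z = g (w z)).

(** [z f'(z) / f(z)], with its removable singularity at [0] filled in: for
    [f] in [class_A] the limit there is [1]. *)
Definition log_ratio (f : C -> C) (z : C) : C :=
  if Ceq_dec z (RtoC 0) then RtoC 1 else (z * C_derive f z / f z)%C.

Definition Sstar (psi : C -> C) (f : C -> C) : Prop :=
  class_S f /\ subordinate (log_ratio f) psi.

Definition Cexp (z : C) : C :=
  (exp (Re z) * cos (Im z), exp (Re z) * sin (Im z)).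

Definition Ctanh (z : C) : C :=
  ((Cexp z - Cexp (- z)) / (Cexp z + Cexp (- z)))%C.

(** Principal branch: the square root of nonnegative real part, and the one in
    the upper half plane on the negative real axis. *)
Definition Csqrt (z : C) : C :=
  (sqrt ((Cmod z + Re z) / 2),
   (if Rle_dec 0 (Im z) then 1 else -1) * sqrt ((Cmod z - Re z) / 2)).

Definition frakB (z : C) : C := Csqrt (RtoC 1 + Ctanh z)%C.

Definition psi_exp (z : C) : C := Cexp z.
Definition psi_sigmoid (z : C) : C :=
  (RtoC 2 / (RtoC 1 + Cexp (- z)))%C.
Definition psi_crescent (z : C) : C :=
  (z + Csqrt (RtoC 1 + z ^ 2))%C.
Definition psi_cardioid (z : C) : C :=
  (RtoC 1 + z * Cexp z)%C.

Definition dilate (f : C -> C) (r : R) : C -> C :=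
  fun z => (f (RtoC r * z) / RtoC r)%C.

Definition dilations_in (F G : (C -> C) -> Prop) (rho : R) : Prop :=
  forall f, G f -> forall r, 0 < r <= rho -> F (dilate f r).

(** [rho] is the sharp [F]-radius of the class [G]. *)
Definition is_radius (F G : (C -> C) -> Prop) (rho : R) : Prop :=
  (0 < rho <= 1 /\ dilations_in F G rho) /\
  (forall rho', 0 < rho' <= 1 -> dilations_in F G rho' -> rho' <= rho).

Definition is_smallest_positive_root (g h : R -> R) (x : R) : Prop :=
  (0 < x /\ g x = h x) /\ (forall y, 0 < y -> g y = h y -> x <= y).

(* Main.v *)
(** If [z f' / f = psi o w0] then [|w0 z| <= |z|] by the Schwarz lemma, so [f (r z) / r] lies in the class of [frakB] as
    soon as [W = frakB^-1 o psi] maps the disk of radius [r] into the unit disk.  Here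
    [exp (2 W) = psi ^ 2 / (2 - psi ^ 2)]; for each of the four [psi] the modulus of [W] (or of its derivative) at [z] is
    at most that of its value at [|z|], by the triangle inequality applied to expansions with nonnegative coefficients,
    so the bound [|W z| < 1] holds up to the real point [rho] with [psi rho = frakB 1].  Sharpness comes from the
    function [f] with [z f' / f = psi], which is univalent since [Re psi > 0]: there [z f' / f] takes the boundary value
    [frakB 1] at [rho]. *)

Require Import Defs.
From Stdlib Require Import Reals Lra Lia Psatz ZArith Arith Factorial Ranalysis5.
From Coquelicot Require Import Coquelicot.
Open Scope R_scope.

(** Every radius solves psi(rho) = b with b = frakB 1, where b^2 = 1 + tanh 1 = 2 e^2 / (1 + e^2);
    this is the origin of the constant in all numerical bounds. The equation for exp (2 W) fixes [W]
    only up to a period, so [W] is built from [log1m], whose argument must be shown to stay in the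
    unit disk. For e^z and the sigmoid, W = z - (1/2) log (1 - G) where G has nonnegative
    coefficients, and the triangle inequality applies to [W] itself. For the crescent and the
    cardioid, [W] contains log psi, that is arcsinh z or log (1 + g), whose coefficients have both
    signs: estimating the two logarithms separately would overshoot the value at the real point. In
    W' the two parts combine into one fraction for which the triangle inequality is sharp on the
    real axis, so W' is bounded and the bound is integrated along rays. This integration replaces
    any manipulation of coefficients of [W]. *)

Ltac c_ring := unfold Re, Im, RtoC, Cminus, Cplus, Copp, Cmult, Cconj, Ci; simpl; ring.

(** * Complex differentiability *)

Definition cderiv (f : C -> C) (z l : C) : Prop :=
  forall eps, 0 < eps -> exists d, 0 < d /\ forall h : C, Cmod h < d ->
    Cmod (f (z + h) - f z - l * h)%C <= eps * Cmod h.

Lemma cderiv_is_derive_abs (f : C -> C) (z l : C) :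
  cderiv f z l <-> @is_derive C_AbsRing (AbsRing_NormedModule C_AbsRing) f z l.
Proof.
  split.
  - intros H. split; [apply is_linear_scal_l|].
    intros x Hx.
    apply (@is_filter_lim_locally_unique C_AbsRing (AbsRing_NormedModule C_AbsRing)) in Hx.
    subst x. intros eps.
    destruct (H eps (cond_pos eps)) as [d [Hd H1]].
    exists (mkposreal d Hd). intros y Hy.
    change (Cmod (y - z)%C < d) in Hy.
    specialize (H1 (y - z)%C Hy).
    change (Cmod (f y - f z - (y - z) * l)%C <= eps * Cmod (y - z)%C).
    rewrite (Cmult_comm (y - z) l).
    assert (E : forall u v : C, (u + (v - u))%C = v) by (intros; ring).
    rewrite E in H1. exact H1.
  - intros [_ H] eps Heps.
    destruct (H z (fun P H => H) (mkposreal eps Heps)) as [d Hd].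
    exists d. split; [apply cond_pos|]. intros h Hh.
    specialize (Hd (z + h)%C).
    change (Cmod ((z + h) - z)%C < d ->
       Cmod (f (z + h) - f z - ((z + h) - z) * l)%C <= eps * Cmod ((z + h) - z)%C) in Hd.
    assert (E : forall u v : C, (u + v - u)%C = v) by (intros; ring).
    rewrite E in Hd. rewrite (Cmult_comm l h). auto.
Qed.

(** [C] carries two normed-module structures: the differentiation rules are taken over
    [AbsRing_NormedModule C_AbsRing], the definitions use [C_NormedModule]. Their norms agree, so
    the little-o clause is shared verbatim and only the linearity record is rebuilt. *)
Lemma cderiv_is_derive (f : C -> C) (z l : C) :
  cderiv f z l <-> @is_derive C_AbsRing C_NormedModule f z l.
Proof.
  rewrite cderiv_is_derive_abs.
  split; intros [[A B D] H]; (split; [|exact H]); split;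
    [exact A|exact B|exact D|exact A|exact B|exact D].
Qed.

Lemma cderiv_eq (f : C -> C) (z l l' : C) : cderiv f z l -> l = l' -> cderiv f z l'.
Proof. intros H <-; exact H. Qed.

Lemma cderiv_ext_loc (f g : C -> C) (z l : C) (d : R) : 0 < d ->
  (forall h, Cmod h < d -> f (z + h)%C = g (z + h)%C) -> cderiv f z l -> cderiv g z l.
Proof.
  intros Hd E H eps Heps. destruct (H eps Heps) as [d1 [Hd1 H1]].
  exists (Rmin d d1). split; [apply Rmin_pos; lra|]. intros h Hh.
  rewrite <- (E h); [|eapply Rlt_le_trans; [exact Hh|apply Rmin_l]].
  assert (E0 : f z = g z).
  { specialize (E 0%C). rewrite Cmod_0 in E. replace (z + 0)%C with z in E by ring. auto. }
  rewrite <- E0. apply H1. eapply Rlt_le_trans; [exact Hh|apply Rmin_r].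
Qed.

Lemma cderiv_const (c z : C) : cderiv (fun _ => c) z 0.
Proof. apply cderiv_is_derive_abs, @is_derive_const. Qed.

Lemma cderiv_id (z : C) : cderiv (fun x => x) z 1.
Proof. apply cderiv_is_derive_abs, @is_derive_id. Qed.

Lemma cderiv_plus (f g : C -> C) (z a b : C) :
  cderiv f z a -> cderiv g z b -> cderiv (fun x => f x + g x)%C z (a + b).
Proof. rewrite !cderiv_is_derive_abs. apply @is_derive_plus. Qed.

Lemma cderiv_opp (f : C -> C) (z a : C) :
  cderiv f z a -> cderiv (fun x => - f x)%C z (- a).
Proof. rewrite !cderiv_is_derive_abs. apply @is_derive_opp. Qed.

Lemma cderiv_minus (f g : C -> C) (z a b : C) :
  cderiv f z a -> cderiv g z b -> cderiv (fun x => f x - g x)%C z (a - b).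
Proof. rewrite !cderiv_is_derive_abs. apply @is_derive_minus. Qed.

Lemma cderiv_mult (f g : C -> C) (z a b : C) :
  cderiv f z a -> cderiv g z b -> cderiv (fun x => f x * g x)%C z (a * g z + f z * b).
Proof.
  rewrite !cderiv_is_derive_abs. intros Hf Hg.
  apply (@is_derive_mult C_AbsRing f g z a b Hf Hg). apply Cmult_comm.
Qed.

Lemma cderiv_comp (f g : C -> C) (z a b : C) :
  cderiv f (g z) a -> cderiv g z b -> cderiv (fun x => f (g x)) z (a * b).
Proof.
  rewrite !cderiv_is_derive_abs. intros Hf Hg.
  replace (a * b)%C with (@scal C_Ring (AbsRing_NormedModule C_AbsRing) b a)
    by (change (b * a = a * b)%C; ring).
  apply (@is_derive_comp C_AbsRing (AbsRing_NormedModule C_AbsRing) f g z a b Hf Hg).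
Qed.

Lemma Cmod_minus_le (a b : C) : Cmod (a - b)%C <= Cmod a + Cmod b.
Proof. unfold Cminus. rewrite <- (Cmod_opp b). apply Cmod_triangle. Qed.

Lemma Cmod_minus_ge (a b : C) : Cmod a - Cmod b <= Cmod (a - b)%C.
Proof.
  assert (H := Cmod_triangle (a - b)%C b). replace (a - b + b)%C with a in H by ring. lra.
Qed.

Lemma cderiv_continuous (f : C -> C) (z l : C) : cderiv f z l ->
  forall eps, 0 < eps -> exists d, 0 < d /\ forall h : C, Cmod h < d -> Cmod (f (z + h) - f z)%C < eps.
Proof.
  intros H eps Heps. destruct (H 1 Rlt_0_1) as [d [Hd H1]].
  assert (P : 0 < 1 + Cmod l + 1) by (generalize (Cmod_ge_0 l); lra).
  exists (Rmin d (eps / (1 + Cmod l + 1))).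
  split; [apply Rmin_pos; [lra|apply Rdiv_lt_0_compat; lra]|].
  intros h Hh.
  assert (A : Cmod h < d) by (eapply Rlt_le_trans; [exact Hh|apply Rmin_l]).
  assert (B : Cmod h < eps / (1 + Cmod l + 1)) by (eapply Rlt_le_trans; [exact Hh|apply Rmin_r]).
  apply Rlt_div_r in B; [|lra].
  specialize (H1 h A).
  assert (T := Cmod_triangle (f (z + h) - f z - l * h)%C (l * h)%C).
  replace (f (z + h) - f z - l * h + l * h)%C with (f (z + h) - f z)%C in T by ring.
  rewrite Cmod_mult in T. generalize (Cmod_ge_0 h) (Cmod_ge_0 l); nra.
Qed.

Lemma cderiv_inv_base (z : C) : z <> 0 -> cderiv Cinv z (- / (z * z)).
Proof.
  intros Hz eps Heps.
  assert (P : 0 < Cmod z) by (apply Cmod_gt_0; auto).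
  set (m := Cmod z) in *.
  (* The first bound keeps |z + h| above m/2. The remainder is h^2 / ((z + h) z^2), of modulus at
     most 2 |h|^2 / m^3, and the second bound brings this below eps |h|. *)
  exists (Rmin (m / 2) (eps * (m * m * m) / 2)).
  assert (P3 : 0 < m * m * m) by (repeat apply Rmult_lt_0_compat; auto).
  split; [apply Rmin_pos; [lra|nra]|].
  intros h Hh.
  assert (A : Cmod h < m / 2) by (eapply Rlt_le_trans; [exact Hh|apply Rmin_l]).
  assert (B : Cmod h < eps * (m * m * m) / 2) by (eapply Rlt_le_trans; [exact Hh|apply Rmin_r]).
  assert (Q : m / 2 < Cmod (z + h)).
  { assert (T := Cmod_minus_ge z (- h)). rewrite Cmod_opp in T.
    replace (z - - h)%C with (z + h)%C in T by ring. fold m in T. lra. }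
  assert (Hzh : (z + h)%C <> 0) by (apply Cmod_gt_0; lra).
  replace (/ (z + h) - / z - - / (z * z) * h)%C with (h * h / ((z + h) * (z * z)))%C
    by (field; auto).
  rewrite Cmod_div, !Cmod_mult by (repeat apply Cmult_neq_0; auto). fold m.
  apply Rle_div_l; [apply Rmult_lt_0_compat; [lra|nra]|].
  assert (G := Cmod_ge_0 h).
  apply Rle_trans with (eps * Cmod h * (m / 2 * (m * m))); [nra|].
  apply Rmult_le_compat_l; [nra|]. apply Rmult_le_compat_r; nra.
Qed.

Lemma cderiv_inv (f : C -> C) (z a : C) : f z <> 0 ->
  cderiv f z a -> cderiv (fun x => / f x)%C z (- a / (f z * f z)).
Proof.
  intros Hz H. eapply cderiv_eq; [apply (cderiv_comp Cinv f); [apply cderiv_inv_base, Hz|exact H]|].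
  field. auto.
Qed.

Lemma cderiv_div (f g : C -> C) (z a b : C) : g z <> 0 ->
  cderiv f z a -> cderiv g z b ->
  cderiv (fun x => f x / g x)%C z ((a * g z - f z * b) / (g z * g z)).
Proof.
  intros Hz Hf Hg. eapply cderiv_eq;
   [apply (cderiv_mult f (fun x => / g x)%C); [exact Hf|apply cderiv_inv; eassumption]|].
  field. auto.
Qed.

Lemma cderiv_pow (n : nat) (z : C) : cderiv (fun x => x ^ n)%C z (RtoC (INR n) * z ^ (n - 1)).
Proof.
  induction n as [|n IH].
  - eapply cderiv_eq; [apply (cderiv_const 1)|]. simpl. ring.
  - eapply cderiv_eq; [apply (cderiv_mult (fun x => x) (fun x => x ^ n)%C);
      [apply cderiv_id|apply IH]|].
    replace (S n - 1)%nat with n by lia. rewrite S_INR, RtoC_plus.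
    destruct n as [|n]; [simpl; ring|].
    replace (S n - 1)%nat with n by lia. rewrite Cpow_S. ring.
Qed.

(** * Complex-valued curves *)

(** Taken by components because the real mean value theorem and the real integral act on components;
    [curve_deriv_eps] is the form in which the chain rule is proved. *)
Definition curve_deriv (g : R -> C) (t : R) (v : C) : Prop :=
  is_derive (fun s => Re (g s)) t (Re v) /\ is_derive (fun s => Im (g s)) t (Im v).

Lemma Re_plus (a b : C) : Re (a + b)%C = Re a + Re b. Proof. reflexivity. Qed.
Lemma Im_plus (a b : C) : Im (a + b)%C = Im a + Im b. Proof. reflexivity. Qed.
Lemma Re_minus (a b : C) : Re (a - b)%C = Re a - Re b. Proof. reflexivity. Qed.
Lemma Im_minus (a b : C) : Im (a - b)%C = Im a - Im b. Proof. reflexivity. Qed.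
Lemma Re_mult (a b : C) : Re (a * b)%C = Re a * Re b - Im a * Im b. Proof. reflexivity. Qed.
Lemma Im_mult (a b : C) : Im (a * b)%C = Re a * Im b + Im a * Re b. Proof. reflexivity. Qed.
Lemma C_ext (a b : C) : Re a = Re b -> Im a = Im b -> a = b.
Proof. destruct a, b; simpl. intros -> ->; reflexivity. Qed.

Lemma is_derive_eps (f : R -> R) (t l : R) :
  is_derive f t l <->
  (forall eps, 0 < eps -> exists d, 0 < d /\ forall s, Rabs s < d ->
     Rabs (f (t + s) - f t - l * s) <= eps * Rabs s).
Proof.
  split.
  - intros [_ H] eps Heps.
    destruct (H t (fun P H => H) (mkposreal eps Heps)) as [d Hd].
    exists d. split; [apply cond_pos|]. intros h Hh.
    specialize (Hd (t + h)).
    change (Rabs ((t + h) - t) < d ->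
       Rabs (f (t + h) - f t - ((t + h) - t) * l) <= eps * Rabs ((t + h) - t)) in Hd.
    assert (E : forall u v : R, u + v - u = v) by (intros; ring).
    rewrite E in Hd. rewrite (Rmult_comm l h). auto.
  - intros H. split; [apply is_linear_scal_l|].
    intros x Hx.
    apply (@is_filter_lim_locally_unique R_AbsRing (AbsRing_NormedModule R_AbsRing)) in Hx.
    subst x. intros eps.
    destruct (H eps (cond_pos eps)) as [d [Hd H1]].
    exists (mkposreal d Hd). intros y Hy.
    change (Rabs (y - t) < d) in Hy.
    specialize (H1 (y - t) Hy).
    change (Rabs (f y - f t - (y - t) * l) <= eps * Rabs (y - t)).
    rewrite (Rmult_comm (y - t) l).
    assert (E : forall u v : R, u + (v - u) = v) by (intros; ring).
    rewrite E in H1. exact H1.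
Qed.

Lemma Im_le_Cmod (c : C) : Rabs (Im c) <= Cmod c.
Proof. eapply Rle_trans; [apply Rmax_r|apply (Rmax_Cmod c)]. Qed.

Lemma Cmod_le_Re_Im (c : C) : Cmod c <= Rabs (Re c) + Rabs (Im c).
Proof.
  replace c with (RtoC (Re c) + Ci * RtoC (Im c))%C at 1
    by (apply C_ext; c_ring).
  eapply Rle_trans; [apply Cmod_triangle|].
  rewrite Cmod_mult, Cmod_Ci, !Cmod_R. lra.
Qed.

Lemma curve_deriv_eps (g : R -> C) (t : R) (v : C) :
  curve_deriv g t v <->
  (forall eps, 0 < eps -> exists d, 0 < d /\ forall s, Rabs s < d ->
     Cmod (g (t + s)%R - g t - v * RtoC s)%C <= eps * Rabs s).
Proof.
  unfold curve_deriv. rewrite !is_derive_eps. split.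
  - intros [A B] eps Heps.
    destruct (A (eps / 2)) as [d1 [Hd1 H1]]; [lra|].
    destruct (B (eps / 2)) as [d2 [Hd2 H2]]; [lra|].
    exists (Rmin d1 d2). split; [apply Rmin_pos; auto|]. intros s Hs.
    specialize (H1 s (Rlt_le_trans _ _ _ Hs (Rmin_l _ _))).
    specialize (H2 s (Rlt_le_trans _ _ _ Hs (Rmin_r _ _))).
    eapply Rle_trans; [apply Cmod_le_Re_Im|].
    replace (Re (g (t + s)%R - g t - v * RtoC s)%C) with (Re (g (t + s)) - Re (g t) - Re v * s)
      by c_ring.
    replace (Im (g (t + s)%R - g t - v * RtoC s)%C) with (Im (g (t + s)) - Im (g t) - Im v * s)
      by c_ring.
    lra.
  - intros H. split; intros eps Heps; destruct (H eps Heps) as [d [Hd H1]];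
      exists d; (split; [exact Hd|]); intros s Hs; (eapply Rle_trans; [|apply H1, Hs]).
    + eapply Rle_trans; [|apply re_le_Cmod]. right. f_equal. c_ring.
    + eapply Rle_trans; [|apply Im_le_Cmod]. right. f_equal. c_ring.
Qed.

Lemma curve_deriv_comp (f : C -> C) (g : R -> C) (t : R) (l v : C) :
  cderiv f (g t) l -> curve_deriv g t v -> curve_deriv (fun s => f (g s)) t (l * v).
Proof.
  rewrite !curve_deriv_eps. intros Hf Hg eps Heps.
  destruct (Hg 1 Rlt_0_1) as [d1 [Hd1 H1]].
  set (K := Cmod v + 1). assert (HK : 0 < K) by (unfold K; generalize (Cmod_ge_0 v); lra).
  assert (HL : 0 < Cmod l + 1) by (generalize (Cmod_ge_0 l); lra).
  destruct (Hf (eps / 2 / K)) as [d2 [Hd2 H2]]; [apply Rdiv_lt_0_compat; lra|].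
  destruct (Hg (eps / 2 / (Cmod l + 1))) as [d3 [Hd3 H3]]; [apply Rdiv_lt_0_compat; lra|].
  exists (Rmin (Rmin d1 d3) (d2 / K)).
  split; [repeat apply Rmin_pos; auto; apply Rdiv_lt_0_compat; lra|].
  intros s Hs.
  assert (S1 : Rabs s < d1) by (eapply Rlt_le_trans; [exact Hs|eapply Rle_trans; [apply Rmin_l|apply Rmin_l]]).
  assert (S3 : Rabs s < d3) by (eapply Rlt_le_trans; [exact Hs|eapply Rle_trans; [apply Rmin_l|apply Rmin_r]]).
  assert (S2 : Rabs s < d2 / K) by (eapply Rlt_le_trans; [exact Hs|apply Rmin_r]).
  apply Rlt_div_r in S2; [|lra].
  specialize (H1 s S1). specialize (H3 s S3).
  set (h := (g (t + s)%R - g t)%C).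
  assert (Hh : Cmod h <= K * Rabs s).
  { unfold h, K. assert (T := Cmod_triangle (g (t + s)%R - g t - v * RtoC s)%C (v * RtoC s)%C).
    replace (g (t + s)%R - g t - v * RtoC s + v * RtoC s)%C with (g (t + s)%R - g t)%C in T by ring.
    rewrite Cmod_mult, Cmod_R in T. lra. }
  specialize (H2 h).
  assert (Hh2 : Cmod h < d2) by (eapply Rle_lt_trans; [exact Hh|lra]).
  specialize (H2 Hh2).
  replace (g t + h)%C with (g (t + s)%R) in H2 by (unfold h; ring).
  (* The remainder of the composite is the remainder of [f] at the increment [h] plus [l] times the
     remainder of [g]; each receives half of eps. *)
  replace (f (g (t + s)%R) - f (g t) - l * v * RtoC s)%C with
    ((f (g (t + s)%R) - f (g t) - l * h) + l * (g (t + s)%R - g t - v * RtoC s))%C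
    by (unfold h; ring).
  eapply Rle_trans; [apply Cmod_triangle|]. rewrite Cmod_mult.
  assert (Z := Rabs_pos s).
  assert (A1 : eps / 2 / K * Cmod h <= eps / 2 * Rabs s).
  { apply Rle_trans with (eps / 2 / K * (K * Rabs s)).
    - apply Rmult_le_compat_l; [apply Rlt_le, Rdiv_lt_0_compat; lra|exact Hh].
    - right. field. lra. }
  assert (A2 : Cmod l * Cmod (g (t + s)%R - g t - v * RtoC s) <= eps / 2 * Rabs s).
  { apply Rle_trans with ((Cmod l + 1) * (eps / 2 / (Cmod l + 1) * Rabs s)).
    - apply Rmult_le_compat; try apply Cmod_ge_0; lra.
    - right. field. lra. }
  lra.
Qed.

Lemma curve_deriv_eq (g : R -> C) (t : R) (v v' : C) :
  curve_deriv g t v -> v = v' -> curve_deriv g t v'.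
Proof. intros H <-; exact H. Qed.

Lemma curve_deriv_line (a b : C) (t : R) : curve_deriv (fun s => a + RtoC s * b)%C t b.
Proof.
  split; simpl; auto_derive; auto; unfold Re, Im; simpl; ring.
Qed.

Lemma curve_deriv_mult (f g : R -> C) (t : R) (a b : C) :
  curve_deriv f t a -> curve_deriv g t b ->
  curve_deriv (fun s => f s * g s)%C t (a * g t + f t * b).
Proof.
  intros [A1 A2] [B1 B2].
  assert (comm : forall n m : R_AbsRing, mult n m = mult m n) by (intros; apply Rmult_comm).
  split.
  - apply (is_derive_ext (fun s => Re (f s) * Re (g s) - Im (f s) * Im (g s))); [reflexivity|].
    replace (Re (a * g t + f t * b)%C) with
     ((Re a * Re (g t) + Re (f t) * Re b) - (Im a * Im (g t) + Im (f t) * Im b)) by c_ring.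
    apply @is_derive_minus; apply (@is_derive_mult R_AbsRing); auto.
  - apply (is_derive_ext (fun s => Re (f s) * Im (g s) + Im (f s) * Re (g s))); [reflexivity|].
    replace (Im (a * g t + f t * b)%C) with
     ((Re a * Im (g t) + Re (f t) * Im b) + (Im a * Re (g t) + Im (f t) * Re b)) by c_ring.
    apply @is_derive_plus; apply (@is_derive_mult R_AbsRing); auto.
Qed.

Lemma curve_deriv_const (c : C) (t : R) : curve_deriv (fun _ => c) t 0.
Proof. split; simpl; apply @is_derive_const. Qed.

Lemma curve_deriv_scal (c : C) (g : R -> C) (t : R) (v : C) :
  curve_deriv g t v -> curve_deriv (fun s => c * g s)%C t (c * v).
Proof.
  intros H. eapply curve_deriv_eq; [apply (curve_deriv_mult (fun _ => c) g); [apply curve_deriv_const|exact H]|].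
  ring.
Qed.

(* Projecting onto the direction of the total increment reduces the claim to the real mean value theorem. *)
Lemma curve_mvt_le (g g' : R -> C) (p p' : R -> R) (a b : R) : a <= b ->
  (forall t, a <= t <= b -> curve_deriv g t (g' t)) ->
  (forall t, a <= t <= b -> is_derive p t (p' t)) ->
  (forall t, a <= t <= b -> Cmod (g' t) <= p' t) ->
  Cmod (g b - g a)%C <= p b - p a.
Proof.
  intros Hab Hg Hp Hle.
  set (D := (g b - g a)%C).
  destruct (Req_dec (Cmod D) 0) as [E|E].
  - rewrite E.
    destruct (MVT_gen p a b p') as [c [Hc Ec]];
      rewrite ?Rmin_left, ?Rmax_right in * by lra.
    + intros x Hx. apply Hp. lra.
    + intros x Hx. apply continuity_pt_filterlim, (ex_derive_continuous p). eexists; apply Hp; lra.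
    + rewrite Ec. specialize (Hle c Hc). generalize (Cmod_ge_0 (g' c)). nra.
  - assert (P : 0 < Cmod D) by (generalize (Cmod_ge_0 D); lra).
    set (q := fun t => Re (Cconj D * g t)%C - Cmod D * p t).
    set (q' := fun t => Re (Cconj D * g' t)%C - Cmod D * p' t).
    assert (Hq : forall t, a <= t <= b -> is_derive q t (q' t)).
    { intros t Ht. apply @is_derive_minus; [apply (curve_deriv_scal (Cconj D) g t (g' t)); auto|].
      apply @is_derive_scal. auto. }
    destruct (MVT_gen q a b q') as [c [Hc Ec]];
      rewrite ?Rmin_left, ?Rmax_right in * by lra.
    + intros x Hx. apply Hq. lra.
    + intros x Hx. apply continuity_pt_filterlim, (ex_derive_continuous q). eexists; apply Hq; lra.
    + assert (N : q' c <= 0).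
      { unfold q'. assert (T := re_le_Cmod (Cconj D * g' c)).
        rewrite Cmod_mult, Cmod_conj in T.
        assert (T2 := Rle_abs (Re (Cconj D * g' c)%C)).
        specialize (Hle c Hc). nra. }
      assert (F : q b - q a = Cmod D * (Cmod D - (p b - p a))).
      { unfold q. replace (Re (Cconj D * g b) - Cmod D * p b - (Re (Cconj D * g a) - Cmod D * p a))
          with (Re (Cconj D * D)%C - Cmod D * (p b - p a)) by (unfold D; c_ring).
        replace (Re (Cconj D * D)%C) with (Cmod D ^ 2); [ring|].
        rewrite Cmod2_alt. c_ring. }
      rewrite F in Ec. nra.
Qed.

Lemma curve_deriv_zero_const (g : R -> C) (a b : R) : a <= b ->
  (forall t, a <= t <= b -> curve_deriv g t 0) -> g a = g b.
Proof.
  intros Hab H.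
  assert (T := curve_mvt_le g (fun _ => 0%C) (fun _ => 0) (fun _ => 0) a b Hab H).
  assert (E : Cmod (g b - g a)%C = 0).
  { apply Rle_antisym; [|apply Cmod_ge_0].
    rewrite <- (Rminus_0_r 0). apply T.
    - intros; apply @is_derive_const.
    - intros. rewrite Cmod_0. lra. }
  apply Cmod_eq_0 in E. apply (f_equal (fun x => (x + g a)%C)) in E.
  replace (g b - g a + g a)%C with (g b) in E by ring. rewrite E. ring.
Qed.

(** Along the segment t z the image curve has speed at most |z| p'(t |z|), the derivative of p (t
    |z|), so [curve_mvt_le] applies. This turns a bound on a derivative into a bound on the function
    by its value at the real point |z|. *)
Lemma cderiv_majorant (w w' : C -> C) (p p' : R -> R) (r : R) :
  (forall z, Cmod z < r -> cderiv w z (w' z)) ->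
  (forall x, 0 <= x < r -> is_derive p x (p' x)) ->
  (forall z, Cmod z < r -> Cmod (w' z) <= p' (Cmod z)) ->
  w 0%C = 0%C -> p 0 = 0 ->
  forall z, Cmod z < r -> Cmod (w z) <= p (Cmod z).
Proof.
  intros Hw Hp Hle Hw0 Hp0 z Hz.
  assert (Hm := Cmod_ge_0 z).
  assert (B : forall t, 0 <= t <= 1 -> Cmod (RtoC t * z) = t * Cmod z).
  { intros t Ht. rewrite Cmod_mult, Cmod_R, Rabs_pos_eq by lra. ring. }
  assert (B2 : forall t, 0 <= t <= 1 -> 0 <= t * Cmod z < r).
  { intros t Ht. nra. }
  assert (T := curve_mvt_le (fun t => w (0 + RtoC t * z)%C) (fun t => w' (RtoC t * z) * z)%C
    (fun t => p (t * Cmod z)) (fun t => Cmod z * p' (t * Cmod z)) 0 1 Rle_0_1).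
  cbv beta in T.
  assert (E1 : (0 + RtoC 1 * z)%C = z) by ring.
  assert (E0 : (0 + RtoC 0 * z)%C = 0%C) by ring.
  rewrite E1, E0 in T.
  rewrite Hw0, Rmult_1_l, Rmult_0_l, Hp0, Rminus_0_r in T.
  assert (E2 : (w z - 0)%C = w z) by ring. rewrite E2 in T. apply T.
  - intros t Ht.
    apply (curve_deriv_comp w (fun s => 0 + RtoC s * z)%C t (w' (RtoC t * z)%C) z).
    + replace (0 + RtoC t * z)%C with (RtoC t * z)%C by ring. apply Hw. rewrite B by auto. apply B2; auto.
    + apply curve_deriv_line.
  - intros t Ht.
    apply (is_derive_comp p (fun s => s * Cmod z) t (p' (t * Cmod z)) (Cmod z)).
    + apply Hp. apply B2; auto.
    + auto_derive; auto; ring.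
  - intros t Ht. rewrite Cmod_mult, Rmult_comm. apply Rmult_le_compat_l; [auto|].
    rewrite <- (B t Ht). apply Hle. rewrite B by auto. apply B2; auto.
Qed.

(** * The complex exponential *)

Lemma Cexp_plus (a b : C) : Cexp (a + b)%C = (Cexp a * Cexp b)%C.
Proof.
  unfold Cexp. rewrite Re_plus, Im_plus, exp_plus, cos_plus, sin_plus.
  apply C_ext; c_ring.
Qed.

Lemma Cexp_RtoC (x : R) : Cexp (RtoC x) = RtoC (exp x).
Proof. unfold Cexp; simpl. rewrite cos_0, sin_0. apply C_ext; c_ring. Qed.

Lemma Cexp_0 : Cexp 0 = 1%C.
Proof. rewrite Cexp_RtoC, exp_0. reflexivity. Qed.

Lemma Cmod_Cexp (z : C) : Cmod (Cexp z) = exp (Re z).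
Proof.
  unfold Cmod, Cexp. simpl fst; simpl snd.
  replace ((exp (Re z) * cos (Im z)) ^ 2 + (exp (Re z) * sin (Im z)) ^ 2)
    with (exp (Re z) ^ 2 * ((sin (Im z))² + (cos (Im z))²)) by (unfold Rsqr; ring).
  rewrite sin2_cos2, Rmult_1_r. apply sqrt_pow2. left; apply exp_pos.
Qed.

Lemma Cexp_neq_0 (z : C) : Cexp z <> 0.
Proof. apply Cmod_gt_0. rewrite Cmod_Cexp. apply exp_pos. Qed.

Lemma Cexp_opp (z : C) : Cexp (- z)%C = (/ Cexp z)%C.
Proof.
  assert (H : (Cexp (- z) * Cexp z)%C = 1%C).
  { rewrite <- Cexp_plus. replace (- z + z)%C with (RtoC 0) by ring. apply Cexp_0. }
  assert (N := Cexp_neq_0 z).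
  replace (Cexp (- z)%C) with (Cexp (- z) * Cexp z * / Cexp z)%C by (field; auto).
  rewrite H. ring.
Qed.

Lemma curve_deriv_Cexp_line (z : C) (t : R) :
  curve_deriv (fun s => Cexp (RtoC s * z)%C) t (z * Cexp (RtoC t * z))%C.
Proof.
  split; unfold Cexp, Re, Im, RtoC, Cmult; simpl; auto_derive; auto; unfold Rminus; ring.
Qed.

(** The curve exp (t z) has speed |z| exp (t Re z), and Re z <= |z|. *)
Lemma Cmod_Cexp_minus_1 (z : C) : Cmod (Cexp z - 1)%C <= exp (Cmod z) - 1.
Proof.
  assert (T := curve_mvt_le (fun t => Cexp (RtoC t * z)%C) (fun t => z * Cexp (RtoC t * z))%C
    (fun t => exp (t * Cmod z)) (fun t => Cmod z * exp (t * Cmod z)) 0 1 Rle_0_1).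
  cbv beta in T.
  rewrite Cmult_1_l, Cmult_0_l, Cexp_0, Rmult_1_l, Rmult_0_l, exp_0 in T. apply T.
  - intros; apply curve_deriv_Cexp_line.
  - intros t _. auto_derive; auto; ring.
  - intros t Ht. rewrite Cmod_mult, Cmod_Cexp. apply Rmult_le_compat_l; [apply Cmod_ge_0|].
    assert (E : Re (RtoC t * z)%C <= t * Cmod z).
    { rewrite Re_mult. simpl (Re (RtoC t)). simpl (Im (RtoC t)).
      assert (G := re_le_Cmod z). assert (G2 := Rle_abs (Re z)). nra. }
    destruct E as [E|E]; [left; apply exp_increasing, E|right; now rewrite E].
Qed.

(** One order further: the curve exp (t z) - t z has velocity z (exp (t z) - 1), bounded by the
    preceding lemma. *)
Lemma Cmod_Cexp_minus_1_minus (z : C) : Cmod (Cexp z - 1 - z)%C <= exp (Cmod z) - 1 - Cmod z.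
Proof.
  assert (T := curve_mvt_le (fun t => Cexp (RtoC t * z) - (0 + RtoC t * z))%C
    (fun t => z * Cexp (RtoC t * z) - z)%C
    (fun t => exp (t * Cmod z) - t * Cmod z) (fun t => Cmod z * exp (t * Cmod z) - Cmod z) 0 1 Rle_0_1).
  cbv beta in T.
  rewrite !Cplus_0_l, !Cmult_1_l, !Cmult_0_l, Cexp_0, !Rmult_1_l, !Rmult_0_l, exp_0 in T.
  replace (Cexp z - 1 - z)%C with (Cexp z - z - (1 - 0))%C by ring.
  replace (exp (Cmod z) - 1 - Cmod z) with (exp (Cmod z) - Cmod z - (1 - 0)) by ring.
  apply T.
  - intros t _. destruct (curve_deriv_Cexp_line z t) as [A1 A2].
    destruct (curve_deriv_line 0 z t) as [B1 B2].
    split; [apply (@is_derive_minus _ _ _ _ _ _ _ A1 B1)|apply (@is_derive_minus _ _ _ _ _ _ _ A2 B2)].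
  - intros t _. auto_derive; auto; ring.
  - intros t Ht. replace (z * Cexp (RtoC t * z) - z)%C with (z * (Cexp (RtoC t * z) - 1))%C by ring.
    rewrite Cmod_mult.
    replace (Cmod z * exp (t * Cmod z) - Cmod z) with (Cmod z * (exp (t * Cmod z) - 1)) by ring.
    apply Rmult_le_compat_l; [apply Cmod_ge_0|].
    replace (t * Cmod z) with (Cmod (RtoC t * z)%C)
      by (rewrite Cmod_mult, Cmod_R, Rabs_pos_eq by lra; ring).
    apply Cmod_Cexp_minus_1.
Qed.

(** The functional equation moves the question to the origin, where the remainder is at most the
    remainder of the real exponential at |h|; differentiability of the latter at 0 supplies the
    little-o. *)
Lemma cderiv_Cexp (z : C) : cderiv Cexp z (Cexp z).
Proof.
  intros eps Heps.
  assert (E := is_derive_exp 0). rewrite is_derive_eps in E.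
  destruct (E (eps / exp (Re z))) as [d [Hd H]]; [apply Rdiv_lt_0_compat; [auto|apply exp_pos]|].
  exists d. split; [auto|]. intros h Hh.
  rewrite Cexp_plus.
  replace (Cexp z * Cexp h - Cexp z - Cexp z * h)%C with (Cexp z * (Cexp h - 1 - h))%C by ring.
  rewrite Cmod_mult, Cmod_Cexp.
  assert (P := Cmod_ge_0 h).
  specialize (H (Cmod h)). rewrite (Rabs_pos_eq (Cmod h)) in H by auto.
  specialize (H Hh). rewrite Rplus_0_l, exp_0, Rmult_1_l in H.
  assert (T := Cmod_Cexp_minus_1_minus h).
  assert (A := Rle_abs (exp (Cmod h) - 1 - Cmod h)).
  apply Rle_trans with (exp (Re z) * (eps / exp (Re z) * Cmod h)).
  - apply Rmult_le_compat_l; [left; apply exp_pos|lra].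
  - right. field. apply Rgt_not_eq, exp_pos.
Qed.

(** * Integrals over a period *)

Definition CInt (F : R -> C) : C :=
  (RInt (fun t => Re (F t)) 0 (2 * PI), RInt (fun t => Im (F t)) 0 (2 * PI)).

Definition ccurve (F : R -> C) : Prop :=
  forall t, continuous (fun s => Re (F s)) t /\ continuous (fun s => Im (F s)) t.

Lemma ccurve_deriv (F : R -> C) : (forall t, exists v, curve_deriv F t v) -> ccurve F.
Proof.
  intros H t. destruct (H t) as [v [A B]].
  split; [apply (ex_derive_continuous (fun s => Re (F s)))|apply (ex_derive_continuous (fun s => Im (F s)))];
    eexists; eassumption.
Qed.

Lemma ccurve_RInt (F : R -> C) : ccurve F ->
  ex_RInt (fun t => Re (F t)) 0 (2 * PI) /\ ex_RInt (fun t => Im (F t)) 0 (2 * PI).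
Proof.
  intros H. split; apply (@ex_RInt_continuous R_CompleteNormedModule); intros t _; apply H.
Qed.

Lemma ccurve_mult (F G : R -> C) : ccurve F -> ccurve G -> ccurve (fun t => F t * G t)%C.
Proof.
  intros HF HG t. destruct (HF t), (HG t). split.
  - apply (continuous_minus (fun s => Re (F s) * Re (G s)) (fun s => Im (F s) * Im (G s)));
     apply (continuous_mult (K := R_AbsRing)); auto.
  - apply (continuous_plus (fun s => Re (F s) * Im (G s)) (fun s => Im (F s) * Re (G s)));
     apply (continuous_mult (K := R_AbsRing)); auto.
Qed.

Lemma ccurve_const (c : C) : ccurve (fun _ => c).
Proof. intros t; split; apply continuous_const. Qed.

Lemma CInt_ext (F G : R -> C) : (forall t, F t = G t) -> CInt F = CInt G.
Proof.
  intros H. unfold CInt. f_equal; apply RInt_ext; intros t _; now rewrite H.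
Qed.

Lemma CInt_plus (F G : R -> C) : ccurve F -> ccurve G ->
  CInt (fun t => F t + G t)%C = (CInt F + CInt G)%C.
Proof.
  intros HF HG. destruct (ccurve_RInt F HF) as [F1 F2], (ccurve_RInt G HG) as [G1 G2].
  apply C_ext; unfold CInt; [rewrite Re_plus|rewrite Im_plus]; simpl Re; simpl Im;
    apply (@RInt_plus R_CompleteNormedModule); auto.
Qed.

Lemma CInt_scal (c : C) (F : R -> C) : ccurve F -> CInt (fun t => c * F t)%C = (c * CInt F)%C.
Proof.
  intros HF. destruct (ccurve_RInt F HF) as [F1 F2].
  assert (S : forall (k : R) (f : R -> R), ex_RInt f 0 (2 * PI) ->
    RInt (fun t => k * f t) 0 (2 * PI) = k * RInt f 0 (2 * PI))
    by (intros; apply (@RInt_scal R_CompleteNormedModule); auto).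
  assert (X : forall (k : R) (f : R -> R), ex_RInt f 0 (2 * PI) ->
    ex_RInt (fun t => k * f t) 0 (2 * PI))
    by (intros; apply (@ex_RInt_scal R_NormedModule); auto).
  apply C_ext.
  - rewrite Re_mult. unfold CInt; simpl Re; simpl Im. rewrite <- !S by auto.
    apply (@RInt_minus R_CompleteNormedModule (fun t => Re c * Re (F t)) (fun t => Im c * Im (F t))); auto.
  - rewrite Im_mult. unfold CInt; simpl Re; simpl Im. rewrite <- !S by auto.
    apply (@RInt_plus R_CompleteNormedModule (fun t => Re c * Im (F t)) (fun t => Im c * Re (F t))); auto.
Qed.

(** Multiplication by the conjugate of the integral I makes the integral equal to the real number
    |I|^2, which reduces the claim to monotonicity of a real integral. *)
Lemma CInt_le (F : R -> C) (M : R) : ccurve F ->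
  (forall t, 0 <= t <= 2 * PI -> Cmod (F t) <= M) -> Cmod (CInt F) <= 2 * PI * M.
Proof.
  intros HF HM. set (I := CInt F).
  assert (P := PI_RGT_0). assert (G := Cmod_ge_0 I).
  assert (M0 : 0 <= M) by (eapply Rle_trans; [apply Cmod_ge_0|apply (HM 0); lra]).
  destruct (Req_dec (Cmod I) 0) as [E|E]; [rewrite E; nra|].
  assert (K : ccurve (fun t => Cconj I * F t)%C) by (apply ccurve_mult; [apply ccurve_const|auto]).
  assert (Q : Cmod I * Cmod I = RInt (fun t => Re (Cconj I * F t)%C) 0 (2 * PI)).
  { change (RInt (fun t => Re (Cconj I * F t)%C) 0 (2 * PI)) with (Re (CInt (fun t => Cconj I * F t)%C)).
    rewrite CInt_scal by auto. fold I.
    replace (Re (Cconj I * I)%C) with (Cmod I ^ 2); [ring|]. rewrite Cmod2_alt. c_ring. }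
  assert (U : RInt (fun t => Re (Cconj I * F t)%C) 0 (2 * PI) <= RInt (fun _ => Cmod I * M) 0 (2 * PI)).
  { apply RInt_le; [lra|apply (ccurve_RInt _ K)|apply ex_RInt_const|].
    intros t Ht. eapply Rle_trans; [apply Rle_abs|]. eapply Rle_trans; [apply re_le_Cmod|].
    rewrite Cmod_mult, Cmod_conj. apply Rmult_le_compat_l; [auto|apply HM; lra]. }
  rewrite RInt_const in U. change (scal (2 * PI - 0) (Cmod I * M)) with ((2 * PI - 0) * (Cmod I * M)) in U.
  rewrite <- Q in U. nra.
Qed.

Lemma ccurve_bounded (F : R -> C) : ccurve F ->
  exists M, forall t, 0 <= t <= 2 * PI -> Cmod (F t) <= M.
Proof.
  intros HF. assert (P := PI_RGT_0).
  destruct (continuity_ab_maj (fun t => Rabs (Re (F t)) + Rabs (Im (F t))) 0 (2 * PI)) as [x [Hx _]]; [lra| |].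
  - intros t _. apply continuity_pt_filterlim.
    apply (continuous_plus (fun s => Rabs (Re (F s))) (fun s => Rabs (Im (F s))));
      apply (continuous_comp _ Rabs); try apply HF; apply continuous_Rabs.
  - eexists. intros t Ht. eapply Rle_trans; [apply Cmod_le_Re_Im|]. exact (Hx t Ht).
Qed.

Lemma CInt_derive (G F : R -> C) : ccurve F -> (forall t, curve_deriv G t (F t)) ->
  CInt F = (G (2 * PI)%R - G 0%R)%C.
Proof.
  intros HF HG. apply C_ext.
  - rewrite Re_minus. unfold CInt; simpl Re. apply is_RInt_unique.
    apply (@is_RInt_derive R_CompleteNormedModule (fun t => Re (G t)) (fun t => Re (F t))); intros; [apply HG|apply HF].
  - rewrite Im_minus. unfold CInt; simpl Im. apply is_RInt_unique.
    apply (@is_RInt_derive R_CompleteNormedModule (fun t => Im (G t)) (fun t => Im (F t))); intros; [apply HG|apply HF].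
Qed.

Definition ccont2 (F : R -> R -> C) (t u : R) : Prop :=
  continuity_2d_pt (fun x y => Re (F x y)) t u /\ continuity_2d_pt (fun x y => Im (F x y)) t u.

Lemma ccont2_mult (F G : R -> R -> C) (t u : R) : ccont2 F t u -> ccont2 G t u ->
  ccont2 (fun x y => F x y * G x y)%C t u.
Proof.
  intros [A B] [A' B']. split.
  - apply (continuity_2d_pt_minus (fun x y => Re (F x y) * Re (G x y)) (fun x y => Im (F x y) * Im (G x y)));
     apply continuity_2d_pt_mult; auto.
  - apply (continuity_2d_pt_plus (fun x y => Re (F x y) * Im (G x y)) (fun x y => Im (F x y) * Re (G x y)));
     apply continuity_2d_pt_mult; auto.
Qed.

Lemma ccont2_comp (h : C -> C) (l : C) (F : R -> R -> C) (t u : R) :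
  cderiv h (F t u) l -> ccont2 F t u -> ccont2 (fun x y => h (F x y)) t u.
Proof.
  intros Hh [A B]. assert (K := cderiv_continuous _ _ _ Hh).
  assert (X : forall eps, 0 < eps -> exists d : posreal, forall x y, Rabs (x - t) < d -> Rabs (y - u) < d ->
    Cmod (h (F x y) - h (F t u))%C < eps).
  { intros eps Heps. destruct (K eps Heps) as [d [Hd H]].
    destruct (A (mkposreal (d / 2) ltac:(lra))) as [d1 H1].
    destruct (B (mkposreal (d / 2) ltac:(lra))) as [d2 H2].
    exists (mkposreal (Rmin d1 d2) ltac:(apply Rmin_pos; apply cond_pos)). simpl.
    intros x y Hx Hy.
    specialize (H1 x y (Rlt_le_trans _ _ _ Hx (Rmin_l _ _)) (Rlt_le_trans _ _ _ Hy (Rmin_l _ _))).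
    specialize (H2 x y (Rlt_le_trans _ _ _ Hx (Rmin_r _ _)) (Rlt_le_trans _ _ _ Hy (Rmin_r _ _))).
    simpl in H1, H2. specialize (H (F x y - F t u)%C).
    replace (F t u + (F x y - F t u))%C with (F x y) in H by ring. apply H.
    eapply Rle_lt_trans; [apply Cmod_le_Re_Im|]. rewrite Re_minus, Im_minus. lra. }
  split; intros eps; destruct (X eps (cond_pos eps)) as [d H]; exists d; intros x y Hx Hy;
    specialize (H x y Hx Hy); (eapply Rle_lt_trans; [|exact H]).
  - rewrite <- Re_minus. apply re_le_Cmod.
  - rewrite <- Im_minus. apply Im_le_Cmod.
Qed.

Lemma CInt_param (F F' : R -> R -> C) (t d : R) : 0 < d ->
  (forall s u, Rabs (s - t) < d -> curve_deriv (fun x => F x u) s (F' s u)) ->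
  (forall u, ccont2 F' t u) ->
  (forall s, Rabs (s - t) < d -> ccurve (F s)) ->
  curve_deriv (fun s => CInt (F s)) t (CInt (F' t)).
Proof.
  intros Hd HF HF' Hc.
  (* [part] stands for [Re] or [Im]; both components are treated by the same real theorem on
     parameter integrals. *)
  assert (gen : forall part : C -> R,
    (forall s u, Rabs (s - t) < d -> is_derive (fun x => part (F x u)) s (part (F' s u))) ->
    (forall u, continuity_2d_pt (fun x y => part (F' x y)) t u) ->
    (forall s, Rabs (s - t) < d -> ex_RInt (fun u => part (F s u)) 0 (2 * PI)) ->
    is_derive (fun s => RInt (fun u => part (F s u)) 0 (2 * PI)) t (RInt (fun u => part (F' t u)) 0 (2 * PI))).
  { intros part A B D.
    assert (T0 : Rabs (t - t) < d) by (replace (t - t) with 0 by ring; rewrite Rabs_R0; auto).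
    replace (RInt (fun u => part (F' t u)) 0 (2 * PI)) with
      (RInt (fun u => Derive (fun x => part (F x u)) t) 0 (2 * PI))
      by (apply RInt_ext; intros u _; apply is_derive_unique, A, T0).
    apply (is_derive_RInt_param (fun x u => part (F x u)) 0 (2 * PI) t).
    - exists (mkposreal d Hd). intros s Hs u _. exists (part (F' s u)). apply A, Hs.
    - intros u _. apply (continuity_2d_pt_ext_loc (fun x y => part (F' x y))).
      + exists (mkposreal d Hd). intros x y Hx _. symmetry. apply is_derive_unique, A, Hx.
      + apply B.
    - exists (mkposreal d Hd). intros s Hs. apply D, Hs. }
  split; [apply (gen Re)|apply (gen Im)].
  - intros s u Hs; apply (HF s u Hs).
  - intros u; apply HF'.
  - intros s Hs; apply (ccurve_RInt _ (Hc s Hs)).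
  - intros s u Hs; apply (HF s u Hs).
  - intros u; apply HF'.
  - intros s Hs; apply (ccurve_RInt _ (Hc s Hs)).
Qed.

(** * Series of complex numbers *)

Notation cseries a l := (@is_series C_AbsRing C_NormedModule a l).
Notation csum_n a n := (@sum_n (AbelianGroup.AbelianMonoid (NormedModule.AbelianGroup C_AbsRing C_NormedModule)) a n).

Lemma csum_O (a : nat -> C) : csum_n a 0 = a 0%nat.
Proof. apply @sum_O. Qed.

Lemma csum_S (a : nat -> C) (n : nat) : csum_n a (S n) = (csum_n a n + a (S n))%C.
Proof. apply @sum_Sn. Qed.

Lemma Re_csum (a : nat -> C) (n : nat) : Re (csum_n a n) = sum_n (fun k => Re (a k)) n.
Proof. induction n; [rewrite csum_O, sum_O; auto|rewrite csum_S, sum_Sn, Re_plus, IHn; auto]. Qed.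

Lemma Im_csum (a : nat -> C) (n : nat) : Im (csum_n a n) = sum_n (fun k => Im (a k)) n.
Proof. induction n; [rewrite csum_O, sum_O; auto|rewrite csum_S, sum_Sn, Im_plus, IHn; auto]. Qed.

Lemma cseries_eps (a : nat -> C) (l : C) : cseries a l <->
  forall eps, 0 < eps -> exists N, forall n, (N <= n)%nat -> Cmod (csum_n a n - l)%C < eps.
Proof.
  split.
  - intros H eps Heps.
    assert (E : 0 < eps / 2) by lra.
    destruct (H _ (@locally_ball C_UniformSpace l (mkposreal _ E))) as [N HN].
    exists N. intros n Hn. destruct (HN n Hn) as [A B].
    eapply Rle_lt_trans; [apply Cmod_le_Re_Im|].
    change (Rabs (Re (csum_n a n) - Re l) < eps / 2) in A.
    change (Rabs (Im (csum_n a n) - Im l) < eps / 2) in B.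
    rewrite Re_minus, Im_minus. lra.
  - intros H P [d HP]. destruct (H d (cond_pos d)) as [N HN].
    exists N. intros n Hn. apply HP. specialize (HN n Hn). split.
    + change (Rabs (Re (csum_n a n) - Re l) < d). rewrite <- Re_minus.
      eapply Rle_lt_trans; [apply re_le_Cmod|exact HN].
    + change (Rabs (Im (csum_n a n) - Im l) < d). rewrite <- Im_minus.
      eapply Rle_lt_trans; [apply Im_le_Cmod|exact HN].
Qed.

Lemma series_eps (a : nat -> R) (l : R) : is_series a l <->
  forall eps, 0 < eps -> exists N, forall n, (N <= n)%nat -> Rabs (sum_n a n - l) < eps.
Proof.
  split.
  - intros H eps Heps.
    destruct (H _ (@locally_ball R_UniformSpace l (mkposreal _ Heps))) as [N HN].
    exists N. intros n Hn. apply (HN n Hn).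
  - intros H P [d HP]. destruct (H d (cond_pos d)) as [N HN].
    exists N. intros n Hn. apply HP, HN, Hn.
Qed.

Lemma cseries_components (a : nat -> C) (l : C) : cseries a l <->
  is_series (fun k => Re (a k)) (Re l) /\ is_series (fun k => Im (a k)) (Im l).
Proof.
  rewrite cseries_eps, !series_eps. split.
  - intros H. split; intros eps Heps; destruct (H eps Heps) as [N HN]; exists N; intros n Hn;
      specialize (HN n Hn); (eapply Rle_lt_trans; [|exact HN]).
    + rewrite <- Re_csum, <- Re_minus. apply re_le_Cmod.
    + rewrite <- Im_csum, <- Im_minus. apply Im_le_Cmod.
  - intros [A B] eps Heps.
    destruct (A (eps / 2)) as [N1 H1]; [lra|]. destruct (B (eps / 2)) as [N2 H2]; [lra|].
    exists (max N1 N2). intros n Hn. specialize (H1 n ltac:(lia)). specialize (H2 n ltac:(lia)).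
    eapply Rle_lt_trans; [apply Cmod_le_Re_Im|].
    rewrite Re_minus, Im_minus, Re_csum, Im_csum. lra.
Qed.

Lemma cseries_unique (a : nat -> C) (l l' : C) : cseries a l -> cseries a l' -> l = l'.
Proof.
  rewrite !cseries_components. intros [A B] [A' B'].
  apply is_series_unique in A, B, A', B'. apply C_ext; congruence.
Qed.

Lemma cseries_ext (a b : nat -> C) (l : C) : (forall n, a n = b n) -> cseries a l -> cseries b l.
Proof. apply @is_series_ext. Qed.

Lemma cseries_scal (c : C) (a : nat -> C) (l : C) :
  cseries a l -> cseries (fun n => c * a n)%C (c * l)%C.
Proof. apply (@is_series_scal C_AbsRing C_NormedModule). Qed.

Lemma cseries_minus (a b : nat -> C) (l m : C) :
  cseries a l -> cseries b m -> cseries (fun n => a n - b n)%C (l - m)%C.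
Proof. apply (@is_series_minus C_AbsRing C_NormedModule). Qed.

Lemma cseries_shift (a : nat -> C) (l : C) :
  cseries a l <-> cseries (fun n => a (S n)) (l - a 0%nat)%C.
Proof.
  split.
  - intros H. apply (@is_series_incr_1 C_AbsRing C_NormedModule).
    assert (E : (l - a 0%nat + a 0%nat)%C = l) by ring. rewrite <- E in H. exact H.
  - intros H. apply (@is_series_decr_1 C_AbsRing C_NormedModule). exact H.
Qed.

Lemma cseries_Cmod_le (a : nat -> C) (b : nat -> R) (l : C) (m : R) :
  cseries a l -> is_series b m -> (forall n, Cmod (a n) <= b n) -> Cmod l <= m.
Proof.
  rewrite cseries_eps, series_eps. intros A B H.
  assert (S : forall n, Cmod (csum_n a n) <= sum_n b n).
  { induction n; [rewrite csum_O, sum_O; auto|]. rewrite csum_S, sum_Sn.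
    eapply Rle_trans; [apply Cmod_triangle|]. apply Rplus_le_compat; auto. }
  apply le_epsilon. intros eps Heps.
  destruct (A (eps / 2)) as [N1 H1]; [lra|]. destruct (B (eps / 2)) as [N2 H2]; [lra|].
  specialize (H1 (max N1 N2) ltac:(lia)). specialize (H2 (max N1 N2) ltac:(lia)).
  specialize (S (max N1 N2)).
  assert (T := Cmod_minus_ge l (csum_n a (max N1 N2))).
  assert (E : Cmod (l - csum_n a (max N1 N2))%C = Cmod (csum_n a (max N1 N2) - l)%C).
  { rewrite <- Cmod_opp. f_equal. ring. }
  apply Rabs_def2 in H2. lra.
Qed.

(** * Cauchy's formula and Taylor series in the disk *)

Definition cis (t : R) : C := Cexp (Ci * RtoC t)%C.

Lemma curve_deriv_cis (t : R) : curve_deriv cis t (Ci * cis t)%C.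
Proof.
  split; unfold cis, Cexp, Re, Im, RtoC, Cmult, Ci; simpl; auto_derive; auto; unfold Rminus; ring.
Qed.

Lemma Cmod_cis (t : R) : Cmod (cis t) = 1.
Proof.
  unfold cis. rewrite Cmod_Cexp. rewrite <- exp_0. f_equal. c_ring.
Qed.

Lemma cis_2PI : cis (2 * PI) = cis 0.
Proof.
  unfold cis, Cexp, Re, Im, Ci, RtoC, Cmult; simpl.
  replace (0 * 0 + 1 * (2 * PI)) with (2 * PI) by ring.
  replace (0 * 0 + 1 * 0) with 0 by ring.
  replace (0 * (2 * PI) - 1 * 0) with 0 by ring.
  replace (0 * 0 - 1 * 0) with 0 by ring.
  now rewrite cos_2PI, sin_2PI, cos_0, sin_0.
Qed.

Lemma Ci_neq_0 : Ci <> 0.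
Proof. apply Cmod_gt_0. rewrite Cmod_Ci. lra. Qed.

Definition circ (rho t : R) : C := (RtoC rho * cis t)%C.

Lemma curve_deriv_circ (rho t : R) : curve_deriv (circ rho) t (Ci * circ rho t)%C.
Proof.
  eapply curve_deriv_eq; [apply curve_deriv_scal, curve_deriv_cis|]. unfold circ. ring.
Qed.

Lemma Cmod_circ (rho t : R) : 0 <= rho -> Cmod (circ rho t) = rho.
Proof.
  intros H. unfold circ. rewrite Cmod_mult, Cmod_cis, Cmod_R, Rabs_pos_eq; auto; ring.
Qed.

Lemma ccurve_circ (rho : R) : ccurve (circ rho).
Proof. apply ccurve_deriv. intros t. eexists. apply curve_deriv_circ. Qed.

Lemma ccurve_comp_circ (g : C -> C) (rho : R) :
  (forall z, Cmod z = rho -> exists l, cderiv g z l) -> 0 <= rho ->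
  ccurve (fun t => g (circ rho t)).
Proof.
  intros H Hr. apply ccurve_deriv. intros t.
  destruct (H (circ rho t)) as [l Hl]; [apply Cmod_circ; auto|].
  eexists. apply curve_deriv_comp; [exact Hl|apply curve_deriv_circ].
Qed.

Lemma circ_minus_neq_0 (rho t : R) (z : C) : 0 <= rho -> Cmod z < rho -> (circ rho t - z)%C <> 0.
Proof.
  intros Hr Hz. apply Cmod_gt_0.
  assert (T := Cmod_minus_ge (circ rho t) z). rewrite Cmod_circ in T by auto. lra.
Qed.

Lemma circ_neq_0 (rho t : R) : 0 < rho -> circ rho t <> 0.
Proof. intros H. apply Cmod_gt_0. rewrite Cmod_circ; lra. Qed.

(** On the circle d zeta = i zeta dt, so the numerator zeta absorbs the parametrization: Cauchy's
    integral over 2 pi i becomes [CInt] of h times this kernel over 2 pi. *)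
Definition cauchy_kernel (rho : R) (z : C) (t : R) : C := (circ rho t / (circ rho t - z))%C.

Lemma ccurve_kernel (rho : R) (z : C) : 0 <= rho -> Cmod z < rho -> ccurve (cauchy_kernel rho z).
Proof.
  intros Hr Hz. apply (ccurve_comp_circ (fun x => x / (x - z))%C); [|auto].
  intros x Hx. eexists. apply cderiv_div; [|apply cderiv_id|apply cderiv_minus; [apply cderiv_id|apply cderiv_const]].
  apply Cmod_gt_0. assert (T := Cmod_minus_ge x z). lra.
Qed.

Lemma Cmod_kernel_le (rho : R) (z : C) (t : R) : 0 <= rho -> Cmod z < rho ->
  Cmod (cauchy_kernel rho z t) <= rho / (rho - Cmod z).
Proof.
  intros Hr Hz. unfold cauchy_kernel. rewrite Cmod_div by (apply circ_minus_neq_0; auto).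
  rewrite Cmod_circ by auto.
  assert (T := Cmod_minus_ge (circ rho t) z). rewrite Cmod_circ in T by auto.
  apply Rmult_le_compat_l; auto. apply Rinv_le_contravar; lra.
Qed.

Lemma ccurve_inv_circ_pow (rho : R) (k : nat) : 0 < rho -> ccurve (fun t => / (circ rho t) ^ k)%C.
Proof.
  intros Hr. apply (ccurve_comp_circ (fun x => / x ^ k)%C); [|lra].
  intros x Hx. eexists. apply cderiv_inv; [|apply cderiv_pow].
  apply Cpow_nz, Cmod_gt_0. lra.
Qed.

Lemma CInt_kernel_split (rho : R) (z : C) (g : R -> C) (n : nat) : 0 < rho -> Cmod z < rho -> ccurve g ->
  CInt (fun t => g t * cauchy_kernel rho z t)%C =
  (csum_n (fun k => z ^ k * CInt (fun t => g t * / (circ rho t) ^ k))%C n +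
   z ^ (S n) * CInt (fun t => g t * (/ (circ rho t) ^ (S n) * cauchy_kernel rho z t)))%C.
Proof.
  intros Hr Hz Hg.
  assert (Hk : forall k, ccurve (fun t => g t * / (circ rho t) ^ k)%C)
    by (intros; apply ccurve_mult; [auto|apply ccurve_inv_circ_pow; auto]).
  assert (Hk2 : forall k, ccurve (fun t => g t * (/ (circ rho t) ^ k * cauchy_kernel rho z t))%C)
    by (intros; apply ccurve_mult; [auto|apply ccurve_mult;
        [apply ccurve_inv_circ_pow; auto|apply ccurve_kernel; auto; lra]]).
  (* One step of the geometric expansion in z / zeta: the kernel K = zeta / (zeta - z) satisfies K =
     1 + (z / zeta) K. *)
  assert (step : forall k, CInt (fun t => g t * (/ (circ rho t) ^ k * cauchy_kernel rho z t))%C =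
    (CInt (fun t => g t * / (circ rho t) ^ k) + z * CInt (fun t => g t * (/ (circ rho t) ^ (S k) * cauchy_kernel rho z t)))%C).
  { intros k. rewrite <- CInt_scal, <- CInt_plus; auto.
    - apply CInt_ext. intros t. unfold cauchy_kernel. rewrite Cpow_S.
      assert (A := circ_neq_0 rho t Hr). assert (B := circ_minus_neq_0 rho t z (Rlt_le _ _ Hr) Hz).
      field. repeat split; auto. apply Cpow_nz; auto.
    - apply ccurve_mult; [apply ccurve_const|auto]. }
  induction n as [|n IH].
  - rewrite csum_O. rewrite (CInt_ext _ (fun t => g t * (/ (circ rho t) ^ 0 * cauchy_kernel rho z t))%C).
    + rewrite (step 0%nat). simpl. ring.
    + intros t. simpl. field.
  - rewrite IH, csum_S, (step (S n)), (Cpow_S z (S n)). ring.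
Qed.

Lemma CInt_kernel_series (rho : R) (z : C) (g : R -> C) (M : R) : 0 < rho -> Cmod z < rho -> ccurve g ->
  (forall t, 0 <= t <= 2 * PI -> Cmod (g t) <= M) ->
  cseries (fun k => z ^ k * CInt (fun t => g t * / (circ rho t) ^ k))%C
          (CInt (fun t => g t * cauchy_kernel rho z t)%C).
Proof.
  intros Hr Hz Hg HM. apply cseries_eps. intros eps Heps.
  assert (Hm := Cmod_ge_0 z). assert (HP := PI_RGT_0).
  assert (M0 : 0 <= M) by (eapply Rle_trans; [apply Cmod_ge_0|apply (HM 0); lra]).
  (* The remainder after n + 1 terms is at most (|z| / rho)^(n+1) [K]; the target eps / (K + 1)
     allows [K] to be 0. *)
  set (K := 2 * PI * (M * (rho / (rho - Cmod z)))).
  assert (HK : 0 <= K).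
  { unfold K. apply Rmult_le_pos; [lra|]. apply Rmult_le_pos; [lra|].
    apply Rlt_le, Rdiv_lt_0_compat; lra. }
  destruct (pow_lt_1_zero (Cmod z / rho)) with (y := eps / (K + 1)) as [N HN].
  - rewrite Rabs_pos_eq by (apply Rdiv_le_0_compat; lra). apply Rlt_div_l; lra.
  - apply Rdiv_lt_0_compat; lra.
  - exists N. intros n Hn. rewrite (CInt_kernel_split rho z g n) by auto.
    match goal with |- Cmod ?x < _ => replace x with
      (- (z ^ S n * CInt (fun t => g t * (/ circ rho t ^ S n * cauchy_kernel rho z t))))%C by ring end.
    rewrite Cmod_opp, Cmod_mult, Cmod_pow.
    assert (B : Cmod (CInt (fun t => g t * (/ circ rho t ^ S n * cauchy_kernel rho z t))%C)
      <= 2 * PI * (/ rho ^ S n * (M * (rho / (rho - Cmod z))))).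
    { apply CInt_le.
      - apply ccurve_mult; [auto|apply ccurve_mult; [apply ccurve_inv_circ_pow; auto|apply ccurve_kernel; auto; lra]].
      - intros t Ht. rewrite !Cmod_mult, Cmod_inv by (apply Cpow_nz, circ_neq_0; auto).
        rewrite Cmod_pow, Cmod_circ by lra.
        assert (Q := Cmod_kernel_le rho z t ltac:(lra) Hz).
        assert (V : 0 < / rho ^ S n) by (apply Rinv_0_lt_compat, pow_lt; auto).
        replace (/ rho ^ S n * (M * (rho / (rho - Cmod z)))) with (M * (/ rho ^ S n * (rho / (rho - Cmod z)))) by ring.
        apply Rmult_le_compat; auto; [apply Cmod_ge_0| |].
        + apply Rmult_le_pos; [lra|apply Cmod_ge_0].
        + apply Rmult_le_compat_l; lra. }
    assert (HN' := HN (S n) ltac:(lia)).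
    assert (W : 0 <= (Cmod z / rho) ^ S n) by (apply pow_le, Rdiv_le_0_compat; lra).
    rewrite Rabs_pos_eq in HN' by auto.
    apply Rle_lt_trans with ((Cmod z / rho) ^ S n * K).
    + unfold Rdiv at 1. rewrite Rpow_mult_distr, pow_inv.
      apply Rle_trans with (Cmod z ^ S n * (2 * PI * (/ rho ^ S n * (M * (rho / (rho - Cmod z)))))).
      * apply Rmult_le_compat_l; [apply pow_le; auto|exact B].
      * right. unfold K. ring.
    + apply Rle_lt_trans with ((Cmod z / rho) ^ S n * (K + 1)); [apply Rmult_le_compat_l; lra|].
      apply Rlt_div_r in HN'; lra.
Qed.

Lemma CInt_const (c : C) : CInt (fun _ => c) = (RtoC (2 * PI) * c)%C.
Proof.
  unfold CInt. rewrite !RInt_const.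
  change (scal (2 * PI - 0) (Re c)) with ((2 * PI - 0) * Re c).
  change (scal (2 * PI - 0) (Im c)) with ((2 * PI - 0) * Im c).
  apply C_ext; c_ring.
Qed.

Lemma circ_2PI (rho : R) : circ rho (2 * PI) = circ rho 0.
Proof. unfold circ. now rewrite cis_2PI. Qed.

(** zeta^(-k-1) has the periodic antiderivative - zeta^(-k-1) / (i (k + 1)). The exponent starts at
    1 because zeta^0 integrates to 2 pi. *)
Lemma CInt_inv_circ_pow (rho : R) (k : nat) : 0 < rho -> CInt (fun t => / (circ rho t) ^ (S k))%C = 0.
Proof.
  intros Hr.
  rewrite (CInt_derive (fun t => (- / (Ci * RtoC (INR (S k)))) * / (circ rho t) ^ (S k))%C).
  - rewrite circ_2PI. ring.
  - apply ccurve_inv_circ_pow; auto.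
  - intros t. assert (A := circ_neq_0 rho t Hr). assert (A2 := Cpow_nz _ (S k) A).
    assert (A3 := Cpow_nz _ k A). assert (Q := Ci_neq_0).
    assert (N : RtoC (INR (S k)) <> 0) by (intros E; apply RtoC_inj in E; apply (not_0_INR (S k)); auto).
    eapply curve_deriv_eq; [apply curve_deriv_scal;
      apply (curve_deriv_comp (fun x => / x ^ S k)%C (circ rho)); [|apply curve_deriv_circ];
      apply cderiv_inv; [exact A2|apply cderiv_pow]|].
    replace (S k - 1)%nat with k by lia. rewrite Cpow_S. field. repeat split; auto.
Qed.

Lemma CInt_kernel (rho : R) (z : C) : 0 < rho -> Cmod z < rho ->
  CInt (cauchy_kernel rho z) = RtoC (2 * PI).
Proof.
  intros Hr Hz.
  assert (A := CInt_kernel_series rho z (fun _ => 1%C) 1 Hr Hz (ccurve_const _)).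
  assert (A' : cseries (fun k => z ^ k * CInt (fun t => 1 * / (circ rho t) ^ k))%C (CInt (cauchy_kernel rho z))).
  { rewrite (CInt_ext (cauchy_kernel rho z) (fun t => 1 * cauchy_kernel rho z t)%C) by (intros; ring).
    apply A. intros _ _. rewrite Cmod_1. lra. }
  apply (cseries_unique _ _ _ A').
  apply cseries_eps. intros eps Heps. exists 0%nat. intros n _.
  (* Every partial sum already equals 2 pi, as only the term k = 0 survives. *)
  replace (csum_n (fun k => z ^ k * CInt (fun t => 1 * / circ rho t ^ k))%C n) with (RtoC (2 * PI)).
  - replace (RtoC (2 * PI) - RtoC (2 * PI))%C with (RtoC 0) by ring. rewrite Cmod_0. auto.
  - induction n as [|n IH].
    + rewrite csum_O. rewrite (CInt_ext _ (fun _ => 1%C)).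
      * rewrite CInt_const. simpl. ring.
      * intros t. simpl. field.
    + rewrite csum_S, <- IH. rewrite (CInt_ext _ (fun t => / circ rho t ^ S n)%C) by (intros; ring).
      rewrite CInt_inv_circ_pow by auto. ring.
Qed.

(* Deforming the circle [zeta] to the point [z] through [z + s (zeta - z)] changes the integral by the integral of a
   [t]-derivative of a periodic function, so the integral stays constant. *)
Lemma cauchy_formula (h h' : C -> C) (rho : R) (z : C) : 0 < rho < 1 -> Cmod z < rho ->
  (forall x, in_disk x -> cderiv h x (h' x)) -> (forall x, in_disk x -> exists l, cderiv h' x l) ->
  CInt (fun t => h (circ rho t) * cauchy_kernel rho z t)%C = (RtoC (2 * PI) * h z)%C.
Proof.
  intros Hr Hz Hh Hh'.
  set (G := fun s u => (z + RtoC s * (circ rho u - z))%C).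
  set (F := fun s u => (h (G s u) * cauchy_kernel rho z u)%C).
  (* The s-derivative of [G] is zeta - z, which cancels the denominator of the kernel and leaves
     zeta. *)
  set (F' := fun s u => (h' (G s u) * circ rho u)%C).
  assert (Hm := Cmod_ge_0 z).
  assert (HG : forall s u, Rabs s * (rho + Cmod z) < 1 - Cmod z \/ (0 <= s <= 1 \/ Rabs (s - 1) * (rho + Cmod z) < 1 - rho) -> in_disk (G s u)).
  { intros s u H. unfold in_disk, G.
    assert (C1 : Cmod (circ rho u - z)%C <= rho + Cmod z)
      by (eapply Rle_trans; [apply Cmod_minus_le|]; rewrite Cmod_circ; lra).
    destruct H as [H|[H|H]].
    - eapply Rle_lt_trans; [apply Cmod_triangle|]. rewrite Cmod_mult, Cmod_R.
      assert (Q := Rabs_pos s). nra.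
    - replace (z + RtoC s * (circ rho u - z))%C with (RtoC (1 - s) * z + RtoC s * circ rho u)%C
        by (rewrite RtoC_minus; ring).
      eapply Rle_lt_trans; [apply Cmod_triangle|]. rewrite !Cmod_mult, !Cmod_R, Cmod_circ by lra.
      rewrite !Rabs_pos_eq by lra. nra.
    - replace (z + RtoC s * (circ rho u - z))%C with (circ rho u + RtoC (s - 1) * (circ rho u - z))%C
        by (rewrite RtoC_minus; ring).
      eapply Rle_lt_trans; [apply Cmod_triangle|]. rewrite Cmod_mult, Cmod_R, Cmod_circ by lra.
      assert (Q := Rabs_pos (s - 1)). nra. }
  (* Differentiation under the integral uses two-sided neighbourhoods, so s ranges over an open
     interval around [0, 1]. Since rho + |z| < 2, leaving [0, 1] by less than [d] moves the points
     by less than 1 - rho. *)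
  set (d := (1 - rho) / 2).
  assert (Hd : 0 < d) by (unfold d; lra).
  assert (HG2 : forall s u, - d < s < 1 + d -> in_disk (G s u)).
  { intros s u Hs. apply HG. unfold d in Hs. destruct (Rlt_dec s 0) as [L|L].
    - left. rewrite Rabs_left by auto. nra.
    - right. destruct (Rle_dec s 1) as [L2|L2]; [left; lra|right].
      rewrite Rabs_pos_eq by lra. nra. }
  assert (HGu : forall s u, curve_deriv (fun x => G s x) u (RtoC s * (Ci * circ rho u))%C).
  { intros s u. destruct (curve_deriv_circ rho u) as [A B].
    assert (X : curve_deriv (fun x => circ rho x - z)%C u (Ci * circ rho u)%C).
    { eapply curve_deriv_eq; [apply (curve_deriv_comp (fun x => x - z)%C (circ rho) u (1 - 0)%C);
       [apply cderiv_minus; [apply cderiv_id|apply cderiv_const]|apply curve_deriv_circ]|]. ring. }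
    eapply curve_deriv_eq; [apply (curve_deriv_comp (fun x => z + RtoC s * x)%C (fun x => circ rho x - z)%C u (0 + (0 * (circ rho u - z) + RtoC s * 1))%C);
     [apply (cderiv_plus (fun _ => z) (fun x => RtoC s * x)%C); [apply cderiv_const|
       apply (cderiv_mult (fun _ => RtoC s) (fun x => x)); [apply cderiv_const|apply cderiv_id]]|exact X]|]. ring. }
  assert (HF : forall s, - d < s < 1 + d -> curve_deriv (fun x => CInt (F x)) s (CInt (F' s))).
  { intros s Hs. apply (CInt_param F F' s (Rmin (s + d) (1 + d - s))).
    - apply Rmin_pos; lra.
    - intros x u Hx. apply Rabs_def2 in Hx.
      assert (M1 := Rmin_l (s + d) (1 + d - s)). assert (M2 := Rmin_r (s + d) (1 + d - s)).
      unfold F, F'. eapply curve_deriv_eq.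
      + apply (curve_deriv_mult (fun y => h (G y u)) (fun _ => cauchy_kernel rho z u)).
        * apply (curve_deriv_comp h (fun y => G y u)); [apply Hh, HG2; lra|apply curve_deriv_line].
        * apply curve_deriv_const.
      + unfold cauchy_kernel. field. apply circ_minus_neq_0; lra.
    - intros u. unfold F'. apply ccont2_mult.
      + destruct (Hh' (G s u)) as [l Hl]; [apply HG2; lra|].
        apply (ccont2_comp h' l G s u Hl).
        assert (Z : forall part : C -> R, (forall v, continuity_pt (fun x => part (circ rho x)) v) ->
           continuity_2d_pt (fun _ x => part (circ rho x)) s u).
        { intros part Hp eps. destruct (proj1 (continuity_pt_locally _ _) (Hp u) eps) as [d1 H1].
          exists d1. intros x y _ Hy. apply (H1 y Hy). }
        assert (cc := ccurve_circ rho).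
        assert (Zr := Z Re (fun v => proj2 (continuity_pt_filterlim _ _) (proj1 (cc v)))).
        assert (Zi := Z Im (fun v => proj2 (continuity_pt_filterlim _ _) (proj2 (cc v)))).
        unfold G. split.
        * apply (continuity_2d_pt_ext (fun x y => Re z + x * (Re (circ rho y) - Re z))); [intros; c_ring|].
          apply continuity_2d_pt_plus; [apply continuity_2d_pt_const|].
          apply continuity_2d_pt_mult; [apply continuity_2d_pt_id1|].
          apply continuity_2d_pt_minus; [apply Zr|apply continuity_2d_pt_const].
        * apply (continuity_2d_pt_ext (fun x y => Im z + x * (Im (circ rho y) - Im z))); [intros; c_ring|].
          apply continuity_2d_pt_plus; [apply continuity_2d_pt_const|].
          apply continuity_2d_pt_mult; [apply continuity_2d_pt_id1|].
          apply continuity_2d_pt_minus; [apply Zi|apply continuity_2d_pt_const].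
      + assert (cc := ccurve_circ rho). split.
        * intros eps. destruct (proj1 (continuity_pt_locally _ _) (proj2 (continuity_pt_filterlim _ _) (proj1 (cc u))) eps) as [d1 H1].
          exists d1. intros x y _ Hy. apply (H1 y Hy).
        * intros eps. destruct (proj1 (continuity_pt_locally _ _) (proj2 (continuity_pt_filterlim _ _) (proj2 (cc u))) eps) as [d1 H1].
          exists d1. intros x y _ Hy. apply (H1 y Hy).
    - intros x Hx. apply Rabs_def2 in Hx.
      assert (M1 := Rmin_l (s + d) (1 + d - s)). assert (M2 := Rmin_r (s + d) (1 + d - s)).
      apply ccurve_mult; [|apply ccurve_kernel; lra].
      apply ccurve_deriv. intros u. eexists. apply (curve_deriv_comp h (fun y => G x y)).
      + apply Hh, HG2; lra.
      + apply HGu. }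
  assert (HF0 : forall s, 0 <= s <= 1 -> CInt (F' s) = 0).
  { intros s Hs.
    assert (cF : ccurve (F' s)).
    { apply ccurve_mult; [|apply ccurve_circ]. apply ccurve_deriv. intros u.
      destruct (Hh' (G s u)) as [l Hl]; [apply HG2; lra|].
      eexists. apply (curve_deriv_comp h' (fun y => G s y)); [exact Hl|apply HGu]. }
    assert (Q := Ci_neq_0).
    (* The antiderivative h (G s t) / (s i) requires s to be nonzero; at s = 0 the factor coming
       from h' is the constant h' z. *)
    destruct (Req_dec s 0) as [E|E].
    - subst s. rewrite (CInt_derive (fun t => (h' z / Ci) * circ rho t)%C _ cF).
      + rewrite circ_2PI. ring.
      + intros t. eapply curve_deriv_eq; [apply curve_deriv_scal, curve_deriv_circ|].
        unfold F', G. replace (z + 0 * (circ rho t - z))%C with z by ring. field. auto.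
    - assert (N : RtoC s <> 0) by (intros X; apply RtoC_inj in X; auto).
      rewrite (CInt_derive (fun t => / (RtoC s * Ci) * h (G s t))%C _ cF).
      + unfold G. rewrite circ_2PI. ring.
      + intros t. eapply curve_deriv_eq; [apply curve_deriv_scal;
          apply (curve_deriv_comp h (fun y => G s y)); [apply Hh, HG2; lra|apply HGu]|].
        unfold F'. field. auto. }
  assert (E := curve_deriv_zero_const (fun s => CInt (F s)) 0 1 Rle_0_1).
  cbv beta in E.
  rewrite (CInt_ext _ (F 1)).
  - rewrite <- E.
    + rewrite (CInt_ext _ (fun t => h z * cauchy_kernel rho z t)%C).
      * rewrite CInt_scal by (apply ccurve_kernel; lra). rewrite CInt_kernel by lra. ring.
      * intros t. unfold F, G. replace (z + 0 * (circ rho t - z))%C with z by ring. reflexivity.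
    + intros t Ht. rewrite <- (HF0 t Ht). apply HF. lra.
  - intros t. unfold F, G. replace (z + 1 * (circ rho t - z))%C with (circ rho t) by ring. reflexivity.
Qed.

(** Cauchy's formula inserted in the kernel series: the coefficients are the means of h zeta^(-k),
    which gives the Cauchy estimates. They are still tied to the chosen circle; [taylor_disk]
    removes this dependence. *)
Lemma taylor_circle (h h' : C -> C) (rho M : R) : 0 < rho < 1 ->
  (forall x, in_disk x -> cderiv h x (h' x)) -> (forall x, in_disk x -> exists l, cderiv h' x l) ->
  (forall t, 0 <= t <= 2 * PI -> Cmod (h (circ rho t)) <= M) ->
  exists a : nat -> C, (forall k, Cmod (a k) * rho ^ k <= M) /\
    forall z, Cmod z < rho -> cseries (fun k => a k * z ^ k)%C (h z).
Proof.
  intros Hr Hh Hh' HM. assert (P := PI_RGT_0).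
  assert (N : RtoC (2 * PI) <> 0) by (intros E; apply RtoC_inj in E; lra).
  assert (c : ccurve (fun t => h (circ rho t))).
  { apply ccurve_comp_circ; [|lra]. intros z Hz. eexists. apply Hh. unfold in_disk. lra. }
  exists (fun k => / RtoC (2 * PI) * CInt (fun t => h (circ rho t) * / (circ rho t) ^ k))%C. split.
  - intros k. assert (Pk : 0 < rho ^ k) by (apply pow_lt; lra).
    assert (B : Cmod (CInt (fun t => h (circ rho t) * / (circ rho t) ^ k)%C) <= 2 * PI * (M * / rho ^ k)).
    { apply CInt_le; [apply ccurve_mult; [auto|apply ccurve_inv_circ_pow; lra]|].
      intros t Ht. rewrite Cmod_mult, Cmod_inv by (apply Cpow_nz, circ_neq_0; lra).
      rewrite Cmod_pow, Cmod_circ by lra. apply Rmult_le_compat_r; [left; apply Rinv_0_lt_compat; auto|auto]. }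
    rewrite Cmod_mult, Cmod_inv, Cmod_R, Rabs_pos_eq by (auto; lra).
    apply Rle_trans with (/ (2 * PI) * (2 * PI * (M * / rho ^ k)) * rho ^ k).
    + apply Rmult_le_compat_r; [lra|]. apply Rmult_le_compat_l; [left; apply Rinv_0_lt_compat; lra|auto].
    + right. field. lra.
  - intros z Hz.
    assert (S := CInt_kernel_series rho z _ M ltac:(lra) Hz c HM). cbv beta in S.
    rewrite (cauchy_formula h h' rho z Hr Hz Hh Hh') in S.
    apply (cseries_scal (/ RtoC (2 * PI))) in S.
    replace (/ RtoC (2 * PI) * (RtoC (2 * PI) * h z))%C with (h z) in S by (field; auto).
    eapply cseries_ext; [|exact S]. intros k. simpl. ring.
Qed.

Lemma cseries_single (c : C) (k : nat) : cseries (fun j => if Nat.eqb j k then c else RtoC 0) c.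
Proof.
  apply cseries_eps. intros eps Heps. exists k. intros n Hn.
  assert (E : forall n, @eq C (csum_n (fun j => if Nat.eqb j k then c else RtoC 0) n) (if Nat.leb k n then c else RtoC 0)).
  { clear. induction n as [|n IH].
    - rewrite csum_O. destruct k; reflexivity.
    - rewrite csum_S, IH.
      destruct (Nat.leb_spec k n), (Nat.leb_spec k (S n)), (Nat.eqb_spec (S n) k); try lia;
        match goal with |- ?x = ?y => change (@eq C x y) end; ring. }
  rewrite E. destruct (Nat.leb_spec k n); [|lia].
  replace (c - c)%C with (RtoC 0) by ring. rewrite Cmod_0; auto.
Qed.

Lemma is_series_geom_pos (x : R) : 0 <= x < 1 -> is_series (fun k => x ^ k) (/ (1 - x)).
Proof. intros H. apply is_series_geom. rewrite Rabs_pos_eq; lra. Qed.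

(** Once the lower coefficients vanish, at a small real x both [s] and the tail are O(x^(k+1)), so
    a_k is bounded by a multiple of x. With [s] and [K] zero this is uniqueness of coefficients;
    with [s] a power of [w] it yields the order of vanishing behind the Schwarz lemma. *)
Lemma ps_vanish (a : nat -> C) (s : C -> C) (rho M K d : R) (n : nat) : 0 < rho -> 0 < d ->
  (forall k, Cmod (a k) * rho ^ k <= M) ->
  (forall z, Cmod z < rho -> cseries (fun k => a k * z ^ k)%C (s z)) ->
  (forall z, Cmod z < d -> Cmod (s z) <= K * Cmod z ^ n) ->
  forall k, (k < n)%nat -> a k = 0.
Proof.
  intros Hr Hd HM Hs HK k. induction k as [k IH] using (well_founded_induction Nat.lt_wf_0). intros Hk.
  assert (M0 : 0 <= M).
  { eapply Rle_trans; [|apply (HM 0%nat)]. apply Rmult_le_pos; [apply Cmod_ge_0|simpl; lra]. }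
  assert (K0 : 0 <= K).
  { assert (T := HK (RtoC (d / 2))). rewrite Cmod_R, Rabs_pos_eq in T by lra.
    specialize (T ltac:(lra)). assert (Q : 0 < (d / 2) ^ n) by (apply pow_lt; lra).
    assert (Q2 := Cmod_ge_0 (s (RtoC (d / 2)))). nra. }
  (* For j > k and x < rho / 2, |a_j| x^j <= M (x / rho)^j <= M (2 x / rho)^(k+1) 2^(-j). Summing
     the powers of 1/2 gives the factor 2, so the tail is at most L x^(k+1). *)
  set (L := 2 * (M * (2 / rho) ^ (S k))).
  assert (L0 : 0 <= L).
  { unfold L. apply Rmult_le_pos; [lra|]. apply Rmult_le_pos; [auto|]. apply pow_le.
    apply Rlt_le, Rdiv_lt_0_compat; lra. }
  assert (main : forall x, 0 < x -> x < 1 -> x < d -> x < rho / 2 -> Cmod (a k) <= (K + L) * x).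
  { intros x X0 X1 Xd Xr.
    assert (Cx : Cmod (RtoC x) = x) by (rewrite Cmod_R, Rabs_pos_eq; lra).
    assert (S1 := Hs (RtoC x) ltac:(rewrite Cx; lra)).
    assert (S2 := cseries_minus _ _ _ _ S1 (cseries_single (a k * RtoC x ^ k)%C k)).
    assert (S3 : is_series (fun j => (M * (2 * x / rho) ^ (S k)) * (/ 2) ^ j) ((M * (2 * x / rho) ^ (S k)) * (/ (1 - / 2)))).
    { apply (@is_series_scal R_AbsRing R_NormedModule). apply is_series_geom_pos. lra. }
    assert (B := cseries_Cmod_le _ _ _ _ S2 S3).
    assert (Y0 : 0 < x / rho) by (apply Rdiv_lt_0_compat; lra).
    assert (Y1 : x / rho <= / 2) by (apply Rle_div_l; lra).
    assert (W : forall j, 0 <= M * (2 * x / rho) ^ (S k) * (/ 2) ^ j).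
    { intros j. apply Rmult_le_pos; [apply Rmult_le_pos; [auto|]|]; apply pow_le; [|lra].
      apply Rlt_le, Rdiv_lt_0_compat; lra. }
    assert (B' : Cmod (s (RtoC x) - a k * RtoC x ^ k)%C <= L * x ^ (S k)).
    { eapply Rle_trans; [apply B|].
      - intros j. destruct (Nat.eqb_spec j k) as [->|Hj].
        + replace (a k * RtoC x ^ k - a k * RtoC x ^ k)%C with (RtoC 0) by ring. rewrite Cmod_0.
          apply W.
        + destruct (Nat.lt_ge_cases j k) as [Hjk|Hjk].
          * rewrite (IH j Hjk) by lia. replace (0 * RtoC x ^ j - 0)%C with (RtoC 0) by ring. rewrite Cmod_0.
            apply W.
          * replace (a j * RtoC x ^ j - 0)%C with (a j * RtoC x ^ j)%C by ring.
            rewrite Cmod_mult, Cmod_pow, Cx.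
            replace (Cmod (a j) * x ^ j) with ((Cmod (a j) * rho ^ j) * (x / rho) ^ j).
            2:{ unfold Rdiv. rewrite Rpow_mult_distr, pow_inv. field. apply pow_nonzero. lra. }
            rewrite (Rmult_assoc M). apply Rmult_le_compat; [apply Rmult_le_pos; [apply Cmod_ge_0|apply pow_le; lra]|apply pow_le; lra|auto|].
            replace j with (S k + (j - S k))%nat at 1 by lia.
            rewrite pow_add. replace (2 * x / rho) with (2 * (x / rho)) by (field; lra).
            rewrite Rpow_mult_distr, (Rmult_comm (2 ^ S k)), Rmult_assoc.
            apply Rmult_le_compat_l; [apply pow_le; lra|].
            apply Rle_trans with ((/ 2) ^ (j - S k)); [apply pow_incr; lra|].
            right. replace j with (S k + (j - S k))%nat at 2 by lia.
            rewrite pow_add, <- Rmult_assoc, <- Rpow_mult_distr.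
            replace (2 * / 2) with 1 by field. rewrite pow1. ring.
      - right. unfold L. replace (2 * x / rho) with (2 / rho * x) by (field; lra).
        rewrite (Rpow_mult_distr (2 / rho) x). field. }
    assert (Z := HK (RtoC x) ltac:(rewrite Cx; lra)). rewrite Cx in Z.
    assert (T := Cmod_minus_ge (a k * RtoC x ^ k)%C (s (RtoC x))).
    replace (Cmod (a k * RtoC x ^ k - s (RtoC x))%C) with (Cmod (s (RtoC x) - a k * RtoC x ^ k)%C) in T
      by (rewrite <- Cmod_opp; f_equal; ring).
    rewrite Cmod_mult, Cmod_pow, Cx in T.
    assert (xn : x ^ n <= x ^ (S k)).
    { replace n with (S k + (n - S k))%nat by lia. rewrite pow_add.
      assert (Q : x ^ (n - S k) <= 1) by (rewrite <- (pow1 (n - S k)); apply pow_incr; lra).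
      assert (Q2 : 0 < x ^ S k) by (apply pow_lt; auto). nra. }
    assert (xk : 0 < x ^ k) by (apply pow_lt; auto).
    apply Rmult_le_reg_r with (x ^ k); [auto|].
    replace ((K + L) * x * x ^ k) with (K * x ^ S k + L * x ^ S k) by (simpl; ring).
    assert (K * x ^ n <= K * x ^ S k) by (apply Rmult_le_compat_l; auto). lra. }
  apply Cmod_eq_0. apply Rle_antisym; [|apply Cmod_ge_0].
  apply le_epsilon. intros eps Heps. rewrite Rplus_0_l.
  set (x := Rmin (Rmin (/ 2) (d / 2)) (Rmin (rho / 4) (eps / (K + L + 1)))).
  assert (E1 : 0 < eps / (K + L + 1)) by (apply Rdiv_lt_0_compat; lra).
  assert (X0 : 0 < x) by (unfold x; repeat apply Rmin_pos; lra).
  assert (X1 : x <= / 2) by (unfold x; eapply Rle_trans; apply Rmin_l).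
  assert (X2 : x <= d / 2) by (unfold x; eapply Rle_trans; [apply Rmin_l|apply Rmin_r]).
  assert (X3 : x <= rho / 4) by (unfold x; eapply Rle_trans; [apply Rmin_r|apply Rmin_l]).
  assert (X4 : x <= eps / (K + L + 1)) by (unfold x; eapply Rle_trans; [apply Rmin_r|apply Rmin_r]).
  apply Rle_div_r in X4; [|lra].
  specialize (main x X0 ltac:(lra) ltac:(lra) ltac:(lra)). nra.
Qed.

(** * Power series converging in the disk *)

(** Radius of convergence at least 1, expressed by bounded terms instead of an upper limit of
    roots. *)
Definition subgeometric (a : nat -> C) : Prop :=
  forall r, 0 < r < 1 -> exists M, forall k, Cmod (a k) * r ^ k <= M.

Lemma one_minus_pow_ge (e : R) (k : nat) : 0 <= e <= 1 -> 1 - INR k * e <= (1 - e) ^ k.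
Proof.
  intros He. induction k as [|k IH]; [simpl; lra|].
  rewrite S_INR. simpl pow. assert (J := pos_INR k). nra.
Qed.

(** The coefficients from the circle of radius 1/2 serve for every larger radius, because
    [ps_vanish] applied to the difference of two expansions of [h] identifies them. The last clause
    comes from the Cauchy estimates as the radius tends to 1. *)
Lemma taylor_disk (h h' : C -> C) :
  (forall x, in_disk x -> cderiv h x (h' x)) -> (forall x, in_disk x -> exists l, cderiv h' x l) ->
  exists a, subgeometric a /\ (forall z, in_disk z -> cseries (fun k => a k * z ^ k)%C (h z)) /\
    (forall M, (forall z, in_disk z -> Cmod (h z) <= M) -> forall k, Cmod (a k) <= M).
Proof.
  intros Hh Hh'.
  assert (B : forall rho, 0 < rho < 1 -> exists M, forall t, 0 <= t <= 2 * PI -> Cmod (h (circ rho t)) <= M).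
  { intros rho Hr. apply (ccurve_bounded (fun t => h (circ rho t))).
    apply ccurve_comp_circ; [|lra]. intros z Hz. eexists. apply Hh. unfold in_disk. lra. }
  destruct (B (/ 2)) as [M0 HM0]; [lra|].
  destruct (taylor_circle h h' (/ 2) M0 ltac:(lra) Hh Hh' HM0) as [a [Ha Hs]].
  assert (U : forall rho M, / 2 <= rho < 1 -> (forall t, 0 <= t <= 2 * PI -> Cmod (h (circ rho t)) <= M) ->
    (forall k, Cmod (a k) * rho ^ k <= M) /\ forall z, Cmod z < rho -> cseries (fun k => a k * z ^ k)%C (h z)).
  { intros rho M Hr HM.
    destruct (taylor_circle h h' rho M ltac:(lra) Hh Hh' HM) as [b [Hb Hsb]].
    assert (E : forall k, a k = b k).
    { intros k.
      assert (V := ps_vanish (fun k => a k - b k)%C (fun _ => 0%C) (/ 2) (M0 + M) 0 1 (S k)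
        ltac:(lra) Rlt_0_1).
      assert (D : (a k - b k)%C = 0).
      { apply V; [| | |lia].
        - intros j. eapply Rle_trans; [apply Rmult_le_compat_r; [apply pow_le; lra|apply Cmod_minus_le]|].
          rewrite Rmult_plus_distr_r. apply Rplus_le_compat; [apply Ha|].
          eapply Rle_trans; [|apply Hb]. apply Rmult_le_compat_l; [apply Cmod_ge_0|apply pow_incr; lra].
        - intros z Hz. assert (X := cseries_minus _ _ _ _ (Hs z Hz) (Hsb z ltac:(lra))).
          replace (h z - h z)%C with (RtoC 0) in X by ring.
          eapply cseries_ext; [|exact X]. intros j. simpl. ring.
        - intros z _. rewrite Cmod_0. lra. }
      apply (f_equal (fun x => (x + b k)%C)) in D.
      replace (a k - b k + b k)%C with (a k) in D by ring. rewrite D. ring. }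
    split.
    - intros k. rewrite E. apply Hb.
    - intros z Hz. eapply cseries_ext; [|apply Hsb, Hz]. intros k. simpl. now rewrite E. }
  exists a. split; [|split].
  - intros r Hr.
    destruct (B (Rmax r (/ 2))) as [M HM].
    { split; [eapply Rlt_le_trans; [|apply Rmax_l]; lra|apply Rmax_lub_lt; lra]. }
    exists M. intros k. destruct (U (Rmax r (/ 2)) M ltac:(split; [apply Rmax_r|apply Rmax_lub_lt; lra]) HM) as [X _].
    eapply Rle_trans; [|apply (X k)]. apply Rmult_le_compat_l; [apply Cmod_ge_0|].
    apply pow_incr. split; [lra|apply Rmax_l].
  - intros z Hz. unfold in_disk in Hz. assert (G := Cmod_ge_0 z).
    destruct (B ((1 + Cmod z) / 2)) as [M HM]; [lra|].
    destruct (U ((1 + Cmod z) / 2) M ltac:(lra) HM) as [_ X]. apply X. lra.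
  - intros M HM k. destruct (Rle_lt_dec (Cmod (a k)) M) as [L|L]; [auto|exfalso].
    assert (M1 : 0 <= M) by (eapply Rle_trans; [apply Cmod_ge_0|apply (HM 0%C)]; unfold in_disk; rewrite Cmod_0; lra).
    assert (K1 := pos_INR k).
    set (A := Cmod (a k)) in *.
    (* The first bound keeps the radius 1 - e at least 1/2. By the second, A k e <= (A - M) / 2, so
       Bernoulli's inequality gives A (1 - e)^k > M, against the Cauchy estimate on that circle. *)
    set (e := Rmin (/ 2) ((A - M) / (2 * (A * (INR k + 1))))).
    assert (e0 : 0 < e).
    { unfold e. apply Rmin_pos; [lra|]. apply Rdiv_lt_0_compat; [lra|]. nra. }
    assert (e1 : e <= / 2) by apply Rmin_l.
    assert (e2 : e * (2 * (A * (INR k + 1))) <= A - M).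
    { apply Rle_div_r; [nra|apply Rmin_r]. }
    assert (Be : 1 - INR k * e <= (1 - e) ^ k).
    { apply one_minus_pow_ge. lra. }
    destruct (U (1 - e) M ltac:(lra)) as [X _].
    + intros t _. apply HM. unfold in_disk. rewrite Cmod_circ; lra.
    + specialize (X k). fold A in X. nra.
Qed.

Definition PSum (a : nat -> C) (z : C) : C :=
  (Series (fun k => Re (a k * z ^ k)%C), Series (fun k => Im (a k * z ^ k)%C)).

Lemma cseries_PSum (a : nat -> C) (z : C) : subgeometric a -> in_disk z ->
  cseries (fun k => a k * z ^ k)%C (PSum a z).
Proof.
  intros Ha Hz. unfold in_disk in Hz. assert (G := Cmod_ge_0 z).
  destruct (Ha ((1 + Cmod z) / 2)) as [M HM]; [lra|].
  set (r := (1 + Cmod z) / 2) in *.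
  assert (X : forall f : nat -> R, (forall k, Rabs (f k) <= Cmod (a k * z ^ k)%C) -> ex_series f).
  { intros f Hf. apply (@ex_series_le R_AbsRing R_CompleteNormedModule f (fun k => M * (Cmod z / r) ^ k)).
    - intros k. eapply Rle_trans; [apply Hf|]. rewrite Cmod_mult, Cmod_pow.
      replace (Cmod (a k) * Cmod z ^ k) with ((Cmod (a k) * r ^ k) * (Cmod z / r) ^ k).
      + apply Rmult_le_compat_r; [apply pow_le, Rdiv_le_0_compat; unfold r; lra|auto].
      + unfold Rdiv. rewrite Rpow_mult_distr, pow_inv. field. apply pow_nonzero. unfold r; lra.
    - apply (@ex_series_scal R_AbsRing R_NormedModule). exists (/ (1 - Cmod z / r)).
      apply is_series_geom_pos. split; [apply Rdiv_le_0_compat; unfold r; lra|apply Rlt_div_l; unfold r; lra]. }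
  apply cseries_components. split; apply Series_correct, X; intros k; [apply re_le_Cmod|apply Im_le_Cmod].
Qed.

Lemma PSum_unique (a : nat -> C) (z l : C) : subgeometric a -> in_disk z ->
  cseries (fun k => a k * z ^ k)%C l -> PSum a z = l.
Proof. intros Ha Hz H. eapply cseries_unique; [apply cseries_PSum; auto|exact H]. Qed.

Lemma PSum_0 (a : nat -> C) : subgeometric a -> PSum a 0 = a 0%nat.
Proof.
  intros Ha. apply PSum_unique; [auto|unfold in_disk; rewrite Cmod_0; lra|].
  eapply cseries_ext; [|apply (cseries_single (a 0%nat) 0)].
  intros [|k]; simpl; ring.
Qed.

Definition PSderiv (a : nat -> C) (k : nat) : C := (RtoC (INR (S k)) * a (S k))%C.

(** Bernoulli's inequality for (1/q)^k, multiplied by q^(k+1). *)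
Lemma INR_pow_bounded (q : R) : 0 < q < 1 -> forall k, INR k * q ^ k <= q / (1 - q).
Proof.
  intros Hq k.
  assert (P : 0 < / q - 1) by (assert (1 < / q) by (rewrite <- Rinv_1; apply Rinv_lt_contravar; lra); lra).
  assert (T := poly k (/ q - 1) P).
  replace (1 + (/ q - 1)) with (/ q) in T by ring. rewrite pow_inv in T.
  assert (Q : 0 < q ^ k) by (apply pow_lt; lra).
  apply (proj1 (Rle_div_r _ _ (1 - q) ltac:(lra))).
  apply Rmult_le_compat_r with (r := q ^ k) in T; [|lra].
  rewrite Rinv_l in T by lra.
  apply Rmult_le_compat_r with (r := q) in T; [|lra].
  replace ((1 + INR k * (/ q - 1)) * q ^ k * q) with (q ^ k * q + INR k * q ^ k * (1 - q)) in T by (field; lra).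
  assert (V : 0 < q ^ k * q) by (apply Rmult_lt_0_compat; lra). lra.
Qed.

(** The factor k + 1 is absorbed by enlarging the radius from r to (1 + r) / 2. *)
Lemma subgeometric_deriv (a : nat -> C) : subgeometric a -> subgeometric (PSderiv a).
Proof.
  intros Ha r Hr. destruct (Ha ((1 + r) / 2)) as [M HM]; [lra|].
  set (s := (1 + r) / 2) in *. set (q := r / s).
  assert (Hs : r < s < 1) by (unfold s; lra).
  assert (Hq : 0 < q < 1) by (unfold q; split; [apply Rdiv_lt_0_compat; lra|apply Rlt_div_l; lra]).
  assert (B := INR_pow_bounded q Hq).
  exists (M * (q / (1 - q)) / r). intros k. unfold PSderiv.
  rewrite Cmod_mult, Cmod_R, Rabs_pos_eq by apply pos_INR.
  apply (proj1 (Rle_div_r _ _ r ltac:(lra))).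
  replace (INR (S k) * Cmod (a (S k)) * r ^ k * r) with ((Cmod (a (S k)) * s ^ S k) * (INR (S k) * q ^ S k)).
  - apply Rmult_le_compat; auto.
    + apply Rmult_le_pos; [apply Cmod_ge_0|apply pow_le; lra].
    + apply Rmult_le_pos; [apply pos_INR|apply pow_le; lra].
  - unfold q, Rdiv. rewrite Rpow_mult_distr, pow_inv. simpl pow. field. split; [|lra]. apply pow_nonzero. lra.
Qed.

(** The remainder for k + 1 is z + h times the one for k, plus k z^(k-1) h^2, and k^2 + k <= (k +
    1)^2. Writing r^k (|h| / r)^2 keeps the truncated exponent k - 2 out of the bound. *)
Lemma Cpow_taylor2 (z h : C) (r : R) (k : nat) : 0 < r -> Cmod z <= r -> Cmod (z + h)%C <= r ->
  Cmod ((z + h) ^ k - z ^ k - RtoC (INR k) * z ^ (k - 1) * h)%C <= INR k ^ 2 * r ^ k * (Cmod h / r) ^ 2.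
Proof.
  intros Hr Hz Hzh. induction k as [|k IH].
  - simpl. replace (1 - 1 - 0 * 1 * h)%C with (RtoC 0) by ring. rewrite Cmod_0. lra.
  - replace (S k - 1)%nat with k by lia. rewrite !Cpow_S, S_INR, RtoC_plus.
    replace ((z + h) * (z + h) ^ k - z * z ^ k - (RtoC (INR k) + 1) * z ^ k * h)%C with
      ((z + h) * ((z + h) ^ k - z ^ k - RtoC (INR k) * z ^ (k - 1) * h) + RtoC (INR k) * z ^ (k - 1) * (h * h))%C.
    + eapply Rle_trans; [apply Cmod_triangle|]. rewrite !Cmod_mult, Cmod_R, Cmod_pow.
      rewrite Rabs_pos_eq by apply pos_INR.
      assert (K := pos_INR k). assert (H0 := Cmod_ge_0 h). assert (Z0 := Cmod_ge_0 z).
      set (X := Cmod ((z + h) ^ k - z ^ k - RtoC (INR k) * z ^ (k - 1) * h)%C) in *.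
      assert (X0 : 0 <= X) by apply Cmod_ge_0.
      assert (Pk : 0 < r ^ k) by (apply pow_lt; auto).
      assert (A : Cmod (z + h)%C * X <= r * (INR k ^ 2 * r ^ k * (Cmod h / r) ^ 2)).
      { apply Rmult_le_compat; auto; apply Cmod_ge_0. }
      assert (B : INR k * Cmod z ^ (k - 1) * (Cmod h * Cmod h) <= INR k * (r ^ S k * (Cmod h / r) ^ 2)).
      { destruct k as [|k]; [simpl INR; lra|].
        rewrite Rmult_assoc. apply Rmult_le_compat_l; [auto|].
        replace (S k - 1)%nat with k by lia.
        replace (r ^ S (S k) * (Cmod h / r) ^ 2) with (r ^ k * (Cmod h * Cmod h)) by (simpl; field; lra).
        apply Rmult_le_compat_r; [nra|]. apply pow_incr; lra. }
      eapply Rle_trans; [apply Rplus_le_compat; [exact A|exact B]|].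
      replace (r * (INR k ^ 2 * r ^ k * (Cmod h / r) ^ 2) + INR k * (r ^ S k * (Cmod h / r) ^ 2)) with
        ((INR k ^ 2 + INR k) * (r ^ S k * (Cmod h / r) ^ 2)) by (simpl; ring).
      rewrite Rmult_assoc. apply Rmult_le_compat_r; [|nra].
      apply Rmult_le_pos; [apply pow_le; lra|apply pow2_ge_0].
    + destruct k as [|k]; [simpl; ring|]. replace (S k - 1)%nat with k by lia. rewrite !Cpow_S. ring.
Qed.

Lemma cderiv_PSum (a : nat -> C) (z : C) : subgeometric a -> in_disk z ->
  cderiv (PSum a) z (PSum (PSderiv a) z).
Proof.
  intros Ha Hz. unfold in_disk in Hz. assert (G := Cmod_ge_0 z).
  set (r := (1 + Cmod z) / 2). assert (Hr : Cmod z < r < 1) by (unfold r; lra).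
  (* Three powers of s are spent on each term: |a_k| k^2 r^k = |a_k| (r / s^3)^k (k s^k)^2 s^k,
     where the first product and k s^k are bounded and s^k is summable. Bernoulli's inequality gives
     r < s^3 for this s. *)
  set (s := 1 - (1 - r) / 4). assert (Hs : 0 < s < 1) by (unfold s; lra).
  assert (Hs3 : r < s ^ 3) by (assert (Q := one_minus_pow_ge ((1 - r) / 4) 3 ltac:(lra)); fold s in Q; simpl INR in Q; lra).
  assert (Hs3' : 0 < s ^ 3) by lra.
  destruct (Ha (r / s ^ 3)) as [M HM].
  { split; [apply Rdiv_lt_0_compat; lra|apply Rlt_div_l; lra]. }
  assert (M0 : 0 <= M).
  { eapply Rle_trans; [|apply (HM 0%nat)]. apply Rmult_le_pos; [apply Cmod_ge_0|simpl; lra]. }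
  set (c := s / (1 - s)).
  assert (c0 : 0 < c) by (unfold c; apply Rdiv_lt_0_compat; lra).
  set (K := M * c ^ 2 / r ^ 2 * (/ (1 - s))).
  assert (r2 : 0 < r ^ 2) by (apply pow_lt; lra).
  assert (K0 : 0 <= K).
  { unfold K. apply Rmult_le_pos; [|left; apply Rinv_0_lt_compat; lra].
    apply Rdiv_le_0_compat; [apply Rmult_le_pos; [auto|apply pow2_ge_0]|auto]. }
  assert (main : forall h, Cmod h < r - Cmod z ->
    Cmod (PSum a (z + h) - PSum a z - PSum (PSderiv a) z * h)%C <= K * Cmod h ^ 2).
  { intros h Hh.
    assert (Hzh : Cmod (z + h)%C <= r) by (eapply Rle_trans; [apply Cmod_triangle|lra]).
    assert (S1 := cseries_PSum a (z + h)%C Ha ltac:(unfold in_disk; lra)).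
    assert (S2 := cseries_PSum a z Ha Hz).
    assert (S3 := cseries_PSum (PSderiv a) z (subgeometric_deriv a Ha) Hz).
    (* Reindexed so that the terms line up with those of the two other series; at k = 0 the
       truncated exponent is harmless because [INR 0] annihilates the term. *)
    assert (S3' : cseries (fun k => RtoC (INR k) * a k * z ^ (k - 1))%C (PSum (PSderiv a) z)).
    { apply cseries_shift. replace (PSum (PSderiv a) z - RtoC (INR 0) * a 0%nat * z ^ (0 - 1))%C
        with (PSum (PSderiv a) z) by (simpl; ring).
      eapply cseries_ext; [|exact S3]. intros k. unfold PSderiv.
      replace (S k - 1)%nat with k by lia. reflexivity. }
    assert (S4 := cseries_minus _ _ _ _ (cseries_minus _ _ _ _ S1 S2) (cseries_scal h _ _ S3')).
    rewrite (Cmult_comm h) in S4.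
    assert (S5 : is_series (fun k => (M * c ^ 2 / r ^ 2 * Cmod h ^ 2) * s ^ k) ((M * c ^ 2 / r ^ 2 * Cmod h ^ 2) * / (1 - s))).
    { apply (@is_series_scal R_AbsRing R_NormedModule). apply is_series_geom_pos. lra. }
    eapply Rle_trans; [apply (cseries_Cmod_le _ _ _ _ S4 S5)|right; unfold K; ring].
    intros k.
    replace (a k * (z + h) ^ k - a k * z ^ k - h * (RtoC (INR k) * a k * z ^ (k - 1)))%C with
      (a k * ((z + h) ^ k - z ^ k - RtoC (INR k) * z ^ (k - 1) * h))%C by ring.
    rewrite Cmod_mult.
    eapply Rle_trans; [apply Rmult_le_compat_l; [apply Cmod_ge_0|apply (Cpow_taylor2 z h r k); lra]|].
    specialize (HM k). assert (B := INR_pow_bounded s Hs k). fold c in B.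
    assert (sk : 0 < s ^ k) by (apply pow_lt; lra).
    assert (B2 : (INR k * s ^ k) ^ 2 <= c ^ 2).
    { apply pow_incr. split; [apply Rmult_le_pos; [apply pos_INR|lra]|auto]. }
    replace (Cmod (a k) * (INR k ^ 2 * r ^ k * (Cmod h / r) ^ 2)) with
      ((Cmod (a k) * (r / s ^ 3) ^ k) * (INR k * s ^ k) ^ 2 * (Cmod h ^ 2 / r ^ 2 * s ^ k)).
    - replace (M * c ^ 2 / r ^ 2 * Cmod h ^ 2 * s ^ k) with (M * c ^ 2 * (Cmod h ^ 2 / r ^ 2 * s ^ k)) by (field; lra).
      apply Rmult_le_compat_r.
      + apply Rmult_le_pos; [|lra]. apply Rdiv_le_0_compat; [apply pow2_ge_0|auto].
      + apply Rmult_le_compat; auto; [|apply pow2_ge_0].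
        apply Rmult_le_pos; [apply Cmod_ge_0|]. apply pow_le, Rdiv_le_0_compat; lra.
    - unfold Rdiv. rewrite !Rpow_mult_distr, !pow_inv, <- !pow_mult.
      replace (s ^ (3 * k)) with (s ^ k * s ^ k * s ^ k) by (rewrite <- !pow_add; f_equal; lia).
      replace (s ^ (k * 2)) with (s ^ k * s ^ k) by (rewrite <- !pow_add; f_equal; lia).
      field. split; lra. }
  intros eps Heps. exists (Rmin (r - Cmod z) (eps / (K + 1))).
  split; [apply Rmin_pos; [lra|apply Rdiv_lt_0_compat; lra]|]. intros h Hh.
  assert (A : Cmod h < r - Cmod z) by (eapply Rlt_le_trans; [exact Hh|apply Rmin_l]).
  assert (B : Cmod h < eps / (K + 1)) by (eapply Rlt_le_trans; [exact Hh|apply Rmin_r]).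
  apply Rlt_div_r in B; [|lra].
  eapply Rle_trans; [apply main, A|]. assert (Q := Cmod_ge_0 h). simpl. nra.
Qed.

(** * The logarithm of 1 - z *)

Lemma cderiv_zero_const (F : C -> C) (r : R) : (forall z, Cmod z < r -> cderiv F z 0) ->
  forall z, Cmod z < r -> F z = F 0%C.
Proof.
  intros H z Hz.
  assert (T := curve_deriv_zero_const (fun t => F (0 + RtoC t * z)%C) 0 1 Rle_0_1).
  cbv beta in T. rewrite !Cplus_0_l, Cmult_1_l, Cmult_0_l in T. symmetry. apply T.
  intros t Ht. eapply curve_deriv_eq;
    [apply (curve_deriv_comp F (fun s => 0 + RtoC s * z)%C t 0 z); [|apply curve_deriv_line]|ring].
  apply H. rewrite Cplus_0_l, Cmod_mult, Cmod_R, Rabs_pos_eq by lra.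
  assert (G := Cmod_ge_0 z). nra.
Qed.

(** [log1m z = log (1 - z)], principal branch. *)
Definition log1m_coef (k : nat) : C := match k with O => 0%C | S _ => (- / RtoC (INR k))%C end.
Definition log1m (z : C) : C := PSum log1m_coef z.

Lemma INR_C_neq_0 (k : nat) : RtoC (INR (S k)) <> 0.
Proof. intros E. apply RtoC_inj in E. apply (not_0_INR (S k)); auto. Qed.

Lemma subgeometric_bounded (a : nat -> C) (M : R) : (forall k, Cmod (a k) <= M) -> subgeometric a.
Proof.
  intros H r Hr. exists M. intros k.
  assert (Q : r ^ k <= 1) by (rewrite <- (pow1 k); apply pow_incr; lra).
  assert (Q2 : 0 < r ^ k) by (apply pow_lt; lra).
  assert (G := Cmod_ge_0 (a k)). specialize (H k). nra.
Qed.

Lemma subgeometric_log1m : subgeometric log1m_coef.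
Proof.
  apply (subgeometric_bounded _ 1). intros [|k]; unfold log1m_coef; [rewrite Cmod_0; lra|].
  rewrite Cmod_opp, Cmod_inv, Cmod_R by apply INR_C_neq_0.
  assert (K := pos_INR k). rewrite S_INR, Rabs_pos_eq by lra.
  rewrite <- Rinv_1. apply Rinv_le_contravar; lra.
Qed.

Lemma one_minus_neq_0 (z : C) : in_disk z -> (1 - z)%C <> 0.
Proof.
  intros Hz. apply Cmod_gt_0. assert (T := Cmod_minus_ge 1%C z). rewrite Cmod_1 in T.
  unfold in_disk in Hz. lra.
Qed.

(** Shifting the series by one index shows that its sum l satisfies l - 1 = z l. *)
Lemma cseries_geom (z : C) : in_disk z -> cseries (fun k => z ^ k)%C (/ (1 - z))%C.
Proof.
  intros Hz. assert (N := one_minus_neq_0 z Hz). unfold in_disk in Hz.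
  assert (S := cseries_PSum (fun _ => 1%C) z (subgeometric_bounded _ 1 (fun _ => Req_le _ _ Cmod_1)) Hz).
  assert (S' := proj1 (cseries_shift _ _) S). assert (S2 := cseries_scal z _ _ S).
  set (l := PSum (fun _ => 1%C) z) in *.
  assert (Q : (l - 1 * z ^ 0)%C = (z * l)%C).
  { apply (cseries_unique _ _ _ S'). eapply cseries_ext; [|exact S2]. intros n. simpl. ring. }
  simpl in Q.
  replace (/ (1 - z))%C with l.
  - eapply cseries_ext; [|exact S]. intros n. simpl. ring.
  - replace l with ((l - z * l) * / (1 - z))%C by (field; auto).
    rewrite <- Q. field. auto.
Qed.

Lemma cderiv_log1m (z : C) : in_disk z -> cderiv log1m z (- / (1 - z))%C.
Proof.
  intros Hz. eapply cderiv_eq; [apply cderiv_PSum; [apply subgeometric_log1m|auto]|].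
  apply PSum_unique; [apply subgeometric_deriv, subgeometric_log1m|auto|].
  replace (- / (1 - z))%C with (- (1) * / (1 - z))%C by (field; apply one_minus_neq_0; auto).
  eapply cseries_ext; [|apply cseries_scal, cseries_geom, Hz].
  intros n. unfold PSderiv, log1m_coef. simpl. field. apply INR_C_neq_0.
Qed.

Lemma log1m_0 : log1m 0 = 0.
Proof. unfold log1m. rewrite PSum_0 by apply subgeometric_log1m. reflexivity. Qed.

(** The quotient of the two sides has derivative zero and the value 1 at the origin. *)
Lemma Cexp_log1m (z : C) : in_disk z -> Cexp (log1m z) = (1 - z)%C.
Proof.
  intros Hz. assert (N := one_minus_neq_0 z Hz).
  assert (T := cderiv_zero_const (fun x => Cexp (log1m x) / (1 - x))%C 1).
  cbv beta in T. assert (E : (Cexp (log1m z) / (1 - z))%C = 1%C).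
  { rewrite T; [rewrite log1m_0, Cexp_0; field| |exact Hz].
    intros x Hx. assert (Nx := one_minus_neq_0 x Hx).
    eapply cderiv_eq; [apply cderiv_div; [exact Nx|apply (cderiv_comp Cexp log1m);
      [apply cderiv_Cexp|apply cderiv_log1m, Hx]|apply cderiv_minus; [apply cderiv_const|apply cderiv_id]]|].
    cbv beta. field. auto. }
  replace (Cexp (log1m z)) with (Cexp (log1m z) / (1 - z) * (1 - z))%C by (field; auto).
  rewrite E. ring.
Qed.

(** The derivative -1 / (1 - z) is at most 1 / (1 - |z|) in modulus, the derivative of -ln (1 - x)
    at |z|. *)
Lemma Cmod_log1m_le (z : C) : in_disk z -> Cmod (log1m z) <= - ln (1 - Cmod z).
Proof.
  intros Hz. apply (cderiv_majorant log1m (fun x => - / (1 - x))%C (fun x => - ln (1 - x)) (fun x => / (1 - x)) 1); auto.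
  - apply cderiv_log1m.
  - intros x Hx. auto_derive; [lra|field; lra].
  - intros x Hx. rewrite Cmod_opp, Cmod_inv by (apply one_minus_neq_0; auto).
    assert (T := Cmod_minus_ge 1%C x). rewrite Cmod_1 in T. apply Rinv_le_contravar; lra.
  - apply log1m_0.
  - rewrite Rminus_0_r, ln_1. ring.
Qed.

(** * The Schwarz lemma *)

(** Asking for two derivatives makes [f'] continuous, so that Cauchy's formula needs no Goursat argument. *)

Definition hol2 (f f' : C -> C) : Prop :=
  (forall z, in_disk z -> cderiv f z (f' z)) /\ (forall z, in_disk z -> exists l, cderiv f' z l).

Lemma in_disk_0 : in_disk 0.
Proof. unfold in_disk. rewrite Cmod_0. lra. Qed.

Lemma cderiv_unique (f : C -> C) (z l l' : C) : cderiv f z l -> cderiv f z l' -> l = l'.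
Proof.
  rewrite !cderiv_is_derive. intros H H'.
  rewrite <- (is_C_derive_unique _ _ _ H). apply is_C_derive_unique, H'.
Qed.

Lemma cderiv_ext_disk (f g : C -> C) (r : R) (z l : C) : Cmod z < r ->
  (forall x, Cmod x < r -> f x = g x) -> cderiv f z l -> cderiv g z l.
Proof.
  intros Hz E. apply (cderiv_ext_loc _ _ _ _ (r - Cmod z)); [lra|].
  intros h Hh. apply E. eapply Rle_lt_trans; [apply Cmod_triangle|]. lra.
Qed.

Lemma is_series_geom_tail (x : R) (n : nat) : 0 <= x < 1 ->
  is_series (fun k => if Nat.ltb k n then 0 else x ^ k) (x ^ n * / (1 - x)).
Proof.
  intros Hx. induction n as [|n IH].
  - simpl pow. rewrite Rmult_1_l. apply is_series_geom_pos, Hx.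
  - apply (@is_series_decr_1 R_AbsRing R_NormedModule).
    match goal with |- is_series _ ?L => replace L with (x * (x ^ n * / (1 - x))) end;
      [|change (x * (x ^ n * / (1 - x)) = x ^ S n * / (1 - x) + - 0); simpl; ring].
    apply (is_series_ext (fun k => x * (if Nat.ltb k n then 0 else x ^ k))).
    + intros k. change (Nat.ltb (S k) (S n)) with (Nat.ltb k n). destruct (Nat.ltb k n); simpl; ring.
    + apply (@is_series_scal R_AbsRing R_NormedModule), IH.
Qed.

(* The Taylor coefficients of [w ^ n] vanish below order [n] and are at most [1], so [|w z| ^ n <= |z| ^ n / (1 - |z|)]
   for all [n]. *)
Lemma schwarz (w w' : C -> C) : hol2 w w' -> (forall z, in_disk z -> in_disk (w z)) -> w 0%C = 0 ->
  forall z, in_disk z -> Cmod (w z) <= Cmod z.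
Proof.
  intros [Hw Hw'] Hd H0 z Hz.
  (* Differentiability at the fixed point 0 gives a linear bound, hence |w|^n <= K^n |x|^n, the
     hypothesis of [ps_vanish] for [w ^ n]. *)
  assert (near : exists K d, 0 < d /\ 0 <= K /\ forall x, Cmod x < d -> Cmod (w x) <= K * Cmod x).
  { destruct (Hw 0%C in_disk_0 1 Rlt_0_1) as [d [Hd1 H1]].
    exists (1 + Cmod (w' 0%C)), d. split; [auto|]. split; [generalize (Cmod_ge_0 (w' 0%C)); lra|].
    intros x Hx. specialize (H1 x Hx). rewrite H0, Cplus_0_l in H1.
    assert (T := Cmod_minus_ge (w x - 0)%C (w' 0%C * x)%C). rewrite Cmod_mult in T.
    replace (w x - 0)%C with (w x) in T, H1 by ring. lra. }
  destruct near as [K [d [Hd0 [HK near]]]].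
  assert (main : forall n, Cmod (w z) ^ n <= Cmod z ^ n * / (1 - Cmod z)).
  { intros n.
    destruct (taylor_disk (fun x => w x ^ n)%C (fun x => RtoC (INR n) * w x ^ (n - 1) * w' x)%C) as [a [Ha [Hs Hb]]].
    - intros x Hx. apply (cderiv_comp (fun y => y ^ n)%C w); [apply cderiv_pow|auto].
    - intros x Hx. destruct (Hw' x Hx) as [l Hl]. eexists.
      apply cderiv_mult; [|exact Hl]. apply cderiv_mult; [apply cderiv_const|].
      apply (cderiv_comp (fun y => y ^ (n - 1))%C w); [apply cderiv_pow|auto].
    - assert (B : forall k, Cmod (a k) <= 1).
      { apply Hb. intros x Hx. rewrite Cmod_pow. rewrite <- (pow1 n). apply pow_incr.
        split; [apply Cmod_ge_0|]. left. apply Hd, Hx. }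
      assert (V : forall k, (k < n)%nat -> a k = 0).
      { destruct (Ha (/ 2)) as [M HM]; [lra|].
        apply (ps_vanish a (fun x => w x ^ n)%C (/ 2) M (K ^ n) d); [lra|auto|auto| |].
        - intros x Hx. apply Hs. unfold in_disk. lra.
        - intros x Hx. rewrite Cmod_pow, <- Rpow_mult_distr. apply pow_incr.
          split; [apply Cmod_ge_0|auto]. }
      rewrite <- Cmod_pow.
      eapply cseries_Cmod_le; [apply (Hs z Hz)|apply is_series_geom_tail; split; [apply Cmod_ge_0|exact Hz]|].
      intros k. cbv beta. destruct (Nat.ltb_spec k n) as [L|L].
      + rewrite V, Cmult_0_l, Cmod_0 by auto. lra.
      + rewrite Cmod_mult, Cmod_pow. assert (P := pow_le _ k (Cmod_ge_0 z)). specialize (B k).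
        nra. }
  (* If |w z| > |z|, the powers of the ratio |w z| / |z| are unbounded, but [main] keeps them all
     below 1 / (1 - |z|). *)
  destruct (Rle_lt_dec (Cmod (w z)) (Cmod z)) as [L|L]; [auto|exfalso].
  unfold in_disk in Hz.
  assert (Pz : 0 < Cmod z).
  { apply Cmod_gt_0. intros E. rewrite E, H0 in L. lra. }
  destruct (Pow_x_infinity (Cmod (w z) / Cmod z)) with (b := / (1 - Cmod z) + 1) as [N HN].
  { rewrite Rabs_pos_eq by (apply Rdiv_le_0_compat; [apply Cmod_ge_0|auto]).
    apply Rlt_gt. apply (proj1 (Rlt_div_r _ _ _ Pz)). lra. }
  specialize (HN N (le_n N)). specialize (main N).
  rewrite Rabs_pos_eq in HN by (apply pow_le, Rdiv_le_0_compat; [apply Cmod_ge_0|auto]).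
  assert (PN : 0 < Cmod z ^ N) by (apply pow_lt; auto).
  assert (X : (Cmod (w z) / Cmod z) ^ N <= / (1 - Cmod z)).
  { unfold Rdiv. rewrite Rpow_mult_distr, pow_inv.
    apply (proj2 (Rle_div_l _ _ _ PN)). lra. }
  lra.
Qed.

Lemma class_A_intro (f f' : C -> C) : hol2 f f' -> f 0%C = 0 -> f' 0%C = 1%C -> class_A f.
Proof.
  intros [Hf Hf'] H0 H1. split.
  - intros z Hz. exists (f' z). apply cderiv_is_derive. auto.
  - destruct (taylor_disk f f' Hf Hf') as [a [Ha [Hs _]]].
    exists a. intros z Hz.
    assert (A0 : a 0%nat = 0).
    { rewrite <- PSum_0 by auto. transitivity (f 0%C); [|exact H0].
      apply PSum_unique; [auto|apply in_disk_0|apply Hs, in_disk_0]. }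
    assert (A1 : a 1%nat = 1%C).
    { assert (D := cderiv_PSum a 0%C Ha in_disk_0).
      rewrite PSum_0 in D by (apply subgeometric_deriv; auto).
      apply (cderiv_ext_disk _ f 1) in D; [| apply in_disk_0|intros x Hx; apply PSum_unique; [auto|auto|apply Hs, Hx]].
      assert (E := cderiv_unique _ _ _ _ D (Hf 0%C in_disk_0)). rewrite H1 in E.
      unfold PSderiv in E. simpl in E. rewrite Cmult_1_l in E. exact E. }
    (* Two shifts, since the series in [class_A] starts at index 2. *)
    assert (Sz := proj1 (cseries_shift _ _) (proj1 (cseries_shift _ _) (Hs z Hz))).
    cbv beta in Sz. rewrite A0, A1 in Sz. replace (f z - 0 * z ^ 0 - 1 * z ^ 1)%C with (f z - z)%C in Sz by (simpl; ring).
    eapply cseries_ext; [|exact Sz]. intros n. simpl. replace (n + 2)%nat with (S (S n)) by lia. reflexivity.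
Qed.

Lemma eventually_bounded (u : nat -> R) (B : R) (N : nat) : (forall n, (N <= n)%nat -> u n <= B) ->
  exists M, forall n, u n <= M.
Proof.
  revert B. induction N as [|N IH]; intros B H.
  - exists B. intros n. apply H. lia.
  - apply (IH (Rmax B (u N))). intros n Hn.
    destruct (Nat.eq_dec n N) as [->|Hne]; [apply Rmax_r|].
    eapply Rle_trans; [apply H; lia|apply Rmax_l].
Qed.

(** [class_A] provides pointwise convergence. At the real point r a term is the difference of two
    consecutive partial sums, eventually both within 1 of the limit, hence at most 2;
    [eventually_bounded] takes care of the first terms. *)
Lemma subgeometric_of_cseries (b : nat -> C) (s : C -> C) :
  (forall z, in_disk z -> cseries (fun k => b k * z ^ k)%C (s z)) -> subgeometric b.
Proof.
  intros H r Hr.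
  assert (Cr : Cmod (RtoC r) = r) by (rewrite Cmod_R, Rabs_pos_eq; lra).
  assert (S := H (RtoC r) ltac:(unfold in_disk; rewrite Cr; lra)).
  rewrite cseries_eps in S. destruct (S 1 Rlt_0_1) as [N HN].
  apply (eventually_bounded (fun k => Cmod (b k) * r ^ k) 2 (Datatypes.S N)).
  intros n Hn. destruct n as [|n]; [lia|].
  assert (A := HN n ltac:(lia)). assert (B := HN (Datatypes.S n) ltac:(lia)).
  rewrite csum_S in B.
  rewrite <- Cr at 1. rewrite <- Cmod_pow, <- Cmod_mult.
  set (x := csum_n (fun k => b k * RtoC r ^ k)%C n) in *.
  set (y := (b (Datatypes.S n) * RtoC r ^ Datatypes.S n)%C) in *.
  change C in (type of x).
  replace y with ((x + y - s (RtoC r)) - (x - s (RtoC r)))%C by ring.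
  eapply Rle_trans; [apply Cmod_minus_le|]. lra.
Qed.

(* [z f' / f = psi (w)] is a quotient of power series, and [psi' <> 0] makes [w' = (z f' / f)' / psi' (w)] differentiable,
   which is what [schwarz] needs. *)
Lemma Sstar_schwarz (psi psi' f w : C -> C) : hol2 psi psi' -> (forall z, in_disk z -> psi' z <> 0) ->
  class_S f -> analytic_in_disk w -> (forall z, in_disk z -> in_disk (w z)) -> w 0%C = 0 ->
  (forall z, in_disk z -> log_ratio f z = psi (w z)) ->
  forall z, in_disk z -> Cmod (w z) <= Cmod z.
Proof.
  intros [Hp Hp'] Np [[Af [a Ha]] Uf] Aw Dw W0 Hw.
  (* [class_A] leaves the entries 0 and 1 of [a] arbitrary; they are replaced by the true
     coefficients of [f]. *)
  set (b := fun k => match k with O => RtoC 0 | S O => RtoC 1 | _ => a k end).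
  assert (Sb : forall z, in_disk z -> cseries (fun k => b k * z ^ k)%C (f z)).
  { intros z Hz. apply cseries_shift, cseries_shift. simpl.
    replace (f z - 0 * 1 - 1 * (z * 1))%C with (f z - z)%C by ring.
    eapply cseries_ext; [|apply (Ha z Hz)]. intros n. simpl.
    replace (n + 2)%nat with (S (S n)) by lia. reflexivity. }
  assert (Gb := subgeometric_of_cseries b f Sb).
  set (c := fun k => b (S k)).
  assert (Gc : subgeometric c).
  { intros r Hr. destruct (Gb r Hr) as [M HM]. exists (M / r). intros k.
    apply (proj1 (Rle_div_r _ _ r ltac:(lra))). eapply Rle_trans; [|apply (HM (S k))].
    right. unfold c. simpl. ring. }
  set (g := PSum c). set (f1 := PSum (PSderiv b)).
  assert (f0 : f 0%C = 0).
  { rewrite <- (PSum_unique b 0%C (f 0%C) Gb in_disk_0 (Sb _ in_disk_0)), PSum_0 by auto. reflexivity. }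
  assert (fg : forall z, in_disk z -> f z = (z * g z)%C).
  { intros z Hz. assert (T := proj1 (cseries_shift _ _) (Sb z Hz)).
    unfold b at 2 in T. replace (f z - 0 * z ^ 0)%C with (f z) in T by (simpl; ring).
    apply (cseries_unique _ _ _ T).
    eapply cseries_ext; [|apply cseries_scal, (cseries_PSum c z Gc Hz)]. intros n. unfold c. simpl. ring. }
  assert (Df : forall z, in_disk z -> cderiv f z (f1 z)).
  { intros z Hz. apply (cderiv_ext_disk (PSum b) f 1 z _ Hz); [|apply cderiv_PSum; auto].
    intros x Hx. apply PSum_unique; auto. }
  (* Univalence enters here: a zero of [g] away from the origin would be a second zero of [f]. *)
  assert (gn : forall z, in_disk z -> g z <> 0).
  { intros z Hz E. destruct (Ceq_dec z 0) as [->|Nz].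
    - unfold g in E. rewrite PSum_0 in E by auto. unfold c, b in E. apply RtoC_inj in E. lra.
    - apply Nz, (Uf z 0%C Hz in_disk_0). rewrite f0, fg, E by auto. ring. }
  set (g1 := PSum (PSderiv c)). set (f2 := PSum (PSderiv (PSderiv b))).
  set (g2 := PSum (PSderiv (PSderiv c))). set (f3 := PSum (PSderiv (PSderiv (PSderiv b)))).
  assert (Gb1 := subgeometric_deriv b Gb). assert (Gb2 := subgeometric_deriv _ Gb1).
  assert (Gc1 := subgeometric_deriv c Gc).
  (* This is z f' / f after cancelling the factor z of f = z g, so it is analytic at the origin as
     well. *)
  set (q := fun z => (f1 z / g z)%C).
  set (q' := fun z => ((f2 z * g z - f1 z * g1 z) / (g z * g z))%C).
  assert (Dq : forall z, in_disk z -> cderiv q z (q' z)).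
  { intros z Hz. apply cderiv_div; [auto|apply cderiv_PSum; auto|apply cderiv_PSum; auto]. }
  assert (Dq' : forall z, in_disk z -> exists l, cderiv q' z l).
  { intros z Hz.
    assert (dg := cderiv_PSum c z Gc Hz). assert (dg1 := cderiv_PSum _ z Gc1 Hz).
    assert (df1 := cderiv_PSum _ z Gb1 Hz). assert (df2 := cderiv_PSum _ z Gb2 Hz).
    eexists. apply cderiv_div.
    - apply Cmult_neq_0; auto.
    - apply cderiv_minus; apply cderiv_mult; eassumption.
    - apply cderiv_mult; eassumption. }
  assert (qw : forall z, in_disk z -> psi (w z) = q z).
  { intros z Hz. rewrite <- Hw by auto. unfold log_ratio, q.
    destruct (Ceq_dec z (RtoC 0)) as [->|Nz].
    - unfold f1, g. rewrite !PSum_0 by auto. unfold PSderiv, c, b. simpl.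
      match goal with |- ?x = ?y => change (@eq C x y) end. field.
    - rewrite (is_C_derive_unique f z (f1 z)) by (apply cderiv_is_derive; auto).
      rewrite fg by auto. field. auto. }
  assert (Dw' : forall z, in_disk z -> cderiv w z (q' z / psi' (w z))%C).
  { intros z Hz. destruct (Aw z Hz) as [l Hl]. apply cderiv_is_derive in Hl. change C in (type of l).
    assert (X := cderiv_comp psi w z _ _ (Hp _ (Dw z Hz)) Hl).
    apply (cderiv_ext_disk _ q 1) in X; [|exact Hz|exact qw].
    rewrite <- (cderiv_unique _ _ _ _ X (Dq z Hz)).
    eapply cderiv_eq; [exact Hl|]. field. auto. }
  apply (schwarz w (fun z => q' z / psi' (w z))%C); auto. split; [exact Dw'|].
  intros z Hz. destruct (Dq' z Hz) as [l1 H1]. destruct (Hp' (w z) (Dw z Hz)) as [l2 H2].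
  eexists. apply cderiv_div; [auto|exact H1|].
  apply (cderiv_comp psi' w); [exact H2|apply Dw', Hz].
Qed.

(** * Extremal functions and the radius criterion *)

Lemma Cexp_surjective (z : C) : z <> 0 -> exists u, Cexp u = z.
Proof.
  intros Hz. assert (P : 0 < Cmod z) by (apply Cmod_gt_0; auto).
  set (x := Re z / Cmod z). set (y := Im z / Cmod z).
  assert (E : x ^ 2 + y ^ 2 = 1).
  { unfold x, y. assert (Q := Cmod2_alt z).
    replace ((Re z / Cmod z) ^ 2 + (Im z / Cmod z) ^ 2) with ((Re z ^ 2 + Im z ^ 2) / Cmod z ^ 2) by (field; lra).
    rewrite <- Q. field. lra. }
  assert (Hx : -1 <= x <= 1) by (split; nra).
  assert (Hy : sqrt (1 - x²) = Rabs y).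
  { rewrite <- sqrt_Rsqr_abs. f_equal. unfold Rsqr. lra. }
  assert (Ex : Re z = Cmod z * x) by (unfold x; field; lra).
  assert (Ey : Im z = Cmod z * y) by (unfold y; field; lra).
  destruct (Rle_dec 0 y) as [S|S].
  - exists (ln (Cmod z), acos x). apply C_ext; unfold Cexp; simpl; rewrite exp_ln by auto.
    + rewrite cos_acos; auto.
    + rewrite sin_acos, Hy, Rabs_pos_eq by auto. auto.
  - exists (ln (Cmod z), - acos x). apply C_ext; unfold Cexp; simpl; rewrite exp_ln by auto.
    + rewrite cos_neg, cos_acos; auto.
    + rewrite sin_neg, sin_acos, Hy, Rabs_left by lra. rewrite Ey. ring.
Qed.

Definition period (k : Z) : C := (Ci * RtoC (2 * (IZR k * PI)))%C.

Lemma Cexp_period (u : C) (k : Z) : Cexp (u + period k)%C = Cexp u.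
Proof.
  rewrite Cexp_plus. replace (Cexp (period k)) with (RtoC 1); [ring|].
  assert (S : sin (IZR k * PI) = 0) by (apply sin_eq_0_1; exists k; auto).
  unfold Cexp, period, Re, Im, Ci, RtoC, Cmult; simpl.
  replace (0 * (2 * (IZR k * PI)) - 1 * 0) with 0 by ring.
  replace (0 * 0 + 1 * (2 * (IZR k * PI))) with (2 * (IZR k * PI)) by ring.
  rewrite cos_2a_sin, sin_2a, S, exp_0. f_equal; ring.
Qed.

Lemma Cexp_eq (u v : C) : Cexp u = Cexp v -> exists k, u = (v + period k)%C.
Proof.
  intros H.
  assert (E : Cexp (u - v)%C = 1%C).
  { unfold Cminus. rewrite Cexp_plus, Cexp_opp, H. field. apply Cexp_neq_0. }
  assert (R0 : Re (u - v)%C = 0).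
  { apply exp_inv. rewrite <- Cmod_Cexp, E, Cmod_1, exp_0. reflexivity. }
  assert (C0 : cos (Im (u - v)%C) = 1).
  { apply (f_equal Re) in E. change (exp (Re (u - v)%C) * cos (Im (u - v)%C) = 1) in E.
    rewrite R0, exp_0 in E. lra. }
  set (y := Im (u - v)%C) in *.
  (* The half angle turns cos y = 1 into sin (y / 2) = 0, whose solutions y / 2 = k pi provide the
     integer. *)
  replace y with (2 * (y / 2)) in C0 by field. rewrite cos_2a_sin in C0.
  assert (S : sin (y / 2) = 0) by nra.
  apply sin_eq_0_0 in S. destruct S as [k Hk]. exists k.
  replace u with (v + (u - v))%C by ring. f_equal.
  unfold period. rewrite <- Hk. apply C_ext.
  - rewrite R0. c_ring.
  - fold y. unfold Im, Ci, RtoC, Cmult; simpl. field.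
Qed.

(* [f = z exp Phi] with [z Phi' = psi - 1].  In the coordinate [z = exp u] on the half plane [Re u < 0], [f] becomes
   [exp (L u)] with [L u = u + Phi (exp u)] and [L' u = psi (exp u)] of positive real part on a convex domain, so [L] is
   injective (Noshiro-Warschawski). *)
Lemma Sstar_extremal (psi psi' : C -> C) : hol2 psi psi' -> psi 0%C = 1%C ->
  (forall z, in_disk z -> 0 < Re (psi z)) ->
  exists f f', Sstar psi f /\ (forall z, in_disk z -> cderiv f z (f' z)) /\
    forall z, in_disk z -> log_ratio f z = psi z.
Proof.
  intros [Hp Hp'] P0 Pre.
  destruct (taylor_disk psi psi' Hp Hp') as [c [Hc [Sc _]]].
  assert (c0 : c 0%nat = 1%C).
  { rewrite <- PSum_0 by auto. transitivity (psi 0%C); [|exact P0].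
    apply PSum_unique; [auto|apply in_disk_0|apply Sc, in_disk_0]. }
  (* Termwise integration of (psi - 1) / z, which gives z Phi' = psi - 1. The constant term 0
     normalizes f' 0 to 1. *)
  set (e := fun k => match k with O => RtoC 0 | S _ => (c k / RtoC (INR k))%C end).
  assert (He : subgeometric e).
  { intros r Hr. destruct (Hc r Hr) as [M HM]. exists M. intros k. eapply Rle_trans; [|apply (HM k)].
    apply Rmult_le_compat_r; [apply pow_le; lra|]. unfold e. destruct k as [|k].
    - rewrite Cmod_0. apply Cmod_ge_0.
    - rewrite Cmod_div, Cmod_R by apply INR_C_neq_0. assert (K := pos_INR k).
      rewrite S_INR, Rabs_pos_eq by lra. apply (proj2 (Rle_div_l _ _ (INR k + 1) ltac:(lra))).
      assert (G := Cmod_ge_0 (c (S k))). nra. }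
  set (Phi := PSum e). set (Phi1 := PSum (PSderiv e)).
  assert (DPhi : forall z, in_disk z -> cderiv Phi z (Phi1 z)) by (intros; apply cderiv_PSum; auto).
  assert (EPhi : forall z, in_disk z -> (z * Phi1 z)%C = (psi z - 1)%C).
  { intros z Hz. assert (T := proj1 (cseries_shift _ _) (Sc z Hz)). cbv beta in T. rewrite c0 in T.
    replace (psi z - 1 * z ^ 0)%C with (psi z - 1)%C in T by (simpl; ring).
    refine (cseries_unique _ _ _ _ T).
    eapply cseries_ext; [|apply cseries_scal, (cseries_PSum (PSderiv e) z (subgeometric_deriv e He) Hz)].
    intros n. unfold PSderiv, e. rewrite Cpow_S.
    assert (N := INR_C_neq_0 n).
    match goal with |- ?x = ?y => change (@eq C x y) end. field. auto. }
  assert (Phi0 : Phi 0%C = 0) by (unfold Phi; rewrite PSum_0 by auto; reflexivity).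
  set (f := fun z => (z * Cexp (Phi z))%C). set (f' := fun z => (Cexp (Phi z) * psi z)%C).
  assert (DE : forall z, in_disk z -> cderiv (fun z => Cexp (Phi z)) z (Cexp (Phi z) * Phi1 z)%C).
  { intros z Hz. apply (cderiv_comp Cexp Phi); [apply cderiv_Cexp|auto]. }
  assert (Df : forall z, in_disk z -> cderiv f z (f' z)).
  { intros z Hz. eapply cderiv_eq; [apply cderiv_mult; [apply cderiv_id|apply DE, Hz]|].
    unfold f'. replace (psi z) with (1 + (psi z - 1))%C by ring. rewrite <- EPhi by auto. ring. }
  assert (Hf : hol2 f f').
  { split; [exact Df|]. intros z Hz. eexists. apply cderiv_mult; [apply DE, Hz|apply Hp, Hz]. }
  assert (f0 : f 0%C = 0) by (unfold f; ring).
  assert (Lr : forall z, in_disk z -> log_ratio f z = psi z).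
  { intros z Hz. unfold log_ratio. destruct (Ceq_dec z (RtoC 0)) as [->|Nz]; [auto|].
    rewrite (is_C_derive_unique f z (f' z)) by (apply cderiv_is_derive; auto).
    unfold f, f'. field. split; [apply Cexp_neq_0|auto]. }
  exists f, f'. split; [split; [split|]|split; [exact Df|exact Lr]].
  - apply (class_A_intro f f' Hf f0). unfold f'. rewrite Phi0, Cexp_0, P0. ring.
  - set (L := fun u => (u + Phi (Cexp u))%C).
    assert (DD : forall u, Re u < 0 -> in_disk (Cexp u)).
    { intros u Hu. unfold in_disk. rewrite Cmod_Cexp, <- exp_0. apply exp_increasing, Hu. }
    assert (DL : forall u, Re u < 0 -> cderiv L u (psi (Cexp u))).
    { intros u Hu. eapply cderiv_eq; [apply cderiv_plus; [apply cderiv_id|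
        apply (cderiv_comp Phi Cexp); [apply DPhi, DD, Hu|apply cderiv_Cexp]]|].
      replace (psi (Cexp u)) with (1 + (psi (Cexp u) - 1))%C by ring. rewrite <- EPhi by auto. ring. }
    assert (fL : forall u, f (Cexp u) = Cexp (L u)).
    { intros u. unfold f, L. now rewrite Cexp_plus. }
    assert (inj : forall u v, Re u < 0 -> Re v < 0 -> L u = L v -> u = v).
    { intros u v Hu Hv E.
      destruct (Ceq_dec u v) as [->|N]; [auto|exfalso].
      set (D := (v - u)%C).
      assert (PD : 0 < Cmod D).
      { apply Cmod_gt_0. intros X. apply N. apply (f_equal (fun x => (x + u)%C)) in X. unfold D in X.
        replace (v - u + u)%C with v in X by ring. rewrite X. ring. }
      (* [q] is [L] along the segment from u to v, projected on the direction [D]: its derivative is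
         |D|^2 Re psi > 0, yet q 1 = q 0. *)
      set (q := fun t => Re (Cconj D * L (u + RtoC t * D)%C)).
      assert (Hre : forall t, 0 <= t <= 1 -> Re (u + RtoC t * D)%C < 0).
      { intros t Ht. replace (Re (u + RtoC t * D)%C) with ((1 - t) * Re u + t * Re v) by (unfold D; c_ring). nra. }
      assert (Dq : forall t, 0 <= t <= 1 -> is_derive q t (Re (Cconj D * (psi (Cexp (u + RtoC t * D)) * D))%C)).
      { intros t Ht. apply (curve_deriv_scal (Cconj D) (fun t => L (u + RtoC t * D)%C)).
        apply (curve_deriv_comp L (fun t => u + RtoC t * D)%C); [apply DL, Hre, Ht|apply curve_deriv_line]. }
      destruct (MVT_gen q 0 1 (fun t => Re (Cconj D * (psi (Cexp (u + RtoC t * D)) * D))%C)) as [t [Ht Et]];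
        rewrite ?Rmin_left, ?Rmax_right in * by lra.
      - intros t Ht. apply Dq. lra.
      - intros t Ht. apply continuity_pt_filterlim, (ex_derive_continuous q). eexists; apply Dq; lra.
      - assert (q10 : q 1 - q 0 = 0).
        { unfold q. replace (u + RtoC 1 * D)%C with v by (unfold D; ring).
          replace (u + RtoC 0 * D)%C with u by ring. rewrite E. ring. }
        rewrite q10 in Et.
        replace (Cconj D * (psi (Cexp (u + RtoC t * D)) * D))%C with
          (RtoC (Cmod D ^ 2) * psi (Cexp (u + RtoC t * D)%C))%C in Et
          by (rewrite Cmod2_conj; ring).
        rewrite Re_mult in Et. simpl (Im (RtoC _)) in Et. simpl (Re (RtoC _)) in Et.
        assert (Q := Pre _ (DD _ (Hre t Ht))). assert (0 < Cmod D * (Cmod D * 1)) by nra. nra. }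
    (* Equal exponentials only give L u1 = L u2 + 2 pi i k; moving the period into the argument
       makes the injectivity of [L] applicable. *)
    assert (Lper : forall u k, L (u + period k)%C = (L u + period k)%C).
    { intros u k. unfold L. rewrite Cexp_period. ring. }
    assert (fz : forall z, f z = 0 -> z = 0).
    { intros z Hz. destruct (Ceq_dec z 0) as [->|N]; [auto|exfalso].
      apply (Cmult_neq_0 z (Cexp (Phi z)) N (Cexp_neq_0 _)). exact Hz. }
    intros z1 z2 H1 H2 E.
    destruct (Ceq_dec z1 0) as [->|N1]; [rewrite f0 in E; symmetry; apply fz; auto|].
    destruct (Ceq_dec z2 0) as [->|N2]; [rewrite f0 in E; apply fz; auto|].
    destruct (Cexp_surjective z1 N1) as [u1 U1]. destruct (Cexp_surjective z2 N2) as [u2 U2].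
    assert (Hneg : forall u z, Cexp u = z -> in_disk z -> Re u < 0).
    { intros u z <- Hz. unfold in_disk in Hz. rewrite Cmod_Cexp, <- exp_0 in Hz. apply exp_lt_inv, Hz. }
    rewrite <- U1, <- U2, !fL in E. destruct (Cexp_eq _ _ E) as [k Hk].
    rewrite <- Lper in Hk. apply inj in Hk.
    + rewrite <- U1, <- U2, Hk. apply Cexp_period.
    + apply (Hneg u1 z1); auto.
    + replace (Re (u2 + period k)%C) with (Re u2) by (unfold period; c_ring). apply (Hneg u2 z2); auto.
  - exists (fun z => z). split; [|split; [|split]]; auto.
    intros z _. exists (RtoC 1). apply cderiv_is_derive, cderiv_id.
Qed.

(** * Inverting [frakB], dilations and the criterion *)

Lemma Csqrt_sqr (a : C) : (Csqrt a * Csqrt a)%C = a.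
Proof.
  assert (A := re_le_Cmod a). assert (A' := Rle_abs (Re a)). assert (A'' := Rle_abs (- Re a)). rewrite Rabs_Ropp in A''.
  assert (M := Cmod2_alt a).
  set (X := sqrt ((Cmod a + Re a) / 2)). set (Y := sqrt ((Cmod a - Re a) / 2)).
  assert (X2 : X * X = (Cmod a + Re a) / 2) by (apply sqrt_sqrt; lra).
  assert (Y2 : Y * Y = (Cmod a - Re a) / 2) by (apply sqrt_sqrt; lra).
  assert (XY : 2 * (X * Y) = Rabs (Im a)).
  { unfold X, Y. rewrite <- sqrt_mult by lra.
    replace ((Cmod a + Re a) / 2 * ((Cmod a - Re a) / 2)) with ((Im a / 2)²) by (unfold Rsqr; nra).
    rewrite sqrt_Rsqr_abs. unfold Rdiv. rewrite Rabs_mult, (Rabs_pos_eq (/ 2)) by lra. lra. }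
  apply C_ext; unfold Csqrt; fold X Y; [rewrite Re_mult|rewrite Im_mult]; simpl Re; simpl Im;
    destruct (Rle_dec 0 (Im a)) as [S|S].
  - nra.
  - nra.
  - rewrite Rabs_pos_eq in XY by auto. lra.
  - rewrite Rabs_left in XY by lra. lra.
Qed.

Lemma Csqrt_of_sqr (u : C) : 0 < Re u -> Csqrt (u * u)%C = u.
Proof.
  intros H. unfold Csqrt. rewrite Cmod_mult, Re_mult, Im_mult.
  assert (M := Cmod2_alt u).
  replace ((Cmod u * Cmod u + (Re u * Re u - Im u * Im u)) / 2) with (Re u ^ 2) by nra.
  replace ((Cmod u * Cmod u - (Re u * Re u - Im u * Im u)) / 2) with ((Im u)²) by (unfold Rsqr; nra).
  rewrite sqrt_pow2, sqrt_Rsqr_abs by lra.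
  apply C_ext; [reflexivity|]. simpl Im at 1.
  destruct (Rle_dec 0 (Re u * Im u + Im u * Re u)) as [S|S].
  - rewrite Rabs_pos_eq by nra. ring.
  - rewrite Rabs_left by nra. ring.
Qed.

(** Its real part is cos (Im w) times a sum of exponentials, and |Im w| < 1 < pi / 2. *)
Lemma cosh_neq_0 (w : C) : in_disk w -> (Cexp w + Cexp (- w))%C <> 0.
Proof.
  intros Hw E. apply (f_equal Re) in E. rewrite Re_plus in E. unfold Cexp in E. simpl in E.
  rewrite cos_neg in E.
  assert (I := Im_le_Cmod w). unfold in_disk in Hw.
  assert (B := PI2_1). assert (B1 := Rle_abs (Im w)). assert (B2 := Rle_abs (- Im w)). rewrite Rabs_Ropp in B2.
  assert (Cp : 0 < cos (Im w)) by (apply cos_gt_0; lra).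
  assert (P1 := exp_pos (Re w)). assert (P2 := exp_pos (- Re w)). unfold Re, Im in *. nra.
Qed.

Lemma one_plus_Ctanh (w : C) : (Cexp w + Cexp (- w))%C <> 0 ->
  ((1 + Ctanh w) * (1 + Cexp w * Cexp w) = 2 * (Cexp w * Cexp w))%C.
Proof.
  intros N. unfold Ctanh. rewrite Cexp_opp in *. assert (E := Cexp_neq_0 w).
  assert (N2 : (Cexp w * Cexp w + 1)%C <> 0).
  { intros X. apply N. replace (Cexp w + / Cexp w)%C with ((Cexp w * Cexp w + 1) / Cexp w)%C by (field; auto).
    rewrite X. unfold Cdiv. ring. }
  field. split; auto.
Qed.

(** Solving u^2 = 1 + tanh w for exp (2 w) gives u^2 / (2 - u^2); the last hypothesis is this
    equation cleared of its denominator. Positivity of Re u selects the principal root. *)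
Lemma frakB_eq (w u : C) : in_disk w -> 0 < Re u -> (Cexp w * Cexp w * (2 - u * u) = u * u)%C -> frakB w = u.
Proof.
  intros Hw Hu E. assert (T := one_plus_Ctanh w (cosh_neq_0 w Hw)).
  set (X := (Cexp w * Cexp w)%C) in *.
  (* X = -1 in the hypothesis would read u^2 - 2 = u^2. *)
  assert (N : (1 + X)%C <> 0).
  { intros Z. assert (X1 : X = (- (1))%C) by (replace X with ((1 + X) - 1)%C by ring; rewrite Z; ring).
    rewrite X1 in E. assert (F : (2 : C)%C = 0).
    { replace (RtoC 2) with (u * u - - (1) * (2 - u * u))%C by ring. rewrite E. ring. }
    apply RtoC_inj in F. lra. }
  unfold frakB. replace (1 + Ctanh w)%C with (u * u)%C; [apply Csqrt_of_sqr; auto|].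
  replace (1 + Ctanh w)%C with (((1 + Ctanh w) * (1 + X)) / (1 + X))%C by (field; auto).
  rewrite T. replace (2 * X)%C with (X * (2 - u * u) + X * (u * u))%C by ring. rewrite E. field. auto.
Qed.

(* If [frakB w ^ 2 = 1 + tanh 1] then [exp (2 w) = exp 2]. *)
Lemma frakB_neq_boundary (w : C) (b : R) : in_disk w -> b * b * (1 + exp 1 ^ 2) = 2 * exp 1 ^ 2 ->
  frakB w <> RtoC b.
Proof.
  intros Hw Hb E.
  assert (T := one_plus_Ctanh w (cosh_neq_0 w Hw)).
  assert (S := Csqrt_sqr (1 + Ctanh w)%C). fold (frakB w) in S. rewrite E in S.
  rewrite <- S in T.
  assert (P := exp_pos 1).
  assert (X : (Cexp w * Cexp w)%C = RtoC (exp 1 ^ 2)).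
  { assert (Q : ((2 - RtoC b * RtoC b) * (Cexp w * Cexp w))%C = (RtoC b * RtoC b)%C).
    { replace ((2 - RtoC b * RtoC b) * (Cexp w * Cexp w))%C with
       (2 * (Cexp w * Cexp w) - RtoC b * RtoC b * (1 + Cexp w * Cexp w) + RtoC b * RtoC b)%C by ring.
      rewrite T. ring. }
    assert (b2 : b * b = 2 * exp 1 ^ 2 / (1 + exp 1 ^ 2)) by (rewrite <- Hb; field; nra).
    assert (P2 : 0 < 1 + exp 1 ^ 2) by nra.
    rewrite <- !RtoC_mult, b2, <- RtoC_minus in Q.
    assert (n : 2 - 2 * exp 1 ^ 2 / (1 + exp 1 ^ 2) = 2 / (1 + exp 1 ^ 2)) by (field; lra).
    rewrite n in Q.
    assert (n2 : RtoC (2 / (1 + exp 1 ^ 2)) <> 0).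
    { intros Z. apply RtoC_inj in Z. assert (0 < 2 / (1 + exp 1 ^ 2)) by (apply Rdiv_lt_0_compat; lra). lra. }
    replace (Cexp w * Cexp w)%C with (RtoC (2 / (1 + exp 1 ^ 2)) * (Cexp w * Cexp w) / RtoC (2 / (1 + exp 1 ^ 2)))%C by (field; auto).
    rewrite Q, <- RtoC_div.
    - f_equal. field. lra.
    - intros Z; apply n2; now rewrite Z. }
  (* The modulus alone decides: |exp (2 w)| = exp (2 Re w), so Re w = 1, which the open disk
     excludes. *)
  assert (M : Cmod (Cexp w * Cexp w)%C = exp 1 ^ 2).
  { rewrite X, Cmod_R, Rabs_pos_eq; [auto|]. apply pow2_ge_0. }
  rewrite Cmod_mult, Cmod_Cexp in M.
  assert (P' := exp_pos (Re w)).
  assert (K : exp (Re w) = exp 1) by nra.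
  apply exp_inv in K. unfold in_disk in Hw. assert (A := re_le_Cmod w). assert (A' := Rle_abs (Re w)). lra.
Qed.

Lemma cderiv_dilate (f : C -> C) (r : R) (z l : C) : r <> 0 -> cderiv f (RtoC r * z)%C l -> cderiv (dilate f r) z l.
Proof.
  intros Hr H. assert (N : RtoC r <> 0) by (intros E; apply RtoC_inj in E; auto).
  eapply cderiv_eq; [apply cderiv_div; [exact N| |apply cderiv_const];
    apply (cderiv_comp f (fun z => RtoC r * z)%C); [exact H|apply cderiv_mult; [apply cderiv_const|apply cderiv_id]]|].
  field. auto.
Qed.

Lemma in_disk_scal (r : R) (z : C) : 0 < r <= 1 -> in_disk z -> in_disk (RtoC r * z)%C.
Proof.
  unfold in_disk. intros Hr Hz. rewrite Cmod_mult, Cmod_R, Rabs_pos_eq by lra.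
  assert (G := Cmod_ge_0 z). nra.
Qed.

Lemma class_S_dilate (f : C -> C) (r : R) : 0 < r <= 1 -> class_S f -> class_S (dilate f r).
Proof.
  intros Hr [[Af [a Ha]] Uf]. assert (N : RtoC r <> 0) by (intros E; apply RtoC_inj in E; lra).
  split; [split|].
  - intros z Hz. destruct (Af _ (in_disk_scal r z Hr Hz)) as [l Hl]. exists l.
    apply cderiv_is_derive, cderiv_dilate; [lra|]. apply cderiv_is_derive, Hl.
  - exists (fun j => / RtoC r * (a j * RtoC r ^ j))%C. intros z Hz.
    assert (Sr := cseries_scal (/ RtoC r)%C _ _ (Ha _ (in_disk_scal r z Hr Hz))).
    unfold dilate. replace (f (RtoC r * z) / RtoC r - z)%C with (/ RtoC r * (f (RtoC r * z) - RtoC r * z))%C by (field; auto).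
    eapply cseries_ext; [|exact Sr]. intros n. simpl. rewrite Cpow_mult_l.
    match goal with |- ?x = ?y => change (@eq C x y) end. ring.
  - intros z1 z2 H1 H2 E. unfold dilate in E.
    assert (E2 : f (RtoC r * z1)%C = f (RtoC r * z2)%C).
    { replace (f (RtoC r * z1)%C) with (f (RtoC r * z1) / RtoC r * RtoC r)%C by (field; auto).
      rewrite E. field. auto. }
    apply Uf in E2; try (apply in_disk_scal; auto).
    replace z1 with (RtoC r * z1 / RtoC r)%C by (field; auto). rewrite E2. field. auto.
Qed.

Lemma log_ratio_dilate (f : C -> C) (r : R) (z : C) : 0 < r <= 1 -> in_disk z -> analytic_in_disk f ->
  log_ratio (dilate f r) z = log_ratio f (RtoC r * z)%C.
Proof.
  intros Hr Hz Af. assert (N : RtoC r <> 0) by (intros E; apply RtoC_inj in E; lra).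
  unfold log_ratio. destruct (Ceq_dec z (RtoC 0)) as [->|Nz].
  - destruct (Ceq_dec (RtoC r * 0)%C (RtoC 0)) as [_|X]; [reflexivity|exfalso; apply X; ring].
  - destruct (Ceq_dec (RtoC r * z)%C (RtoC 0)) as [X|_]; [exfalso; revert X; apply Cmult_neq_0; auto|].
    destruct (Af _ (in_disk_scal r z Hr Hz)) as [l Hl].
    rewrite (is_C_derive_unique f _ l Hl).
    rewrite (is_C_derive_unique (dilate f r) z l)
      by (apply cderiv_is_derive, cderiv_dilate; [lra|apply cderiv_is_derive, Hl]).
    change C in (type of l). unfold dilate, Cdiv.
    (* If f (r z) = 0, both sides divide by zero; the inverse of 0 evaluates to 0, so both sides are
       0. *)
    destruct (Ceq_dec (f (RtoC r * z)%C) 0) as [E|E].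
    + rewrite E. replace (0 * / RtoC r)%C with (RtoC 0) by ring.
      replace (/ 0)%C with (RtoC 0); [ring|].
      unfold Cinv, RtoC; simpl. f_equal; unfold Rdiv; ring.
    + field. split; auto.
Qed.

(** Reduces a class to the construction of an explicit [W] on the disk of radius rho, with [b] in
    the role of frakB 1. The equation for [W] is free of division, so zeros of 2 - psi^2 need no
    separate treatment. *)
Lemma is_radius_frakB (psi psi' : C -> C) (rho b : R) (W : C -> C) :
  hol2 psi psi' -> (forall z, in_disk z -> psi' z <> 0) -> psi 0%C = 1%C ->
  (forall z, in_disk z -> 0 < Re (psi z)) ->
  0 < rho < 1 -> psi (RtoC rho) = RtoC b -> b * b * (1 + exp 1 ^ 2) = 2 * exp 1 ^ 2 ->
  (forall z, Cmod z < rho -> exists l, cderiv W z l) -> W 0%C = 0 ->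
  (forall z, Cmod z < rho -> in_disk (W z)) ->
  (forall z, Cmod z < rho -> (Cexp (W z) * Cexp (W z) * (2 - psi z * psi z) = psi z * psi z)%C) ->
  is_radius (Sstar frakB) (Sstar psi) rho.
Proof.
  intros Hp Np P0 Pre Hrho Pb Hb DW W0 Wd We. split; [split; [lra|]|].
  - intros f [Sf [w [Aw [Dw [w0 Ew]]]]] r Hr.
    assert (Hr1 : 0 < r <= 1) by lra.
    assert (Sw := Sstar_schwarz psi psi' f w Hp Np Sf Aw Dw w0 Ew).
    assert (small : forall z, in_disk z -> Cmod (w (RtoC r * z)%C) < rho).
    { intros z Hz. eapply Rle_lt_trans; [apply Sw, in_disk_scal; auto|].
      rewrite Cmod_mult, Cmod_R, Rabs_pos_eq by lra. unfold in_disk in Hz.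
      assert (G := Cmod_ge_0 z). nra. }
    split; [apply class_S_dilate; auto|].
    exists (fun z => W (w (RtoC r * z)%C)). split; [|split; [|split]].
    + intros z Hz. destruct (Aw _ (in_disk_scal r z Hr1 Hz)) as [l1 H1].
      destruct (DW _ (small z Hz)) as [l2 H2]. apply cderiv_is_derive in H1.
      eexists. apply cderiv_is_derive, (cderiv_comp W (fun z => w (RtoC r * z)%C)); [exact H2|].
      apply (cderiv_comp w (fun z => RtoC r * z)%C); [exact H1|].
      apply cderiv_mult; [apply cderiv_const|apply cderiv_id].
    + intros z Hz. apply Wd, small, Hz.
    + replace (RtoC r * RtoC 0)%C with (RtoC 0) by ring. rewrite w0. exact W0.
    + intros z Hz. rewrite log_ratio_dilate; [|auto|auto|apply Sf].
      rewrite Ew by (apply in_disk_scal; auto). symmetry.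
      apply frakB_eq; [apply Wd, small, Hz|apply Pre, Dw, in_disk_scal; auto|apply We, small, Hz].
  - intros rho' Hr' Hdil. destruct (Rle_lt_dec rho' rho) as [L|L]; [auto|exfalso].
    destruct (Sstar_extremal psi psi' Hp P0 Pre) as [f [f' [Sf [Df Lf]]]].
    destruct (Hdil f Sf rho' ltac:(lra)) as [_ [w [_ [Dw [_ Ew]]]]].
    (* The point that dilation by rho' carries to rho; it lies in the disk because rho < rho'. *)
    set (z := RtoC (rho / rho')).
    assert (Hq : 0 < rho / rho' < 1) by (split; [apply Rdiv_lt_0_compat; lra|apply (proj2 (Rlt_div_l _ _ rho' ltac:(lra))); lra]).
    assert (Hz : in_disk z) by (unfold in_disk, z; rewrite Cmod_R, Rabs_pos_eq; lra).
    specialize (Ew z Hz). rewrite log_ratio_dilate in Ew; [|lra|auto|].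
    + replace (RtoC rho' * z)%C with (RtoC rho) in Ew by (unfold z; rewrite <- RtoC_mult; f_equal; field; lra).
      rewrite Lf, Pb in Ew by (unfold in_disk; rewrite Cmod_R, Rabs_pos_eq; lra).
      apply (frakB_neq_boundary (w z) b (Dw z Hz) Hb). auto.
    + intros x Hx. exists (f' x). apply cderiv_is_derive. auto.
Qed.

(** * Numerical bounds *)

Lemma is_derive_n_exp (n : nat) (x : R) : is_derive_n exp n x (exp x).
Proof.
  revert x. induction n as [|n IH]; intros x; [reflexivity|].
  simpl. apply (is_derive_ext exp); [|apply is_derive_exp].
  intros t. symmetry. apply is_derive_n_unique, IH.
Qed.

Definition exp_taylor (n : nat) (x : R) : R := sum_f_R0 (fun m => x ^ m / INR (fact m)) n.

(** Lagrange's form of the remainder; the factor 3 bounds the exponential at the intermediate point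
    of [0, 1]. *)
Lemma exp_taylor_bounds (n : nat) (x : R) : 0 < x <= 1 ->
  exp_taylor n x < exp x <= exp_taylor n x + x ^ S n / INR (fact (S n)) * 3.
Proof.
  intros Hx.
  destruct (Taylor_Lagrange exp n 0 x) as [u [Hu E]]; [lra| |].
  - intros t _ [|k] _; [exact I|]. exists (exp t). apply (is_derive_n_exp (S k)).
  - rewrite (is_derive_n_unique _ _ _ _ (is_derive_n_exp (S n) u)) in E.
    rewrite (sum_eq _ (fun m => x ^ m / INR (fact m))) in E.
    + rewrite Rminus_0_r in E. fold (exp_taylor n x) in E.
      assert (P : 0 < x ^ S n / INR (fact (S n))).
      { apply Rdiv_lt_0_compat; [apply pow_lt; lra|apply INR_fact_lt_0]. }
      assert (P1 := exp_pos u).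
      assert (P2 : exp u <= 3).
      { eapply Rle_trans; [left; apply (exp_increasing u 1); lra|apply exp_le_3]. }
      rewrite E. split; [nra|]. apply Rplus_le_compat_l, Rmult_le_compat_l; lra.
    + intros i _. rewrite (is_derive_n_unique _ _ _ _ (is_derive_n_exp i 0)), exp_0, Rminus_0_r. ring.
Qed.

(* [exp_taylor n (p / q) = taylor_num p q n / taylor_den q n], so that numerical bounds reduce to integer arithmetic. *)
Fixpoint taylor_den (q : Z) (n : nat) : Z :=
  match n with O => 1 | S k => taylor_den q k * (Z.of_nat n * q) end%Z.

Fixpoint taylor_num (p q : Z) (n : nat) : Z :=
  match n with O => 1 | S k => taylor_num p q k * (Z.of_nat n * q) + p ^ Z.of_nat n end%Z.

Lemma taylor_den_fact (q : Z) (n : nat) : IZR (taylor_den q n) = INR (fact n) * IZR q ^ n.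
Proof.
  induction n as [|n IH]; [simpl; ring|].
  cbn [taylor_den]. rewrite !mult_IZR, IH, fact_simpl, mult_INR, <- INR_IZR_INZ. simpl pow. ring.
Qed.

Lemma taylor_den_pos (q : Z) (n : nat) : (0 < q)%Z -> (0 < taylor_den q n)%Z.
Proof.
  intros Hq. apply lt_IZR. rewrite taylor_den_fact. apply IZR_lt in Hq.
  apply Rmult_lt_0_compat; [apply INR_fact_lt_0|apply pow_lt, Hq].
Qed.

Lemma exp_taylor_term (p q : Z) (n : nat) : (0 < q)%Z ->
  (IZR p / IZR q) ^ n / INR (fact n) = IZR (p ^ Z.of_nat n) / IZR (taylor_den q n).
Proof.
  intros Hq. apply IZR_lt in Hq.
  rewrite taylor_den_fact, <- pow_IZR. unfold Rdiv. rewrite Rpow_mult_distr, pow_inv, Rinv_mult. ring.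
Qed.

Lemma exp_taylor_frac (p q : Z) (n : nat) : (0 < q)%Z ->
  exp_taylor n (IZR p / IZR q) = IZR (taylor_num p q n) / IZR (taylor_den q n).
Proof.
  intros Hq. unfold exp_taylor. induction n as [|n IH]; [simpl; lra|].
  rewrite tech5, IH, exp_taylor_term by auto.
  assert (P := IZR_lt _ _ (taylor_den_pos q n Hq)). assert (P' := IZR_lt _ _ (taylor_den_pos q (S n) Hq)).
  cbn [taylor_num taylor_den] in *. rewrite plus_IZR, !(mult_IZR _ (Z.of_nat (S n) * q)) in *.
  assert (Q : 0 < IZR (Z.of_nat (S n) * q)) by (apply IZR_lt; nia).
  field. lra.
Qed.

(** The comparison is a boolean test on integers, to be settled by computation with [eq_refl]. *)
Lemma exp_frac_gt (n : nat) (p q a c : Z) : (0 < p <= q)%Z -> (0 < c)%Z ->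
  (a * taylor_den q n <=? taylor_num p q n * c)%Z = true -> IZR a / IZR c < exp (IZR p / IZR q).
Proof.
  intros Hp Hc H. apply Z.leb_le, IZR_le in H. rewrite !mult_IZR in H.
  assert (Q : 0 < IZR q) by (apply IZR_lt; lia). assert (Hc' := IZR_lt _ _ Hc).
  assert (Hd := IZR_lt _ _ (taylor_den_pos q n ltac:(lia))).
  destruct (exp_taylor_bounds n (IZR p / IZR q)) as [L _].
  - split; [apply Rdiv_lt_0_compat; [apply IZR_lt; lia|auto]|].
    apply (proj2 (Rle_div_l _ _ (IZR q) Q)). rewrite Rmult_1_l. apply IZR_le. lia.
  - rewrite exp_taylor_frac in L by lia. eapply Rle_lt_trans; [|exact L].
    apply (proj2 (Rle_div_l _ _ (IZR c) Hc')).
    replace (IZR (taylor_num p q n) / IZR (taylor_den q n) * IZR c) with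
      (IZR (taylor_num p q n) * IZR c / IZR (taylor_den q n)) by (field; lra).
    apply (proj1 (Rle_div_r _ _ _ Hd)), H.
Qed.

Lemma exp_frac_lt (n : nat) (p q a c : Z) : (0 < p <= q)%Z -> (0 < c)%Z ->
  ((taylor_num p q (S n) + 2 * p ^ Z.of_nat (S n)) * c <=? a * taylor_den q (S n))%Z = true ->
  exp (IZR p / IZR q) <= IZR a / IZR c.
Proof.
  intros Hp Hc H. apply Z.leb_le, IZR_le in H. rewrite !mult_IZR, plus_IZR, mult_IZR in H.
  assert (Q : 0 < IZR q) by (apply IZR_lt; lia). assert (Hc' := IZR_lt _ _ Hc).
  assert (Hd := IZR_lt _ _ (taylor_den_pos q (S n) ltac:(lia))).
  destruct (exp_taylor_bounds n (IZR p / IZR q)) as [_ U].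
  - split; [apply Rdiv_lt_0_compat; [apply IZR_lt; lia|auto]|].
    apply (proj2 (Rle_div_l _ _ (IZR q) Q)). rewrite Rmult_1_l. apply IZR_le. lia.
  - eapply Rle_trans; [exact U|].
    assert (E := exp_taylor_frac p q (S n) ltac:(lia)). unfold exp_taylor in E. rewrite tech5 in E.
    fold (exp_taylor n (IZR p / IZR q)) in E.
    assert (T := exp_taylor_term p q (S n) ltac:(lia)).
    set (X := (IZR p / IZR q) ^ S n / INR (fact (S n))) in *.
    (* The sum up to n plus 3 X is the sum up to n + 1 plus 2 X, which is where the 2 in the integer
       test comes from. *)
    replace (exp_taylor n (IZR p / IZR q) + X * 3) with
      ((IZR (taylor_num p q (S n)) + 2 * IZR (p ^ Z.of_nat (S n))) / IZR (taylor_den q (S n))).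
    + apply (proj2 (Rle_div_l _ _ _ Hd)).
      replace (IZR a / IZR c * IZR (taylor_den q (S n))) with (IZR a * IZR (taylor_den q (S n)) / IZR c) by (field; lra).
      apply (proj1 (Rle_div_r _ _ _ Hc')), H.
    + transitivity (IZR (taylor_num p q (S n)) / IZR (taylor_den q (S n))
        + 2 * (IZR (p ^ Z.of_nat (S n)) / IZR (taylor_den q (S n)))); [field; lra|].
      rewrite <- E, <- T. ring.
Qed.

Lemma exp_1_bounds : 2.718281828 < exp 1 < 2.718281829.
Proof.
  assert (L := exp_frac_gt 13 1 1 2718281828 1000000000 ltac:(lia) ltac:(lia) eq_refl).
  assert (U := exp_frac_lt 13 1 1 27182818288 10000000000 ltac:(lia) ltac:(lia) eq_refl).
  replace (1 / 1) with 1 in * by lra. split; lra.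
Qed.

Lemma exp_1_sqr_bounds : 7.38905609 < exp 1 ^ 2 < 7.38905611.
Proof.
  destruct exp_1_bounds as [L U].
  assert (A : 0 < (exp 1 - 2.718281828) * (exp 1 + 2.718281828)) by (apply Rmult_lt_0_compat; lra).
  assert (B : 0 < (2.718281829 - exp 1) * (exp 1 + 2.718281829)) by (apply Rmult_lt_0_compat; lra).
  lra.
Qed.

(** [b] stands for [frakB 1 = sqrt (1 + tanh 1)], the value at which the image of the disk is left. *)
Definition boundary_value (b : R) : Prop := 0 < b /\ b * b * (1 + exp 1 ^ 2) = 2 * exp 1 ^ 2.

Lemma sqr_gt_reg (x y : R) : 0 < x -> 0 < y -> y * y < x * x -> y < x.
Proof. intros. nra. Qed.

(** The precision has to match the sigmoid and cardioid radii, which are bracketed in intervals of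
    length 10^(-6). *)
Lemma boundary_value_bounds (b : R) : boundary_value b -> 1.32725057 < b < 1.32725061.
Proof.
  intros [H0 H]. assert (E := exp_1_sqr_bounds). set (e2 := exp 1 ^ 2) in *.
  assert (L : 1.761594076 < b * b).
  { apply Rnot_le_lt. intros C. assert (A : 0 <= (1.761594076 - b * b) * (1 + e2)) by (apply Rmult_le_pos; lra). lra. }
  assert (U : b * b < 1.76159418).
  { apply Rnot_le_lt. intros C. assert (A : 0 <= (b * b - 1.76159418) * (1 + e2)) by (apply Rmult_le_pos; lra). lra. }
  split; apply sqr_gt_reg; lra.
Qed.

Lemma boundary_value_lt (b x : R) : boundary_value b -> 0 <= x < b -> x * x * (1 + exp 1 ^ 2) < 2 * exp 1 ^ 2.
Proof. intros [H0 H] Hx. rewrite <- H. apply Rmult_lt_compat_r; [nra|]. nra. Qed.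

(** The bracket is 0.28311 with the claimed tolerance on either side; since exp is increasing, it
    suffices to compare exp at the two endpoints with [b]. The brackets of the other radii arise in
    the same way. *)
Lemma radius_exp_bounds (x b : R) : boundary_value b -> exp x = b -> 0.283105 < x < 0.283115.
Proof.
  intros Hb E. apply boundary_value_bounds in Hb.
  assert (U := exp_frac_lt 8 283105 1000000 1327250200 1000000000 ltac:(lia) ltac:(lia) eq_refl).
  assert (L := exp_frac_gt 8 283115 1000000 1327251000 1000000000 ltac:(lia) ltac:(lia) eq_refl).
  split; apply exp_lt_inv; rewrite E.
  - replace 0.283105 with (283105 / 1000000) by lra. lra.
  - replace 0.283115 with (283115 / 1000000) by lra. lra.
Qed.

Lemma radius_sigmoid_bounds (x b : R) : boundary_value b -> exp x * (2 - b) = b -> 0.6794915 < x < 0.6794925.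
Proof.
  intros Hb E. apply boundary_value_bounds in Hb.
  assert (U := exp_frac_lt 10 6794915 10000000 19728745 10000000 ltac:(lia) ltac:(lia) eq_refl).
  assert (L := exp_frac_gt 10 6794925 10000000 19728760 10000000 ltac:(lia) ltac:(lia) eq_refl).
  split; apply exp_lt_inv.
  - replace 0.6794915 with (6794915 / 10000000) by lra. eapply Rle_lt_trans; [exact U|].
    apply Rnot_le_lt. intros K.
    assert (A : 0 <= (19728745 / 10000000 - exp x) * (2 - b)) by (apply Rmult_le_pos; lra). lra.
  - replace 0.6794925 with (6794925 / 10000000) by lra. eapply Rlt_trans; [|exact L].
    apply Rnot_le_lt. intros K.
    assert (A : 0 <= (exp x - 19728760 / 10000000) * (2 - b)) by (apply Rmult_le_pos; lra). lra.
Qed.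

Lemma radius_crescent_bounds (b : R) : boundary_value b -> 0.28685 < (b - / b) / 2 < 0.28695.
Proof.
  intros Hb. apply boundary_value_bounds in Hb.
  assert (A : / 1.3273 < / b) by (apply Rinv_lt_contravar; [apply Rmult_lt_0_compat|]; lra).
  assert (B : / b < / 1.3272) by (apply Rinv_lt_contravar; [apply Rmult_lt_0_compat|]; lra).
  assert (A' : 0.75340 <= / 1.3273) by lra. assert (B' : / 1.3272 <= 0.75347) by lra. lra.
Qed.

Lemma radius_cardioid_bounds (b : R) : boundary_value b ->
  0.2538765 * exp 0.2538765 < b - 1 < 0.2538775 * exp 0.2538775.
Proof.
  intros Hb. apply boundary_value_bounds in Hb.
  assert (U := exp_frac_lt 9 2538765 10000000 1289012603 1000000000 ltac:(lia) ltac:(lia) eq_refl).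
  assert (L := exp_frac_gt 9 2538775 10000000 1289013888 1000000000 ltac:(lia) ltac:(lia) eq_refl).
  replace 0.2538765 with (2538765 / 10000000) by lra. replace 0.2538775 with (2538775 / 10000000) by lra.
  lra.
Qed.

(** * The four classes *)

(** All four bounds on |W| end here: A / B equals x^2 / (2 - x^2) for a real x below b, and the last
    hypothesis is then x^2 (1 + e^2) < 2 e^2. *)
Lemma half_log_lt (A B : R) : 0 < A -> 0 < B -> A < exp 1 ^ 2 * B -> / 2 * ln A - / 2 * ln B < 1.
Proof.
  intros HA HB H.
  assert (P := exp_pos 1).
  assert (L := ln_increasing _ _ HA H).
  rewrite ln_mult, ln_pow, ln_exp in L by (auto; nra). simpl in L. lra.
Qed.

Lemma Cexp_half_log (u l : C) :
  (Cexp (u - RtoC (/ 2) * l) * Cexp (u - RtoC (/ 2) * l))%C = (Cexp u * Cexp u / Cexp l)%C.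
Proof.
  unfold Cdiv. rewrite <- Cexp_opp, <- !Cexp_plus. f_equal.
  assert (E : (RtoC (/ 2) + RtoC (/ 2))%C = 1%C) by (rewrite <- RtoC_plus; f_equal; lra).
  transitivity (u + u - (RtoC (/ 2) + RtoC (/ 2)) * l)%C; [ring|]. rewrite E. ring.
Qed.

Lemma Cmod_half (l : C) : Cmod (RtoC (/ 2) * l)%C = / 2 * Cmod l.
Proof. rewrite Cmod_mult, Cmod_R, Rabs_pos_eq; lra. Qed.

Lemma cos_pos_disk (z : C) : in_disk z -> 0 < cos (Im z).
Proof.
  intros Hz. assert (I := Im_le_Cmod z). unfold in_disk in Hz. assert (B := PI2_1).
  assert (B1 := Rle_abs (Im z)). assert (B2 := Rle_abs (- Im z)). rewrite Rabs_Ropp in B2.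
  apply cos_gt_0; lra.
Qed.

Lemma Re_Cexp_pos (z : C) : in_disk z -> 0 < Re (Cexp z).
Proof. intros Hz. apply Rmult_lt_0_compat; [apply exp_pos|apply cos_pos_disk, Hz]. Qed.

Lemma in_disk_opp (z : C) : in_disk z -> in_disk (- z).
Proof. unfold in_disk. now rewrite Cmod_opp. Qed.

(** * The exponential class *)

Lemma radius_exp (rho b : R) : boundary_value b -> exp rho = b -> is_radius (Sstar frakB) (Sstar psi_exp) rho.
Proof.
  intros Hb Er. assert (N := radius_exp_bounds rho b Hb Er).
  assert (b2 : b * b < 2). { apply boundary_value_bounds in Hb. nra. }
  assert (lt : forall x, x < rho -> exp (2 * x) < b * b).
  { intros x Hx. replace (2 * x) with (x + x) by ring. rewrite exp_plus, <- Er.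
    assert (A := exp_increasing _ _ Hx). assert (P := exp_pos x). nra. }
  assert (small : forall z, Cmod z < rho -> Cmod (Cexp (2 * z) - 1)%C <= exp (2 * Cmod z) - 1 /\ exp (2 * Cmod z) < b * b).
  { intros z Hz. split; [|apply lt, Hz]. eapply Rle_trans; [apply Cmod_Cexp_minus_1|].
    rewrite Cmod_mult, Cmod_R, Rabs_pos_eq by lra. lra. }
  (* The logarithm is that of 2 - e^(2z) = 1 - (e^(2z) - 1); its argument stays in the disk because
     |e^(2z) - 1| < b^2 - 1 < 1. *)
  set (W := fun z => (z - RtoC (/ 2) * log1m (Cexp (2 * z) - 1))%C).
  apply (is_radius_frakB psi_exp Cexp rho b W).
  - split; intros z _; [apply cderiv_Cexp|eexists; apply cderiv_Cexp].
  - intros z _. apply Cexp_neq_0.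
  - apply Cexp_0.
  - apply Re_Cexp_pos.
  - lra.
  - unfold psi_exp. now rewrite Cexp_RtoC, Er.
  - apply Hb.
  - intros z Hz. destruct (small z Hz) as [A B]. eexists.
    apply cderiv_minus; [apply cderiv_id|]. apply cderiv_mult; [apply cderiv_const|].
    apply (cderiv_comp log1m (fun z => Cexp (2 * z) - 1)%C); [apply cderiv_log1m; unfold in_disk; lra|].
    apply cderiv_minus; [|apply cderiv_const].
    apply (cderiv_comp Cexp (fun z => 2 * z)%C); [apply cderiv_Cexp|].
    apply cderiv_mult; [apply cderiv_const|apply cderiv_id].
  - unfold W. rewrite Cmult_0_r, Cexp_0. replace (1 - 1)%C with (RtoC 0) by ring. rewrite log1m_0. ring.
  - intros z Hz. destruct (small z Hz) as [A B]. unfold in_disk, W.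
    eapply Rle_lt_trans; [apply Cmod_minus_le|]. rewrite Cmod_half.
    assert (L := Cmod_log1m_le (Cexp (2 * z) - 1)%C ltac:(unfold in_disk; lra)).
    assert (M : - ln (1 - Cmod (Cexp (2 * z) - 1)%C) <= - ln (2 - exp (2 * Cmod z))).
    { apply Ropp_le_contravar, ln_le; lra. }
    assert (Q := half_log_lt (exp (2 * Cmod z)) (2 - exp (2 * Cmod z)) (exp_pos _) ltac:(lra)).
    rewrite ln_exp in Q. destruct Hb as [_ Hb].
    assert (V : exp (2 * Cmod z) * (1 + exp 1 ^ 2) < b * b * (1 + exp 1 ^ 2))
      by (apply Rmult_lt_compat_r; [generalize (pow2_ge_0 (exp 1)); lra|exact B]).
    specialize (Q ltac:(lra)). lra.
  - intros z Hz. destruct (small z Hz) as [A B]. unfold W, psi_exp.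
    rewrite Cexp_half_log, Cexp_log1m by (unfold in_disk; lra).
    replace (2 * z)%C with (z + z)%C by ring. rewrite Cexp_plus.
    assert (K := one_minus_neq_0 (Cexp (2 * z) - 1)%C ltac:(unfold in_disk; lra)).
    replace (2 * z)%C with (z + z)%C in K by ring. rewrite Cexp_plus in K.
    field. intros X; apply K; rewrite <- X; ring.
Qed.

(** * The sigmoid class *)

Lemma Re_inv_pos (u : C) : 0 < Re u -> 0 < Re (/ u)%C.
Proof.
  intros H. unfold Cinv, Re in *. simpl. apply Rdiv_lt_0_compat; [auto|]. nra.
Qed.

Lemma Re_pos_neq_0 (u : C) : 0 < Re u -> u <> 0.
Proof. intros H ->. simpl in H. lra. Qed.

Lemma radius_sigmoid (rho b : R) : boundary_value b -> exp rho * (2 - b) = b ->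
  is_radius (Sstar frakB) (Sstar psi_sigmoid) rho.
Proof.
  intros Hb Er. assert (N := radius_sigmoid_bounds rho b Hb Er).
  assert (Bb := boundary_value_bounds b Hb).
  assert (Pr := exp_pos rho).
  (* exp rho = b / (2 - b) and b < 4/3. Hence |e^z - 1| < 1 on the disk of radius rho. *)
  assert (e2 : exp rho < 2) by nra.
  assert (G1 : forall z, Cmod z < rho -> Cmod (Cexp z - 1)%C <= exp (Cmod z) - 1 /\ 1 <= exp (Cmod z) < exp rho).
  { intros z Hz. split; [apply Cmod_Cexp_minus_1|]. split; [|apply exp_increasing, Hz].
    rewrite <- exp_0. destruct (Cmod_ge_0 z) as [Q|Q]; [left; apply exp_increasing, Q|right; now rewrite <- Q]. }
  (* With psi = 2 e^z / (1 + e^z) one has psi^2 / (2 - psi^2) = e^(2z) / (1 - G), and [G] has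
     nonnegative coefficients, being half the square of e^z - 1. *)
  set (G := fun z => ((Cexp z - 1) * (Cexp z - 1) / 2)%C).
  assert (G2 : forall z, Cmod z < rho -> Cmod (G z) <= (exp (Cmod z) - 1) ^ 2 / 2).
  { intros z Hz. destruct (G1 z Hz) as [A B]. unfold G.
    assert (T : RtoC 2 <> 0) by (intros X; apply RtoC_inj in X; lra).
    rewrite Cmod_div, Cmod_mult, Cmod_R, Rabs_pos_eq by (auto; lra).
    apply Rmult_le_compat_r; [lra|]. assert (Q := Cmod_ge_0 (Cexp z - 1)%C). nra. }
  assert (G3 : forall z, Cmod z < rho -> in_disk (G z)).
  { intros z Hz. destruct (G1 z Hz) as [A B]. specialize (G2 z Hz). unfold in_disk. nra. }
  assert (nz : forall z, in_disk z -> 0 < Re (1 + Cexp (- z))%C).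
  { intros z Hz. rewrite Re_plus. assert (Q := Re_Cexp_pos (- z)%C (in_disk_opp z Hz)). simpl (Re 1). lra. }
  set (psi' := fun z => (2 * Cexp (- z) / ((1 + Cexp (- z)) * (1 + Cexp (- z))))%C).
  assert (dE : forall z, cderiv (fun z => Cexp (- z)) z (- Cexp (- z))%C).
  { intros z. eapply cderiv_eq; [apply (cderiv_comp Cexp (fun z => - z)%C); [apply cderiv_Cexp|apply cderiv_opp, cderiv_id]|]. ring. }
  assert (d1E : forall z, cderiv (fun z => 1 + Cexp (- z))%C z (0 + - Cexp (- z))%C).
  { intros z. apply cderiv_plus; [apply cderiv_const|apply dE]. }
  assert (T2 : RtoC 2 <> 0) by (intros X; apply RtoC_inj in X; lra).
  set (W := fun z => (z - RtoC (/ 2) * log1m (G z))%C).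
  apply (is_radius_frakB psi_sigmoid psi' rho b W).
  - split.
    + intros z Hz. assert (Q := Re_pos_neq_0 _ (nz z Hz)). unfold psi_sigmoid.
      eapply cderiv_eq; [apply cderiv_div; [exact Q|apply cderiv_const|apply d1E]|].
      unfold psi'. field. auto.
    + intros z Hz. assert (Q := Re_pos_neq_0 _ (nz z Hz)). eexists.
      apply cderiv_div; [apply Cmult_neq_0; auto| |apply cderiv_mult; apply d1E].
      apply cderiv_mult; [apply cderiv_const|apply dE].
  - intros z Hz. assert (Q := Re_pos_neq_0 _ (nz z Hz)). unfold psi', Cdiv.
    apply Cmult_neq_0; [apply Cmult_neq_0; [auto|apply Cexp_neq_0]|]. intros X.
    apply (f_equal (fun u => ((1 + Cexp (- z)) * (1 + Cexp (- z)) * u)%C)) in X.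
    rewrite Cinv_r, Cmult_0_r in X by (apply Cmult_neq_0; auto). apply RtoC_inj in X. lra.
  - unfold psi_sigmoid. replace (- 0)%C with (RtoC 0) by ring. rewrite Cexp_0.
    rewrite <- RtoC_plus, <- RtoC_div by lra. f_equal. lra.
  - intros z Hz. unfold psi_sigmoid, Cdiv. rewrite Re_mult. simpl (Re (RtoC 2)). simpl (Im (RtoC 2)).
    assert (Q := Re_inv_pos _ (nz z Hz)). lra.
  - lra.
  - unfold psi_sigmoid. rewrite <- RtoC_opp, Cexp_RtoC.
    assert (P := exp_pos (- rho)).
    rewrite <- RtoC_plus, <- RtoC_div by lra. f_equal.
    assert (Ei : exp (- rho) = (2 - b) / b).
    { rewrite exp_Ropp. apply (Rmult_eq_reg_l (exp rho)); [|lra]. rewrite Rinv_r by lra.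
      unfold Rdiv. rewrite <- Rmult_assoc, Er. field. lra. }
    rewrite Ei. field. lra.
  - apply Hb.
  - intros z Hz. eexists.
    apply cderiv_minus; [apply cderiv_id|]. apply cderiv_mult; [apply cderiv_const|].
    apply (cderiv_comp log1m G); [apply cderiv_log1m, G3, Hz|]. unfold G.
    apply cderiv_div; [exact T2| |apply cderiv_const].
    apply cderiv_mult; (apply cderiv_minus; [apply cderiv_Cexp|apply cderiv_const]).
  - unfold W, G. rewrite Cexp_0. replace ((1 - 1) * (1 - 1) / 2)%C with (RtoC 0) by (field; auto). rewrite log1m_0. ring.
  - intros z Hz. destruct (G1 z Hz) as [A B]. assert (g2 := G2 z Hz). assert (g3 := G3 z Hz).
    set (u := exp (Cmod z)) in *.
    unfold in_disk, W.
    eapply Rle_lt_trans; [apply Cmod_minus_le|]. rewrite Cmod_half.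
    assert (L := Cmod_log1m_le (G z) g3).
    assert (pos : 0 < 1 - (u - 1) ^ 2 / 2) by nra.
    assert (M : - ln (1 - Cmod (G z)) <= - ln (1 - (u - 1) ^ 2 / 2)).
    { apply Ropp_le_contravar, ln_le; lra. }
    assert (Q := half_log_lt (u ^ 2) (1 - (u - 1) ^ 2 / 2) ltac:(nra) pos).
    rewrite ln_pow in Q by lra. replace (ln u) with (Cmod z) in Q by (symmetry; apply ln_exp). simpl INR in Q.
    (* 2 u / (1 + u) is psi at the real point |z|; it increases with u and equals b at u = exp rho.
       Multiplying the bound of [boundary_value_lt] by (1 + u)^2 gives u^2 < e^2 (1 - (u - 1)^2 /
       2). *)
    assert (X : 2 * u / (1 + u) < b).
    { apply (proj2 (Rlt_div_l _ _ (1 + u) ltac:(lra))). nra. }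
    assert (X0 : 0 < 2 * u / (1 + u)) by (apply Rdiv_lt_0_compat; lra).
    assert (Y := boundary_value_lt b _ Hb (conj (Rlt_le _ _ X0) X)).
    set (p := 2 * u / (1 + u)) in *.
    assert (Ep : p * (1 + u) = 2 * u) by (unfold p; field; lra).
    assert (Y2 : (p * (1 + u)) ^ 2 * (1 + exp 1 ^ 2) < 2 * exp 1 ^ 2 * (1 + u) ^ 2).
    { replace ((p * (1 + u)) ^ 2 * (1 + exp 1 ^ 2)) with (p * p * (1 + exp 1 ^ 2) * (1 + u) ^ 2) by ring.
      apply Rmult_lt_compat_r; [nra|exact Y]. }
    rewrite Ep in Y2. specialize (Q ltac:(nra)). lra.
  - intros z Hz. assert (g3 := G3 z Hz). assert (K := one_minus_neq_0 _ g3).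
    unfold W, psi_sigmoid. rewrite Cexp_half_log, Cexp_log1m by auto.
    assert (Hz1 : in_disk z) by (unfold in_disk; lra).
    assert (Q := Re_pos_neq_0 _ (nz z Hz1)). rewrite Cexp_opp in *.
    assert (E0 := Cexp_neq_0 z).
    assert (Q2 : (Cexp z + 1)%C <> 0).
    { intros X. apply Q. replace (1 + / Cexp z)%C with ((Cexp z + 1) / Cexp z)%C by (field; auto).
      rewrite X. unfold Cdiv. ring. }
    unfold G in *. field. split; [|split]; auto.
    + intros X. apply K.
      replace (1 - (Cexp z - 1) * (Cexp z - 1) / 2)%C with ((2 - (Cexp z - 1) * (Cexp z - 1)) / 2)%C by (field; auto).
      rewrite X. unfold Cdiv. ring.
Qed.

(** * The crescent class *)

(** The principal branch of [sqrt (1 + z ^ 2)] in a form that can be differentiated. *)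
Definition sqrt1p2 (z : C) : C := Cexp (RtoC (/ 2) * log1m (- (z * z))).

Lemma in_disk_sqr (z : C) : in_disk z -> in_disk (- (z * z)).
Proof. unfold in_disk. rewrite Cmod_opp, Cmod_mult. intros H. assert (G := Cmod_ge_0 z). nra. Qed.

Lemma sqrt1p2_sqr (z : C) : in_disk z -> (sqrt1p2 z * sqrt1p2 z)%C = (1 + z * z)%C.
Proof.
  intros Hz. unfold sqrt1p2. rewrite <- Cexp_plus.
  assert (E : (RtoC (/ 2) + RtoC (/ 2))%C = 1%C) by (rewrite <- RtoC_plus; f_equal; lra).
  rewrite <- Cmult_plus_distr_r, E, Cmult_1_l, Cexp_log1m by (apply in_disk_sqr, Hz). ring.
Qed.

Lemma sqrt1p2_neq_0 (z : C) : sqrt1p2 z <> 0.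
Proof. apply Cexp_neq_0. Qed.

Lemma cderiv_sqrt1p2 (z : C) : in_disk z -> cderiv sqrt1p2 z (z / sqrt1p2 z)%C.
Proof.
  intros Hz. unfold sqrt1p2 at 1.
  assert (N := one_minus_neq_0 _ (in_disk_sqr z Hz)).
  eapply cderiv_eq.
  - apply (cderiv_comp Cexp (fun z => RtoC (/ 2) * log1m (- (z * z)))%C); [apply cderiv_Cexp|].
    apply cderiv_mult; [apply cderiv_const|].
    apply (cderiv_comp log1m (fun z => - (z * z))%C); [apply cderiv_log1m, in_disk_sqr, Hz|].
    apply cderiv_opp, cderiv_mult; apply cderiv_id.
  - fold (sqrt1p2 z). assert (S := sqrt1p2_sqr z Hz). assert (S0 := sqrt1p2_neq_0 z).
    replace (1 - - (z * z))%C with (sqrt1p2 z * sqrt1p2 z)%C by (rewrite S; ring).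
    rewrite RtoC_inv by lra. field. auto.
Qed.

Lemma sqrt1p2_0 : sqrt1p2 0 = 1%C.
Proof. unfold sqrt1p2. replace (- (0 * 0))%C with (RtoC 0) by ring. rewrite log1m_0, Cmult_0_r. apply Cexp_0. Qed.

(** On a ray from the origin the real part starts at 1 and cannot vanish: a purely imaginary value
    has a square of nonpositive real part, while Re (1 + z^2) > 0. Positivity is what identifies
    this root with [Csqrt]. *)
Lemma Re_sqrt1p2_pos (z : C) : in_disk z -> 0 < Re (sqrt1p2 z).
Proof.
  intros Hz.
  assert (nz : forall x, in_disk x -> Re (sqrt1p2 x) <> 0).
  { intros x Hx E. assert (S := f_equal Re (sqrt1p2_sqr x Hx)). rewrite Re_mult, Re_plus, E in S. simpl (Re 1) in S.
    assert (A := re_le_Cmod (x * x)%C). rewrite Cmod_mult in A. unfold in_disk in Hx.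
    assert (B := Rle_abs (- Re (x * x)%C)). rewrite Rabs_Ropp in B. assert (G := Cmod_ge_0 x). nra. }
  destruct (Rtotal_order 0 (Re (sqrt1p2 z))) as [L|[L|L]]; [auto|exfalso; apply (nz z Hz); auto|exfalso].
  assert (Hd : forall t, 0 <= t <= 1 -> in_disk (0 + RtoC t * z)%C).
  { intros t Ht. unfold in_disk in *. rewrite Cplus_0_l, Cmod_mult, Cmod_R, Rabs_pos_eq by lra.
    assert (G := Cmod_ge_0 z). nra. }
  destruct (IVT_interv (fun t => - Re (sqrt1p2 (0 + RtoC t * z)%C)) 0 1) as [t [Ht E]].
  - intros t Ht. apply continuity_pt_filterlim, (continuous_opp (fun t => Re (sqrt1p2 (0 + RtoC t * z)%C))).
    apply (ex_derive_continuous (fun t => Re (sqrt1p2 (0 + RtoC t * z)%C))). eexists.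
    exact (proj1 (curve_deriv_comp sqrt1p2 (fun t => 0 + RtoC t * z)%C t _ z (cderiv_sqrt1p2 _ (Hd t Ht)) (curve_deriv_line 0 z t))).
  - lra.
  - replace (0 + RtoC 0 * z)%C with (RtoC 0) by ring. rewrite sqrt1p2_0. simpl. lra.
  - replace (0 + RtoC 1 * z)%C with z by ring. lra.
  - apply (nz _ (Hd t Ht)). lra.
Qed.

Definition crescent (z : C) : C := (z + sqrt1p2 z)%C.

Lemma psi_crescent_eq (z : C) : in_disk z -> psi_crescent z = crescent z.
Proof.
  intros Hz. unfold psi_crescent, crescent. f_equal.
  replace (1 + z ^ 2)%C with (sqrt1p2 z * sqrt1p2 z)%C by (rewrite sqrt1p2_sqr by auto; simpl; ring).
  apply Csqrt_of_sqr, Re_sqrt1p2_pos, Hz.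
Qed.

Lemma crescent_inv (z : C) : in_disk z -> (crescent z * (sqrt1p2 z - z))%C = 1%C.
Proof.
  intros Hz. unfold crescent. transitivity (sqrt1p2 z * sqrt1p2 z - z * z)%C; [ring|].
  rewrite sqrt1p2_sqr by auto. ring.
Qed.

(** Yields 2 - psi^2 = 1 - 2 z psi, the form of the denominator used in [W] and in its
    derivative. *)
Lemma crescent_sqr (z : C) : in_disk z -> (crescent z * crescent z)%C = (1 + 2 * z * crescent z)%C.
Proof.
  intros Hz. unfold crescent. transitivity (sqrt1p2 z * sqrt1p2 z + z * z + 2 * z * sqrt1p2 z)%C; [ring|].
  rewrite sqrt1p2_sqr by auto. ring.
Qed.

Lemma crescent_neq_0 (z : C) : in_disk z -> crescent z <> 0.
Proof.
  intros Hz E. assert (T := crescent_inv z Hz). rewrite E, Cmult_0_l in T. apply RtoC_inj in T. lra.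
Qed.

Lemma cderiv_crescent (z : C) : in_disk z -> cderiv crescent z (crescent z / sqrt1p2 z)%C.
Proof.
  intros Hz. eapply cderiv_eq; [apply cderiv_plus; [apply cderiv_id|apply cderiv_sqrt1p2, Hz]|].
  unfold crescent. field. apply sqrt1p2_neq_0.
Qed.

(** The inverse of psi is s - z, so psi + 1/psi = 2 s has positive real part; a number and its
    inverse have real parts of the same sign. *)
Lemma Re_crescent_pos (z : C) : in_disk z -> 0 < Re (crescent z).
Proof.
  intros Hz. assert (T := crescent_inv z Hz). assert (N := crescent_neq_0 z Hz).
  assert (S := Re_sqrt1p2_pos z Hz).
  assert (E : (crescent z + / crescent z)%C = (sqrt1p2 z + sqrt1p2 z)%C).
  { replace (/ crescent z)%C with (sqrt1p2 z - z)%C; [unfold crescent; ring|].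
    replace (/ crescent z)%C with (/ crescent z * (crescent z * (sqrt1p2 z - z)))%C by (rewrite T; ring).
    field. auto. }
  destruct (Rlt_le_dec 0 (Re (crescent z))) as [L|L]; [auto|exfalso].
  apply (f_equal Re) in E. rewrite !Re_plus in E.
  assert (V : Re (/ crescent z)%C <= 0); [|lra].
  change (Re (crescent z) / (Re (crescent z) ^ 2 + Im (crescent z) ^ 2) <= 0).
  set (x := Re (crescent z)) in *. set (y := Im (crescent z)) in *.
  assert (Q : 0 <= / (x ^ 2 + y ^ 2)).
  { destruct (Req_dec (x ^ 2 + y ^ 2) 0) as [F|F]; [rewrite F, Rinv_0; lra|].
    left. apply Rinv_0_lt_compat. assert (A := pow2_ge_0 x). assert (B := pow2_ge_0 y). lra. }
  unfold Rdiv. nra.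
Qed.

(* With [t = z ^ 2], [2 / (s (1 - 2 z psi)) = 2 ((1 - 2 t) / s + 2 z) / (1 - 8 t)] and
   [((1 - 2 t) / (s (1 - 8 t))) ^ 2 = (1 + 6 t / (1 - 8 t)) (1 + (5 t + 8 t ^ 2) / (1 - 7 t - 8 t ^ 2))]:
   all expansions on the right have nonnegative coefficients. *)
Lemma crescent_derivative_majorant (z : C) (x : R) : Cmod z = x -> 8 * (x * x) < 1 ->
  (1 - 2 * z * crescent z)%C <> 0 /\
  Cmod (2 / (sqrt1p2 z * (1 - 2 * z * crescent z)))%C
    <= 2 / (sqrt (1 + x * x) * (1 - 2 * x * (x + sqrt (1 + x * x)))).
Proof.
  intros Hx H8. assert (x0 : 0 <= x) by (rewrite <- Hx; apply Cmod_ge_0).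
  assert (Hz : in_disk z) by (unfold in_disk; rewrite Hx; nra).
  set (s := sqrt1p2 z) in *. assert (s0 : s <> 0) by apply sqrt1p2_neq_0.
  assert (s2 : (s * s)%C = (1 + z * z)%C) by (apply sqrt1p2_sqr, Hz).
  set (t := (z * z)%C) in *.
  assert (Ht : Cmod t = x * x) by (unfold t; rewrite Cmod_mult, Hx; auto).
  set (y := x * x) in *. assert (y0 : 0 <= y) by (unfold y; nra).
  assert (lb : forall k, 0 <= k -> 1 - k * y <= Cmod (1 - RtoC k * t)%C).
  { intros k Hk. assert (T := Cmod_minus_ge 1%C (RtoC k * t)%C).
    rewrite Cmod_1, Cmod_mult, Cmod_R, Rabs_pos_eq, Ht in T by auto. lra. }
  assert (N8 : (1 - 8 * t)%C <> 0) by (apply Cmod_gt_0; generalize (lb 8 ltac:(lra)); lra).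
  (* Rationalization: 1 - 2 z psi = (1 - 2 t) - 2 z s is multiplied by its conjugate, and s^2 = 1 +
     t leaves 1 - 8 t. *)
  assert (id : ((1 - 2 * z * crescent z) * ((1 - 2 * t) + 2 * z * s) = 1 - 8 * t)%C).
  { unfold crescent. fold s.
    transitivity ((1 - 2 * t) * (1 - 2 * t) - 4 * t * (s * s))%C; [unfold t; ring|].
    rewrite s2. unfold t. ring. }
  assert (N1 : (1 - 2 * z * crescent z)%C <> 0).
  { intros E. apply N8. rewrite <- id, E. ring. }
  split; [auto|].
  assert (E1 : (2 / (s * (1 - 2 * z * crescent z)))%C = (2 * ((1 - 2 * t) / ((1 - 8 * t) * s) + 2 * z / (1 - 8 * t)))%C).
  { replace (2 / (s * (1 - 2 * z * crescent z)))%C with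
     (2 * ((1 - 2 * z * crescent z) * (1 - 2 * t + 2 * z * s)) / ((1 - 8 * t) * s * (1 - 2 * z * crescent z)))%C
     by (rewrite id; field; auto).
    field. auto. }
  set (S := sqrt (1 + y)).
  assert (S1 : 1 <= S) by (unfold S; rewrite <- sqrt_1 at 1; apply sqrt_le_1; lra).
  assert (S2 : S * S = 1 + y) by (apply sqrt_sqrt; lra).
  assert (idr : (1 - 2 * x * (x + S)) * ((1 - 2 * y) + 2 * x * S) = 1 - 8 * y).
  { replace ((1 - 2 * x * (x + S)) * (1 - 2 * y + 2 * x * S)) with ((1 - 2 * y) ^ 2 - 4 * y * (S * S)) by (unfold y; ring).
    rewrite S2. ring. }
  assert (pr : 0 < 1 - 2 * x * (x + S)).
  { assert (0 < 1 - 2 * y + 2 * x * S) by nra. nra. }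
  assert (E2 : 2 / (S * (1 - 2 * x * (x + S))) = 2 * ((1 - 2 * y) / ((1 - 8 * y) * S) + 2 * x / (1 - 8 * y))).
  { replace (2 / (S * (1 - 2 * x * (x + S)))) with
     (2 * ((1 - 2 * x * (x + S)) * (1 - 2 * y + 2 * x * S)) / ((1 - 8 * y) * S * (1 - 2 * x * (x + S))))
     by (rewrite idr; field; lra).
    field. lra. }
  rewrite E1, E2, Cmod_mult, Cmod_R, Rabs_pos_eq by lra.
  apply Rmult_le_compat_l; [lra|]. eapply Rle_trans; [apply Cmod_triangle|].
  assert (i8 : 0 < / Cmod (1 - 8 * t)%C <= / (1 - 8 * y)).
  { assert (Q := lb 8 ltac:(lra)). split; [apply Rinv_0_lt_compat; lra|apply Rinv_le_contravar; lra]. }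
  apply Rplus_le_compat.
  - assert (N7 : (1 - 7 * t - 8 * (t * t))%C <> 0).
    { replace (1 - 7 * t - 8 * (t * t))%C with ((1 - 8 * t) * (s * s))%C by (rewrite s2; fold t; ring).
      repeat apply Cmult_neq_0; auto. }
    assert (sq : ((1 - 2 * t) / ((1 - 8 * t) * s) * ((1 - 2 * t) / ((1 - 8 * t) * s)) =
      (1 + 6 * t / (1 - 8 * t)) * (1 + (5 * t + 8 * (t * t)) / (1 - 7 * t - 8 * (t * t))))%C).
    { transitivity ((1 - 2 * t) * (1 - 2 * t) / ((1 - 8 * t) * (1 - 8 * t) * (s * s)))%C; [field; auto|].
      rewrite s2. fold t. assert (N9 : (1 + t)%C <> 0) by (fold t in s2; rewrite <- s2; apply Cmult_neq_0; auto).
      replace (1 - 7 * t - 8 * (t * t))%C with ((1 - 8 * t) * (1 + t))%C by ring. field. auto. }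
    set (X := Cmod ((1 - 2 * t) / ((1 - 8 * t) * s))%C).
    set (Y := (1 - 2 * y) / ((1 - 8 * y) * S)).
    assert (X0 : 0 <= X) by apply Cmod_ge_0.
    assert (Y0 : 0 < Y) by (unfold Y; apply Rdiv_lt_0_compat; nra).
    assert (A : Cmod (1 + 6 * t / (1 - 8 * t))%C <= 1 + 6 * y / (1 - 8 * y)).
    { eapply Rle_trans; [apply Cmod_triangle|]. rewrite Cmod_1, Cmod_div, Cmod_mult, Cmod_R, Rabs_pos_eq, Ht by (auto; lra).
      apply Rplus_le_compat_l, Rmult_le_compat_l; lra. }
    assert (p7 : 0 < 1 - 7 * y - 8 * (y * y)) by nra.
    assert (l7 : 1 - 7 * y - 8 * (y * y) <= Cmod (1 - 7 * t - 8 * (t * t))%C).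
    { assert (T := Cmod_minus_ge (1 - 7 * t)%C (8 * (t * t))%C).
      rewrite !Cmod_mult, Cmod_R, Rabs_pos_eq, Ht in T by lra. assert (T2 := lb 7 ltac:(lra)). lra. }
    assert (B : Cmod (1 + (5 * t + 8 * (t * t)) / (1 - 7 * t - 8 * (t * t)))%C
      <= 1 + (5 * y + 8 * (y * y)) / (1 - 7 * y - 8 * (y * y))).
    { eapply Rle_trans; [apply Cmod_triangle|]. rewrite Cmod_1, Cmod_div by auto.
      apply Rplus_le_compat_l, Rmult_le_compat; [apply Cmod_ge_0|left; apply Rinv_0_lt_compat; lra| |apply Rinv_le_contravar; lra].
      eapply Rle_trans; [apply Cmod_triangle|]. rewrite !Cmod_mult, !Cmod_R, !Rabs_pos_eq, Ht by lra. lra. }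
    assert (XY : X * X <= Y * Y).
    { unfold X. rewrite <- Cmod_mult, sq, Cmod_mult.
      replace (Y * Y) with ((1 + 6 * y / (1 - 8 * y)) * (1 + (5 * y + 8 * (y * y)) / (1 - 7 * y - 8 * (y * y)))).
      - apply Rmult_le_compat; auto; apply Cmod_ge_0.
      - replace (1 - 7 * y - 8 * (y * y)) with ((1 - 8 * y) * (S * S)) by (rewrite S2; ring).
        unfold Y. assert (D : (1 - 8 * y) * (S * S) + (5 * y + 8 * (y * y)) = 1 - 2 * y) by (rewrite S2; ring).
        replace (1 + (5 * y + 8 * (y * y)) / ((1 - 8 * y) * (S * S))) with ((1 - 2 * y) / ((1 - 8 * y) * (S * S)))
          by (rewrite <- D; field; lra).
        field. lra. }
    nra.
  - rewrite Cmod_div, Cmod_mult, Cmod_R, Rabs_pos_eq, Hx by (auto; lra).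
    apply Rmult_le_compat_l; lra.
Qed.

Lemma sqrt_1_sqr_monotone (x y : R) : 0 <= x < y -> x + sqrt (1 + x * x) < y + sqrt (1 + y * y).
Proof. intros H. apply Rplus_lt_compat; [lra|]. apply sqrt_lt_1; nra. Qed.

Lemma radius_crescent (rho b : R) : boundary_value b -> rho = (b - / b) / 2 ->
  is_radius (Sstar frakB) (Sstar psi_crescent) rho.
Proof.
  intros Hb Er. assert (N := radius_crescent_bounds b Hb). rewrite <- Er in N.
  assert (Bb := boundary_value_bounds b Hb).
  assert (Hbr : rho + sqrt (1 + rho * rho) = b).
  { replace (1 + rho * rho) with (((b + / b) / 2) * ((b + / b) / 2)) by (rewrite Er; field; lra).
    rewrite sqrt_square; [rewrite Er; field; lra|].
    assert (0 < / b) by (apply Rinv_0_lt_compat; lra). lra. }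
  assert (D : forall z, Cmod z < rho -> in_disk z) by (intros; unfold in_disk; lra).
  assert (c1 : forall z, Cmod z < rho -> Cmod (1 - crescent z)%C <= Cmod z + Cmod z * Cmod z).
  { intros z Hz. specialize (D z Hz). assert (S := Re_sqrt1p2_pos z D).
    assert (N1 : (sqrt1p2 z + 1)%C <> 0) by (apply Re_pos_neq_0; rewrite Re_plus; simpl (Re 1); lra).
    (* s - 1 = z^2 / (s + 1) because s^2 = 1 + z^2, and |s + 1| >= 1 because Re s > 0. *)
    replace (1 - crescent z)%C with (- (z + z * z / (sqrt1p2 z + 1)))%C.
    - rewrite Cmod_opp. eapply Rle_trans; [apply Cmod_triangle|].
      rewrite Cmod_div, Cmod_mult by auto. apply Rplus_le_compat_l.
      rewrite <- (Rmult_1_r (Cmod z * Cmod z)) at 2. apply Rmult_le_compat_l; [generalize (Cmod_ge_0 z); nra|].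
      apply Rle_trans with (/ 1); [apply Rinv_le_contravar; [lra|]|rewrite Rinv_1; lra].
      assert (A := re_le_Cmod (sqrt1p2 z + 1)%C). rewrite Re_plus in A. simpl (Re 1) in A.
      assert (B := Rle_abs (Re (sqrt1p2 z) + 1)). lra.
    - unfold crescent. replace (z * z)%C with (sqrt1p2 z * sqrt1p2 z - 1)%C by (rewrite sqrt1p2_sqr by auto; ring).
      field. auto. }
  assert (c2 : forall z, Cmod z < rho -> in_disk (1 - crescent z)).
  { intros z Hz. assert (T := c1 z Hz). assert (G := Cmod_ge_0 z). unfold in_disk. nra. }
  assert (c3 : forall z, Cmod z < rho -> in_disk (2 * z * crescent z)).
  { intros z Hz. assert (T := c1 z Hz). assert (G := Cmod_ge_0 z). unfold in_disk.
    rewrite !Cmod_mult, Cmod_R, Rabs_pos_eq by lra.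
    assert (U : Cmod (crescent z) <= 1 + (Cmod z + Cmod z * Cmod z)).
    { replace (crescent z) with (1 - (1 - crescent z))%C by ring.
      eapply Rle_trans; [apply Cmod_minus_le|]. rewrite Cmod_1. lra. }
    assert (V := Cmod_ge_0 (crescent z)).
    (* Here |z| < 0.29, so |psi| <= 1 + 0.29 + 0.29^2 < 1.4, and 2 times 0.29 times 1.4 is below
       1. *)
    assert (Z2 : Cmod z * Cmod z <= 0.29 * 0.29) by (apply Rmult_le_compat; lra).
    assert (Y : 2 * Cmod z * Cmod (crescent z) <= 2 * 0.29 * 1.4) by (apply Rmult_le_compat; lra). lra. }
  set (W := fun z => (log1m (1 - crescent z) - RtoC (/ 2) * log1m (2 * z * crescent z))%C).
  assert (T2 : RtoC 2 <> 0) by (intros X; apply RtoC_inj in X; lra).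
  (* As psi' = psi / s, W' = psi' / psi + psi psi' / (2 - psi^2) = 2 / (s (2 - psi^2)). *)
  assert (DW : forall z, Cmod z < rho -> cderiv W z (2 / (sqrt1p2 z * (1 - 2 * z * crescent z)))%C).
  { intros z Hz. assert (s0 := sqrt1p2_neq_0 z). assert (n0 := crescent_neq_0 z (D z Hz)).
    assert (n1 := one_minus_neq_0 _ (c3 z Hz)).
    eapply cderiv_eq.
    - apply cderiv_minus.
      + apply (cderiv_comp log1m (fun z => 1 - crescent z)%C); [apply cderiv_log1m, c2, Hz|].
        apply cderiv_minus; [apply cderiv_const|apply cderiv_crescent, D, Hz].
      + apply cderiv_mult; [apply cderiv_const|].
        apply (cderiv_comp log1m (fun z => 2 * z * crescent z)%C); [apply cderiv_log1m, c3, Hz|].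
        apply cderiv_mult; [|apply cderiv_crescent, D, Hz].
        apply cderiv_mult; [apply cderiv_const|apply cderiv_id].
    - assert (Q := crescent_sqr z (D z Hz)).
      transitivity (((1 - 2 * z * crescent z) + (sqrt1p2 z + z) * crescent z) / (sqrt1p2 z * (1 - 2 * z * crescent z)))%C.
      + rewrite RtoC_inv by lra. replace (1 - (1 - crescent z))%C with (crescent z) by ring. field. auto.
      + replace ((sqrt1p2 z + z) * crescent z)%C with (crescent z * crescent z)%C by (unfold crescent; ring).
        rewrite Q. f_equal. ring. }
  (* The formula of [W] on the real axis; its derivative is the right-hand side of
     [crescent_derivative_majorant]. *)
  set (p := fun x => ln (x + sqrt (1 + x * x)) - / 2 * ln (1 - 2 * x * (x + sqrt (1 + x * x)))).
  assert (px : forall x, 0 <= x < rho -> 0 < 1 - 2 * x * (x + sqrt (1 + x * x)) /\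
     0 < x + sqrt (1 + x * x) < b /\ 0 < 1 + x * x).
  { intros x Hx. assert (P1 : 0 < 1 + x * x) by nra.
    assert (P2 : 0 < sqrt (1 + x * x)) by (apply sqrt_lt_R0, P1).
    assert (P3 : x + sqrt (1 + x * x) < b) by (rewrite <- Hbr; apply sqrt_1_sqr_monotone; lra).
    repeat split; try lra. nra. }
  assert (maj : forall z, Cmod z < rho -> Cmod (W z) <= p (Cmod z)).
  { apply (cderiv_majorant W (fun z => 2 / (sqrt1p2 z * (1 - 2 * z * crescent z)))%C p
      (fun x => 2 / (sqrt (1 + x * x) * (1 - 2 * x * (x + sqrt (1 + x * x)))))).
    - exact DW.
    - intros x Hx. destruct (px x Hx) as [A [B Cc]]. unfold p. auto_derive; [repeat split; lra|].
      assert (P2 : 0 < sqrt (1 + x * x)) by (apply sqrt_lt_R0, Cc).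
      assert (S2 : sqrt (1 + x * x) * sqrt (1 + x * x) = 1 + x * x) by (apply sqrt_sqrt; lra).
      set (S := sqrt (1 + x * x)) in *.
      transitivity ((1 - 2 * x * (x + S) + (x + S) * (x + S)) / (S * (1 - 2 * x * (x + S)))).
      + field. repeat split; lra.
      + f_equal. transitivity (1 - x * x + S * S); [ring|]. rewrite S2. ring.
    - intros z Hz. destruct (crescent_derivative_majorant z (Cmod z) eq_refl) as [_ Q]; [generalize (Cmod_ge_0 z); nra|exact Q].
    - unfold W, crescent. rewrite sqrt1p2_0. replace (1 - (0 + 1))%C with (RtoC 0) by ring.
      replace (2 * 0 * (0 + 1))%C with (RtoC 0) by ring. rewrite log1m_0. ring.
    - unfold p. replace (0 + sqrt (1 + 0 * 0)) with 1.
      + replace (1 - 2 * 0 * 1) with 1 by ring. rewrite ln_1. ring.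
      + replace (1 + 0 * 0) with 1 by ring. rewrite sqrt_1. ring. }
  apply (is_radius_frakB psi_crescent (fun z => crescent z / sqrt1p2 z)%C rho b W).
  - split.
    + intros z Hz. apply (cderiv_ext_disk crescent psi_crescent 1); [exact Hz| |apply cderiv_crescent, Hz].
      intros x Hx. symmetry. apply psi_crescent_eq, Hx.
    + intros z Hz. eexists. apply cderiv_div; [apply sqrt1p2_neq_0|apply cderiv_crescent, Hz|apply cderiv_sqrt1p2, Hz].
  - intros z Hz E. apply (crescent_neq_0 z Hz).
    replace (crescent z) with (crescent z / sqrt1p2 z * sqrt1p2 z)%C by (field; apply sqrt1p2_neq_0).
    rewrite E. ring.
  - rewrite psi_crescent_eq by apply in_disk_0. unfold crescent. rewrite sqrt1p2_0. ring.
  - intros z Hz. rewrite psi_crescent_eq by auto. apply Re_crescent_pos, Hz.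
  - lra.
  - unfold psi_crescent. rewrite <- Hbr, RtoC_plus. f_equal.
    assert (S2 : sqrt (1 + rho * rho) * sqrt (1 + rho * rho) = 1 + rho * rho) by (apply sqrt_sqrt; nra).
    replace (1 + RtoC rho ^ 2)%C with (RtoC (sqrt (1 + rho * rho)) * RtoC (sqrt (1 + rho * rho)))%C.
    + apply Csqrt_of_sqr. simpl. apply sqrt_lt_R0. nra.
    + rewrite <- RtoC_mult, S2, RtoC_plus, RtoC_mult. simpl. ring.
  - apply Hb.
  - intros z Hz. eexists. apply DW, Hz.
  - unfold W, crescent. rewrite sqrt1p2_0. replace (1 - (0 + 1))%C with (RtoC 0) by ring.
    replace (2 * 0 * (0 + 1))%C with (RtoC 0) by ring. rewrite log1m_0. ring.
  - intros z Hz. unfold in_disk. eapply Rle_lt_trans; [apply maj, Hz|].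
    destruct (px (Cmod z) (conj (Cmod_ge_0 z) Hz)) as [A [B Cc]]. unfold p.
    set (q := Cmod z + sqrt (1 + Cmod z * Cmod z)) in *.
    assert (S2 : sqrt (1 + Cmod z * Cmod z) * sqrt (1 + Cmod z * Cmod z) = 1 + Cmod z * Cmod z) by (apply sqrt_sqrt; lra).
    assert (Eq : 2 - q * q = 1 - 2 * Cmod z * q) by (unfold q; nra).
    assert (L := boundary_value_lt b q Hb ltac:(lra)).
    assert (H := half_log_lt (q ^ 2) (1 - 2 * Cmod z * q) ltac:(nra) A ltac:(rewrite <- Eq; nra)).
    rewrite ln_pow in H by lra. simpl INR in H. lra.
  - intros z Hz. rewrite psi_crescent_eq by auto. unfold W.
    rewrite Cexp_half_log, !Cexp_log1m by auto.
    assert (n1 := one_minus_neq_0 _ (c3 z Hz)).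
    replace (1 - (1 - crescent z))%C with (crescent z) by ring.
    rewrite (crescent_sqr z) by auto.
    replace (2 - (1 + 2 * z * crescent z))%C with (1 - 2 * z * crescent z)%C by ring. field. auto.
Qed.

(** * The cardioid class *)

Lemma y_sin_le (y : R) : -1 <= y <= 1 -> y * sin y <= y ^ 2 - y ^ 4 / 7.
Proof.
  assert (pos : forall y, 0 <= y <= 1 -> y * sin y <= y ^ 2 - y ^ 4 / 7).
  { intros x Hx. destruct (pre_sin_bound x 0 ltac:(lra) ltac:(lra)) as [_ U].
    unfold sin_approx, sin_term in U. cbn [Nat.mul Nat.add sum_f_R0] in U.
    simpl in U.
    assert (V : sin x <= x - x ^ 3 / 6 + x ^ 5 / 120) by lra.
    assert (x4 : 0 <= x ^ 4) by (apply pow_le; lra).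
    assert (x2 : x ^ 2 <= 1) by nra.
    apply Rle_trans with (x * (x - x ^ 3 / 6 + x ^ 5 / 120)); [apply Rmult_le_compat_l; lra|].
    (* As x^2 <= 1, the last two terms amount to at most -(1/6 - 1/120) x^4 = -(19/120) x^4, and
       19/120 > 1/7. *)
    replace (x * (x - x ^ 3 / 6 + x ^ 5 / 120)) with (x ^ 2 - x ^ 4 / 6 + x ^ 4 * x ^ 2 / 120) by field.
    nra. }
  intros Hy. destruct (Rle_lt_dec 0 y) as [S|S]; [apply pos; lra|].
  replace (y * sin y) with (- y * sin (- y)) by (rewrite sin_neg; ring).
  replace (y ^ 2 - y ^ 4 / 7) with ((- y) ^ 2 - (- y) ^ 4 / 7) by field. apply pos. lra.
Qed.

Lemma cos_ge (y : R) : -1 <= y <= 1 -> 1 - y ^ 2 / 2 <= cos y.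
Proof.
  intros Hy. destruct (pre_cos_bound y 0 ltac:(lra) ltac:(lra)) as [L _].
  unfold cos_approx, cos_term in L. simpl in L. lra.
Qed.

(** Taylor's bound of degree 3 gives exp x <= [T], the coefficient 1/8 being 3 / 4!. Then (1 - x +
    x^2 / 3) [T] <= 1, with 1/3 instead of the true 1/2 leaving the necessary room. *)
Lemma exp_opp_ge (x : R) : 0 <= x <= 1 -> 1 - x + x ^ 2 / 3 <= exp (- x).
Proof.
  intros [[Hx|<-] Hx1]; [|rewrite Ropp_0, exp_0; lra].
  destruct (exp_taylor_bounds 3 x (conj Hx Hx1)) as [_ H].
  unfold exp_taylor in H. cbn [sum_f_R0] in H.
  rewrite !fact_simpl, !mult_INR in H. change (fact 0) with 1%nat in H. cbn [INR] in H.
  rewrite exp_Ropp. assert (P := exp_pos x).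
  set (T := 1 + x + x ^ 2 / 2 + x ^ 3 / 6 + x ^ 4 / 8).
  assert (H' : exp x <= T) by (unfold T; lra).
  apply Rle_trans with (/ T); [|apply Rinv_le_contravar; auto].
  assert (T0 : 0 < T) by lra.
  apply (Rmult_le_reg_r T); [auto|]. rewrite Rinv_l by lra.
  assert (x2 : 0 < x ^ 2) by (apply pow_lt; auto).
  assert (E : (1 - x + x ^ 2 / 3) * T = 1 - x ^ 2 * (1 / 6 - x ^ 2 / 8 + 5 * x ^ 3 / 72 - x ^ 4 / 24)) by (unfold T; field).
  rewrite E. assert (Q : 0 <= 1 / 6 - x ^ 2 / 8 + 5 * x ^ 3 / 72 - x ^ 4 / 24); [|nra].
  assert (A : x ^ 2 <= 1) by nra. assert (B : x ^ 4 <= x ^ 3); [|assert (0 <= x ^ 3) by (apply pow_le; lra); lra].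
  replace (x ^ 4) with (x ^ 3 * x) by ring. assert (0 <= x ^ 3) by (apply pow_le; lra). nra.
Qed.

Lemma Re_cardioid_pos (z : C) : in_disk z -> 0 < Re (1 + z * Cexp z)%C.
Proof.
  intros Hz. set (x := Re z). set (y := Im z).
  assert (n : x ^ 2 + y ^ 2 < 1).
  { unfold x, y. rewrite <- Cmod2_alt. unfold in_disk in Hz. assert (G := Cmod_ge_0 z). nra. }
  replace (Re (1 + z * Cexp z)%C) with (1 - exp x * (y * sin y - x * cos y)) by (unfold x, y, Cexp; c_ring).
  assert (hy : -1 <= y <= 1) by (split; nra). assert (hx : -1 <= x <= 1) by (split; nra).
  assert (P := exp_pos x).
  (* For x >= 0 both sides are compared through polynomials and y is eliminated by y^2 < 1 - x^2;
     for x < 0, exp (-x) >= 1 - x and y sin y < 1 suffice. *)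
  enough (K : y * sin y - x * cos y < exp (- x)).
  { apply (Rmult_lt_compat_l (exp x)) in K; [|auto]. rewrite <- exp_plus, Rplus_opp_r, exp_0 in K. lra. }
  assert (S := y_sin_le y hy).
  assert (y4 : 0 <= y ^ 4) by (replace (y ^ 4) with (y ^ 2 * y ^ 2) by ring; nra).
  destruct (Rle_lt_dec 0 x) as [L|L].
  - assert (C1 := cos_ge y hy). assert (E := exp_opp_ge x ltac:(lra)).
    assert (C2 : x * (1 - y ^ 2 / 2) <= x * cos y) by (apply Rmult_le_compat_l; auto).
    set (s := y ^ 2) in *. replace (y ^ 4) with (s * s) in * by (unfold s; ring).
    assert (s0 : 0 <= s) by (unfold s; nra).
    assert (F : s - s * s / 7 + x * s / 2 < 1 + x ^ 2 / 3); [|lra].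
    (* The left side increases in s on [0, 1], so s is replaced by its upper bound 1 - x^2. *)
    assert (s1 : s - s * s / 7 + x * s / 2 <= (1 - x ^ 2) - (1 - x ^ 2) * (1 - x ^ 2) / 7 + x * (1 - x ^ 2) / 2) by nra.
    assert (Q : x / 2 - 4 * x ^ 2 / 3 - x ^ 3 / 2 - (1 - x ^ 2) * (1 - x ^ 2) / 7 < 0); [|nra].
    assert (x3 : 0 <= x ^ 3) by (apply pow_le; auto). nra.
  - assert (E := exp_ineq1_le (- x)). assert (C1 := COS_bound y).
    assert (C2 : - x * cos y <= - x * 1) by (apply Rmult_le_compat_l; lra). nra.
Qed.

Lemma one_plus_neq_0 (z : C) : in_disk z -> (1 + z)%C <> 0.
Proof.
  intros Hz. replace (1 + z)%C with (1 - - z)%C by ring. apply one_minus_neq_0, in_disk_opp, Hz.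
Qed.

Lemma radius_cardioid (rho b : R) : boundary_value b -> 0 < rho < 1 -> rho * exp rho = b - 1 ->
  is_radius (Sstar frakB) (Sstar psi_cardioid) rho.
Proof.
  intros Hb Hr Er. assert (Bb := boundary_value_bounds b Hb).
  assert (b2 : b * b < 2) by nra.
  assert (N : RtoC 2 <> 0) by (intros X; apply RtoC_inj in X; lra).
  (* With psi = 1 + g and g = z e^z, 2 - psi^2 = 1 - (2 g + g^2): [W] depends on g alone, and [V] is
     that function. *)
  set (V := fun g => (log1m (- g) - RtoC (/ 2) * log1m (2 * g + g * g))%C).
  assert (small : forall g, Cmod g < b - 1 -> in_disk g /\ in_disk (2 * g + g * g) /\
    Cmod (2 * g + g * g)%C <= 2 * Cmod g + Cmod g * Cmod g).
  { intros g Hg. assert (G := Cmod_ge_0 g).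
    assert (A : Cmod (2 * g + g * g)%C <= 2 * Cmod g + Cmod g * Cmod g).
    { eapply Rle_trans; [apply Cmod_triangle|]. rewrite !Cmod_mult, Cmod_R, Rabs_pos_eq by lra. lra. }
    unfold in_disk. repeat split; [lra| |auto]. nra. }
  (* V' = 1 / (1 + g) + (1 + g) / (1 - 2 g - g^2) = 2 / ((1 + g) (1 - 2 g - g^2)). In the expanded
     product every coefficient after the constant is negative, so the reverse triangle inequality is
     sharp at positive g. *)
  assert (DV : forall g, Cmod g < b - 1 -> cderiv V g (2 / (1 - g - 3 * (g * g) - g * (g * g)))%C).
  { intros g Hg. destruct (small g Hg) as [A [B _]].
    assert (n1 := one_plus_neq_0 g A). assert (n2 := one_minus_neq_0 _ B).
    eapply cderiv_eq.
    - apply cderiv_minus.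
      + apply (cderiv_comp log1m (fun g => - g)%C); [apply cderiv_log1m, in_disk_opp, A|apply cderiv_opp, cderiv_id].
      + apply cderiv_mult; [apply cderiv_const|].
        apply (cderiv_comp log1m (fun g => 2 * g + g * g)%C); [apply cderiv_log1m, B|].
        apply cderiv_plus; apply cderiv_mult; try apply cderiv_const; apply cderiv_id.
    - replace (1 - g - 3 * (g * g) - g * (g * g))%C with ((1 + g) * (1 - (2 * g + g * g)))%C by ring.
      rewrite RtoC_inv by lra. replace (1 - - g)%C with (1 + g)%C by ring. field. auto. }
  set (p := fun c => ln (1 + c) - / 2 * ln (1 - 2 * c - c * c)).
  assert (pos : forall c, 0 <= c < b - 1 -> 0 < 1 - 2 * c - c * c) by (intros; nra).
  assert (V0 : V 0%C = 0).
  { unfold V. replace (- 0)%C with (RtoC 0) by ring. replace (2 * 0 + 0 * 0)%C with (RtoC 0) by ring.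
    rewrite log1m_0. ring. }
  assert (maj : forall g, Cmod g < b - 1 -> Cmod (V g) <= p (Cmod g)).
  { apply (cderiv_majorant V (fun g => 2 / (1 - g - 3 * (g * g) - g * (g * g)))%C p
      (fun c => 2 / (1 - c - 3 * (c * c) - c * (c * c)))).
    - exact DV.
    - intros c Hc. specialize (pos c Hc). unfold p. auto_derive; [split; lra|].
      replace (1 - c - 3 * (c * c) - c * (c * c)) with ((1 + c) * (1 - 2 * c - c * c)) by ring.
      field. split; lra.
    - intros g Hg. set (c := Cmod g) in *. assert (c0 : 0 <= c) by apply Cmod_ge_0.
      specialize (pos c (conj c0 Hg)).
      assert (P : 0 < 1 - c - 3 * (c * c) - c * (c * c)).
      { replace (1 - c - 3 * (c * c) - c * (c * c)) with ((1 + c) * (1 - 2 * c - c * c)) by ring.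
        apply Rmult_lt_0_compat; lra. }
      assert (L : 1 - c - 3 * (c * c) - c * (c * c) <= Cmod (1 - g - 3 * (g * g) - g * (g * g))%C).
      { assert (T1 := Cmod_minus_ge (1 - g - 3 * (g * g))%C (g * (g * g))%C).
        assert (T2 := Cmod_minus_ge (1 - g)%C (3 * (g * g))%C).
        assert (T3 := Cmod_minus_ge 1%C g).
        rewrite !Cmod_mult in T1, T2. rewrite Cmod_R, Rabs_pos_eq in T2 by lra. rewrite Cmod_1 in T3. fold c in T1, T2, T3. lra. }
      rewrite Cmod_div, Cmod_R, Rabs_pos_eq by (try lra; apply Cmod_gt_0; lra).
      apply Rmult_le_compat_l; [lra|]. apply Rinv_le_contravar; lra.
    - exact V0.
    - unfold p. replace (1 - 2 * 0 - 0 * 0) with 1 by ring. rewrite Rplus_0_r, ln_1. ring. }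
  set (h := fun z => (z * Cexp z)%C).
  assert (dh : forall z, cderiv h z ((1 + z) * Cexp z)%C).
  { intros z. eapply cderiv_eq; [apply cderiv_mult; [apply cderiv_id|apply cderiv_Cexp]|]. cbv beta. ring. }
  assert (hs : forall z, Cmod z < rho -> Cmod (h z) < b - 1).
  { intros z Hz. unfold h. rewrite Cmod_mult, Cmod_Cexp, <- Er.
    assert (A := re_le_Cmod z). assert (A' := Rle_abs (Re z)).
    assert (E : exp (Re z) < exp rho) by (apply exp_increasing; lra).
    assert (G := Cmod_ge_0 z). assert (P := exp_pos (Re z)). nra. }
  apply (is_radius_frakB psi_cardioid (fun z => (1 + z) * Cexp z)%C rho b (fun z => V (h z))).
  - split; intros z Hz.
    + eapply cderiv_eq; [apply cderiv_plus; [apply cderiv_const|apply dh]|]. ring.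
    + eexists. apply cderiv_mult; [apply cderiv_plus; [apply cderiv_const|apply cderiv_id]|apply cderiv_Cexp].
  - intros z Hz. apply Cmult_neq_0; [apply one_plus_neq_0, Hz|apply Cexp_neq_0].
  - unfold psi_cardioid. ring.
  - apply Re_cardioid_pos.
  - exact Hr.
  - unfold psi_cardioid. rewrite Cexp_RtoC, <- RtoC_mult, Er, <- RtoC_plus. f_equal. ring.
  - apply Hb.
  - intros z Hz. eexists. apply (cderiv_comp V h); [apply DV, hs, Hz|apply dh].
  - unfold h. rewrite Cmult_0_l. exact V0.
  - intros z Hz. unfold in_disk. eapply Rle_lt_trans; [apply maj, hs, Hz|].
    specialize (hs z Hz). set (c := Cmod (h z)) in *. assert (c0 : 0 <= c) by apply Cmod_ge_0.
    specialize (pos c (conj c0 hs)). unfold p.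
    assert (L := boundary_value_lt b (1 + c) Hb ltac:(lra)).
    assert (H := half_log_lt ((1 + c) ^ 2) (1 - 2 * c - c * c) ltac:(nra) pos ltac:(nra)).
    rewrite ln_pow in H by lra. simpl INR in H. lra.
  - intros z Hz. destruct (small _ (hs z Hz)) as [A [B _]].
    assert (n2 := one_minus_neq_0 _ B).
    unfold V, psi_cardioid. rewrite Cexp_half_log, !Cexp_log1m by (auto using in_disk_opp).
    fold (h z). set (g := h z) in *.
    replace (2 - (1 + g) * (1 + g))%C with (1 - (2 * g + g * g))%C by ring. field. auto.
Qed.

(** * The closed forms of the radii *)

Lemma boundary_value_formula : boundary_value (sqrt 2 * exp 1 / sqrt (1 + exp 1 ^ 2)).
Proof.
  assert (P := exp_pos 1). assert (P2 : 0 < 1 + exp 1 ^ 2) by nra.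
  assert (S2 : 0 < sqrt 2) by (apply sqrt_lt_R0; lra).
  assert (S : 0 < sqrt (1 + exp 1 ^ 2)) by (apply sqrt_lt_R0, P2).
  assert (Q2 : sqrt 2 * sqrt 2 = 2) by (apply sqrt_sqrt; lra).
  assert (Q : sqrt (1 + exp 1 ^ 2) * sqrt (1 + exp 1 ^ 2) = 1 + exp 1 ^ 2) by (apply sqrt_sqrt; lra).
  split; [apply Rdiv_lt_0_compat; nra|].
  set (T := sqrt (1 + exp 1 ^ 2)) in *. rewrite <- Q.
  transitivity (sqrt 2 * sqrt 2 * exp 1 ^ 2); [field; lra|rewrite Q2; ring].
Qed.

Theorem theorem4p4 :
  let e := exp 1 in
  (* (i) *)
  (let R1 := 1 + ln (sqrt (2 / (1 + e ^ 2))) in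
   is_radius (Sstar frakB) (Sstar psi_exp) R1 /\
   Rabs (R1 - 0.28311) < 0.000005) /\
  (* (ii) *)
  (let R2 := - ln (/ e * sqrt (2 * (1 + e ^ 2)) - 1) in
   is_radius (Sstar frakB) (Sstar psi_sigmoid) R2 /\
   Rabs (R2 - 0.679492) < 0.0000005) /\
  (* (iii) *)
  (let R3 := (e ^ 2 - 1) / (2 * e * sqrt (2 * (e ^ 2 + 1))) in
   is_radius (Sstar frakB) (Sstar psi_crescent) R3 /\
   Rabs (R3 - 0.2869) < 0.00005) /\
  (* (iv) *)
  (exists R4 : R,
     is_smallest_positive_root
       (fun r => sqrt (1 + e ^ 2) * (1 + r * exp r)) (fun _ => sqrt 2 * e) R4 /\
     is_radius (Sstar frakB) (Sstar psi_cardioid) R4 /\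
     Rabs (R4 - 0.253877) < 0.0000005).
Proof.
  cbv zeta. assert (Hb := boundary_value_formula).
  set (e := exp 1) in *. assert (P : 0 < e) by apply exp_pos.
  set (b := sqrt 2 * e / sqrt (1 + e ^ 2)) in *. assert (Bb := boundary_value_bounds b Hb).
  assert (E2 : 0 < 1 + e ^ 2) by nra.
  assert (b2 : b * b * (1 + e ^ 2) = 2 * e ^ 2) by apply Hb.
  (* The closed forms are expressed through [b]: exp R1 = b, exp (-R2) = (2 - b) / b and R3 = (b -
     1/b) / 2. *)
  assert (eb : sqrt (2 / (1 + e ^ 2)) = b / e).
  { replace (2 / (1 + e ^ 2)) with ((b / e) * (b / e)); [apply sqrt_square, Rlt_le, Rdiv_lt_0_compat; lra|].
    apply (Rmult_eq_reg_r (e ^ 2 * (1 + e ^ 2))); [|nra].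
    transitivity (b * b * (1 + e ^ 2)); [field; lra|]. rewrite b2. field. lra. }
  assert (eb2 : sqrt (2 * (1 + e ^ 2)) = 2 * e / b).
  { replace (2 * (1 + e ^ 2)) with ((2 * e / b) * (2 * e / b)); [apply sqrt_square, Rlt_le, Rdiv_lt_0_compat; lra|].
    apply (Rmult_eq_reg_r (b * b)); [|nra].
    transitivity (2 * (2 * e ^ 2)); [field; lra|]. rewrite <- b2. ring. }
  split; [|split; [|split]].
  - assert (H : exp (1 + ln (sqrt (2 / (1 + e ^ 2)))) = b).
    { rewrite eb, exp_plus, exp_ln by (apply Rdiv_lt_0_compat; lra). fold e. field. lra. }
    split; [apply (radius_exp _ b); auto|].
    assert (Q := radius_exp_bounds _ b Hb H). apply Rabs_def1; lra.
  - assert (H : exp (- ln (/ e * sqrt (2 * (1 + e ^ 2)) - 1)) * (2 - b) = b).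
    { rewrite eb2. replace (/ e * (2 * e / b) - 1) with ((2 - b) / b) by (field; lra).
      rewrite exp_Ropp, exp_ln by (apply Rdiv_lt_0_compat; lra). field. lra. }
    split; [apply (radius_sigmoid _ b); auto|].
    assert (Q := radius_sigmoid_bounds _ b Hb H). apply Rabs_def1; lra.
  - assert (H : (e ^ 2 - 1) / (2 * e * sqrt (2 * (e ^ 2 + 1))) = (b - / b) / 2).
    { rewrite (Rplus_comm (e ^ 2) 1), eb2.
      transitivity (b * (2 * e ^ 2 - (1 + e ^ 2)) / (4 * e ^ 2)); [field; lra|].
      rewrite <- b2 at 1.
      transitivity (b * (b * b - 1) * (1 + e ^ 2) / (2 * (2 * e ^ 2))); [field; lra|]. rewrite <- b2.
      field. lra. }
    rewrite H. split; [apply (radius_crescent _ b); auto|].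
    assert (Q := radius_crescent_bounds b Hb). apply Rabs_def1; lra.
  - assert (Q := radius_cardioid_bounds b Hb).
    destruct (IVT_interv (fun x => x * exp x - (b - 1)) 0.2538765 0.2538775) as [x [Hx Ex]]; try lra.
    { intros x _. apply continuity_pt_filterlim, (ex_derive_continuous (fun x => x * exp x - (b - 1))).
      auto_derive. auto. }
    assert (E : x * exp x = b - 1) by lra.
    assert (S : 0 < sqrt (1 + e ^ 2)) by (apply sqrt_lt_R0, E2).
    assert (R : forall y, sqrt (1 + e ^ 2) * (1 + y * exp y) = sqrt 2 * e <-> y * exp y = b - 1).
    { intros y. assert (K : sqrt 2 * e = sqrt (1 + e ^ 2) * b) by (unfold b; field; lra). rewrite K. split.
      - intros Z. apply Rmult_eq_reg_l in Z; lra.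
      - intros ->. f_equal. ring. }
    exists x. split; [split; [split; [lra|apply R, E]|]|split].
    (* y e^y is strictly increasing for y > 0, so no smaller positive root exists. *)
    + intros y Hy Ey. apply R in Ey. destruct (Rle_lt_dec x y) as [L|L]; [auto|exfalso].
      assert (Z := exp_increasing y x L). assert (Z2 := exp_pos y). nra.
    + apply (radius_cardioid x b); auto. lra.
    (* The intermediate value theorem only places the root in the closed bracket; the strict
       inequalities at the endpoints exclude these. *)
    + destruct (Req_dec x 0.2538765) as [X|N1]; [rewrite X in E; lra|].
      destruct (Req_dec x 0.2538775) as [X|N2]; [rewrite X in E; lra|].
      apply Rabs_def1; lra.
Qed.
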